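(* In the setting of the context, the excess MSE of the generalized Bayes estimator $\hat{\bm\theta}^{\mathrm{Bayes}}$ with weighting function $\pi(\bm\theta)$ is $$\mathrm{XMSE}(\hat{\bm\theta}^{\mathrm{Bayes}})=\|\mathrm{XBias}(\hat{\bm\theta}^{\mathrm{Bayes}})\|_2^2+\mathrm{Tr}[\mathrm{XVar}(\hat{\bm\theta}^{\mathrm{Bayes}})]+\mathrm{Tr}[\mathrm{XVarHPE}(\hat{\bm\theta}^{\mathrm{Bayes}})],\qquad \mathrm{Tr}[\mathrm{XVarHPE}(\hat{\bm\theta}^{\mathrm{Bayes}})]=0,$$ where $$\mathrm{XBias}(\hat{\bm\theta}^{\mathrm{Bayes}})=\sigma^2\mathbf\Sigma^{-1}\left.\frac{\partial\log\pi(\bm\theta)}{\partial\bm\theta}\right|_{\bm\theta=\bm\theta_0},$$ $$\mathrm{XVar}(\hat{\bm\theta}^{\mathrm{Bayes}})=\mathrm{XVar}_\#+\mathrm{XVar}_\#^\top,\qquad \mathrm{XVar}_\#=(\sigma^2)^2\,\mathbf\Sigma^{-1}\left.\frac{\partial^2\log\pi(\bm\theta)}{\partial\bm\theta\,\partial\bm\theta^\top}\right|_{\bm\theta=\bm\theta_0}\mathbf\Sigma^{-1}.$$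
   Context: Model. Fix $n\ge1$, $\sigma^2>0$ (known) and the true parameter $\bm\theta_0\in\mathbb R^n$. For every sample size $N\ge n$ the data are $\bm Y=\mathbf\Phi\bm\theta_0+\bm E\in\mathbb R^N$ with $\bm E\sim\mathcal N(\bm 0,\sigma^2\mathbf I_N)$. Here $\mathbf\Phi=\mathbf\Phi_N\in\mathbb R^{N\times n}$ is the lower triangular Toeplitz matrix with first column $[u(0),\dots,u(N-1)]^\top$, i.e. $[\mathbf\Phi]_{t,k}=u(t-k)$, where the inputs $u(t)$ are deterministic and known with $u(t)=0$ for $t<0$; $\mathrm{rank}(\mathbf\Phi)=n$ for all $N\ge n$. Moreover $\lim_{N\to\infty}\mathbf\Phi^\top\mathbf\Phi/N=\mathbf\Sigma\succ0$. Estimators. $\mathrm{MSE}(\hat{\bm\theta})=\mathbb E[\|\hat{\bm\theta}-\bm\theta_0\|_2^2]$, expectation over $\bm E$. The maximum likelihood estimator is $\hat{\bm\theta}^{\mathrm{ML}}=(\mathbf\Phi^\top\mathbf\Phi)^{-1}\mathbf\Phi^\top\bm Y$. With $p(\bm Y|\bm\theta)$ the density of $\mathcal N(\mathbf\Phi\bm\theta,\sigma^2\mathbf I_N)$ and $\pi(\bm\theta)\ge0$ a weighting function on $\mathbb R^n$ (possibly improper, i.e. $\int\pi\,d\bm\theta=\infty$ is allowed), not depending on the data or on any hyper-parameter, the generalized Bayes estimator is $$\hat{\bm\theta}^{\mathrm{Bayes}}=\frac{\int\bm\theta\,p(\bm Y|\bm\theta)\pi(\bm\theta)\,d\bm\theta}{\int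 p(\bm Y|\bm\theta)\pi(\bm\theta)\,d\bm\theta},$$ both integrands being well-defined and integrable. The excess MSE is $\mathrm{XMSE}(\hat{\bm\theta})=\lim_{N\to\infty}N^2[\mathrm{MSE}(\hat{\bm\theta})-\mathrm{MSE}(\hat{\bm\theta}^{\mathrm{ML}})]$. $\mathrm{XVarHPE}$ denotes the excess variance due to hyper-parameter estimation, the limit of $N^2$ times the sum of the cross covariance, and its transpose, between $\hat{\bm\theta}^{\mathrm{ML}}$ and the change in the estimator caused by replacing the deterministic hyper-parameter $\hat{\bm\eta}(\bm\theta_0)$ by the estimated hyper-parameter; there is no hyper-parameter here, so this change is zero. The derivatives of $\log\pi$ and the moments appearing are understood to exist. *)

(* Defs.v *)
From HB Require Import structures.
From mathcomp Require Import all_boot all_order all_algebra.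
From mathcomp Require Import all_classical all_reals all_analysis.

Set Implicit Arguments.
Unset Strict Implicit.
Unset Printing Implicit Defensive.

Import Order.TTheory GRing.Theory Num.Theory.
Import numFieldNormedType.Exports.

Local Open Scope classical_set_scope.
Local Open Scope ring_scope.

(* R^n as a measurable space is [n.-tuple R] (sigma-algebra generated by the
   coordinates, i.e. Borel sets); R^n as a vector space is ['cV[R]_n].  They are
   identified through [vec]. *)
Notation Rtuple R n := (n.-tuple (measurableTypeR R)).

Definition vec (R : realType) (n : nat) (t : Rtuple R n) : 'cV[R]_n :=
  \col_i tnth t i.

Section lebesgue_step.
Context {R : realType} {n : nat}.
Variable mu : {sigma_finite_measure set (Rtuple R n) -> \bar R}.

Definition pair_cons (x : measurableTypeR R * Rtuple R n) : Rtuple R n.+1 :=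
  [tuple of x.1 :: x.2].

Lemma measurable_pair_cons : measurable_fun setT pair_cons.
Proof. exact: (measurable_cons measurable_fst measurable_snd). Qed.

Definition lebesgue_cons : set (Rtuple R n.+1) -> \bar R :=
  pushforward (lebesgue_measure \x mu)%E pair_cons.

Let lebesgue_cons0 : lebesgue_cons set0 = 0%E.
Proof. by rewrite /lebesgue_cons /pushforward preimage_set0 measure0. Qed.

Let lebesgue_cons_ge0 A : (0 <= lebesgue_cons A)%E.
Proof.
rewrite /lebesgue_cons /pushforward. exact: measure_ge0.
Qed.

Let lebesgue_cons_sigma_additive : semi_sigma_additive lebesgue_cons.
Proof.
move=> F mF tF mUF; rewrite /lebesgue_cons /pushforward preimage_bigcup.
apply: measure_semi_sigma_additive.
- by move=> k; rewrite -[X in measurable X]setTI; exact: measurable_pair_cons.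
- apply/trivIsetP => /= i j _ _ ij; rewrite -preimage_setI.
  by move/trivIsetP : tF => /(_ _ _ _ _ ij) ->//; rewrite preimage_set0.
- rewrite -preimage_bigcup -[X in measurable X]setTI.
  exact: measurable_pair_cons.
Qed.

HB.instance Definition _ := isMeasure.Build _ _ _ lebesgue_cons
  lebesgue_cons0 lebesgue_cons_ge0 lebesgue_cons_sigma_additive.

Let lebesgue_cons_sigma_finite : sigma_finite setT lebesgue_cons.
Proof.
have /sigma_finiteP[F [TF ndF Foo]] := sigma_finiteT (@lebesgue_measure R).
have /sigma_finiteP[G [TG ndG Goo]] := sigma_finiteT mu.
pose uncons (t : Rtuple R n.+1) : measurableTypeR R * Rtuple R n :=
  (tnth t ord0, [tuple of behead t]).
have muncons : measurable_fun setT uncons.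
  apply/measurable_fun_pairP; split; first exact: measurable_tnth.
  exact: measurable_behead.
exists (fun k => uncons @^-1` (F k `*` G k)).
  rewrite -preimage_bigcup (_ : \bigcup_k _ = setT) ?preimage_setT//.
  apply/seteqP; split => // -[x t] _.
  have [k _ Fx] : (\bigcup_k F k) x by rewrite -TF.
  have [l _ Gt] : (\bigcup_k G k) t by rewrite -TG.
  exists (maxn k l) => //; split => /=.
  - by move: x Fx; exact/subsetPset/ndF/leq_maxl.
  - by move: t Gt; exact/subsetPset/ndG/leq_maxr.
move=> k; have [mF Fk] := Foo k; have [mG Gk] := Goo k; split.
  by rewrite -[X in measurable X]setTI; apply: muncons => //; exact: measurableX.
rewrite /lebesgue_cons /pushforward -comp_preimage.
rewrite (_ : uncons \o pair_cons = id); last first.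
  by apply/funext => -[x t]; congr pair; exact: val_inj.
by rewrite preimage_id product_measure1E// lte_mul_pinfty// ge0_fin_numE.
Qed.

HB.instance Definition _ := Measure_isSigmaFinite.Build _ _ _ lebesgue_cons
  lebesgue_cons_sigma_finite.

End lebesgue_step.

(* Lebesgue measure on R^n: the n-fold product of the one-dimensional one. *)
Fixpoint lebesgueRn (R : realType) (n : nat) :
    {sigma_finite_measure set (Rtuple R n) -> \bar R} :=
  match n with
  | 0 => \d_([tuple] : Rtuple R 0)
  | m.+1 => lebesgue_cons (lebesgueRn R m)
  end.

Definition sqnorm (R : realType) (n : nat) (x : 'cV[R]_n) : R :=
  \sum_i x i ord0 ^+ 2.

(* Density of N(m, s2 I_N) at y, with respect to [lebesgueRn R N]. *)
Definition gauss_pdf (R : realType) (N : nat) (s2 : R) (m y : 'cV[R]_N) : R :=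
  (Num.sqrt (2 * pi * s2)) ^- N * expR (- (sqnorm (y - m) / (2 * s2))).

Definition gaussian_noise (d : measure_display) (Omega : measurableType d) (R : realType)
    (P : probability Omega R) (N : nat) (E : {RV P >-> Rtuple R N})
    (s2 : R) : Prop :=
  forall A : set (Rtuple R N), measurable A ->
    distribution P E A
    = (\int[lebesgueRn R N]_(e in A) (gauss_pdf s2 0 (vec e))%:E)%E.

Definition posdefmx (R : realType) (n : nat) (M : 'M[R]_n) : Prop :=
  M^T = M /\
  forall x : 'cV[R]_n, x != 0 -> 0 < (x^T *m M *m x) ord0 ord0.

(* Indices start at 0 here, which leaves the differences t - k unchanged. *)
Definition Phi (R : realType) (u : int -> R) (N n : nat) : 'M[R]_(N, n) :=
  \matrix_(t < N, k < n) u (t%:Z - k%:Z).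

Definition gradient (R : realType) (n : nat) (f : 'cV[R]_n -> R)
    (x : 'cV[R]_n) : 'cV[R]_n :=
  \col_i 'D_(delta_mx i ord0) f x.

Definition hessian (R : realType) (n : nat) (f : 'cV[R]_n -> R)
    (x : 'cV[R]_n) : 'M[R]_n :=
  \matrix_(i, j) 'D_(delta_mx j ord0) (fun y => gradient f y i ord0) x.

Definition twice_differentiable (R : realType) (n : nat) (f : 'cV[R]_n -> R)
    (x : 'cV[R]_n) : Prop :=
  (\forall y \near x, differentiable f y) /\ differentiable (gradient f) x.

(* Indexed by the sample size N. *)
Definition estimator (R : realType) (n : nat) : Type :=
  forall N : nat, 'cV[R]_N -> 'cV[R]_n.

Definition theta_ML (R : realType) (u : int -> R) (n : nat) : estimator R n :=
  fun N y =>
    invmx ((Phi u N n)^T *m Phi u N n) *m (Phi u N n)^T *m y.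

(* Improper weighting functions are covered: [prior] itself is not required to
   be integrable. *)
Definition bayes_integrable (R : realType) (u : int -> R) (n : nat) (s2 : R)
    (prior : 'cV[R]_n -> R) (N : nat) (y : 'cV[R]_N) : Prop :=
  (lebesgueRn R n).-integrable setT
    (fun t => (gauss_pdf s2 (Phi u N n *m vec t) y * prior (vec t))%:E) /\
  forall i : 'I_n, (lebesgueRn R n).-integrable setT
    (fun t => (vec t i ord0 *
               (gauss_pdf s2 (Phi u N n *m vec t) y * prior (vec t)))%:E).

Definition theta_Bayes (R : realType) (u : int -> R) (n : nat) (s2 : R)
    (prior : 'cV[R]_n -> R) : estimator R n :=
  fun N y => \col_i
    ((\int[lebesgueRn R n]_t
        (vec t i ord0 *
         (gauss_pdf s2 (Phi u N n *m vec t) y * prior (vec t)))) /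
     (\int[lebesgueRn R n]_t
        (gauss_pdf s2 (Phi u N n *m vec t) y * prior (vec t)))).

Section model.
Context (R : realType) (n : nat) (u : int -> R) (theta0 : 'cV[R]_n).
Context (d : measure_display) (Omega : measurableType d).
Context (P : probability Omega R) (E : forall N, {RV P >-> Rtuple R N}).

Definition data (N : nat) (w : Omega) : 'cV[R]_N :=
  Phi u N n *m theta0 + vec (E N w).

Definition MSE (est : estimator R n) (N : nat) : \bar R :=
  'E_P[fun w => sqnorm (est N (data N w) - theta0)]%E.

Definition excess_MSE (est : estimator R n) (N : nat) : \bar R :=
  ((N%:R ^+ 2)%:E * (MSE est N - MSE (theta_ML u n) N))%E.

(* Valued in [\bar R], so that an infinite MSE at small N is not hidden. *)
Definition XMSE (est : estimator R n) : \bar R := limn (excess_MSE est).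

Definition cross_covariance (X Y : Omega -> 'cV[R]_n) : 'M[R]_n :=
  \matrix_(i, j) fine (covariance P (fun w => X w i ord0)
                                    (fun w => Y w j ord0)).

(* For an estimator [est eta] depending on a hyper-parameter [eta : H]:
   [eta_hat] is the hyper-parameter estimator and [eta0] the deterministic
   hyper-parameter it is compared with. *)
Definition hpe_change (H : Type) (est : H -> estimator R n)
    (eta_hat : forall N, 'cV[R]_N -> H) (eta0 : H) (N : nat) (w : Omega) :
    'cV[R]_n :=
  est (eta_hat N (data N w)) N (data N w) - est eta0 N (data N w).

Definition excess_var_HPE (H : Type) (est : H -> estimator R n)
    (eta_hat : forall N, 'cV[R]_N -> H) (eta0 : H) (N : nat) : 'M[R]_n :=
  let C := cross_covariance (fun w => theta_ML u n (data N w))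
                            (hpe_change est eta_hat eta0 N) in
  N%:R ^+ 2 *: (C + C^T).

Definition XVarHPE (H : Type) (est : H -> estimator R n)
    (eta_hat : forall N, 'cV[R]_N -> H) (eta0 : H) : 'M[R]_n :=
  limn (excess_var_HPE est eta_hat eta0).

End model.

Definition XBias_Bayes (R : realType) (n : nat) (s2 : R) (Sigma : 'M[R]_n)
    (prior : 'cV[R]_n -> R) (theta0 : 'cV[R]_n) : 'cV[R]_n :=
  s2 *: (invmx Sigma *m gradient (fun theta => ln (prior theta)) theta0).

Definition XVar_sharp_Bayes (R : realType) (n : nat) (s2 : R)
    (Sigma : 'M[R]_n) (prior : 'cV[R]_n -> R) (theta0 : 'cV[R]_n) : 'M[R]_n :=
  s2 ^+ 2 *: (invmx Sigma
              *m hessian (fun theta => ln (prior theta)) theta0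
              *m invmx Sigma).

Definition XVar_Bayes (R : realType) (n : nat) (s2 : R) (Sigma : 'M[R]_n)
    (prior : 'cV[R]_n -> R) (theta0 : 'cV[R]_n) : 'M[R]_n :=
  XVar_sharp_Bayes s2 Sigma prior theta0
  + (XVar_sharp_Bayes s2 Sigma prior theta0)^T.

(* Main.v *)
Require Import Defs.
From HB Require Import structures.
From mathcomp Require Import all_boot all_order all_algebra.
From mathcomp Require Import all_classical all_reals all_analysis.
From mathcomp Require Import measurable_realfun.
From mathcomp Require Import ring lra.

(** The likelihood of [theta] is, up to a factor, the Gaussian weight with
    precision [Q = Phi^T Phi / sigma2] centred at the maximum likelihood estimate
    [m] ([likelihoodE]), so the generalized Bayes estimator is [m + b] where [b]
    ([post_shift]) is the mean displacement from [m] under this weight times the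
    prior ([theta_Bayes_shift]). Writing [x = m - theta0], the two squared errors
    differ by [2 x . b + |b| ^ 2], and everything rests on an expansion of [b].

    Let [g] and [H] be the gradient and the Hessian of the log-prior at [theta0],
    and [C] the inverse of [Q], of order [1 / N]. Dividing the prior by its value
    at [theta0] and expanding gives
    [1 + g . h + h . (H + g g^T) h / 2 + o(|h| ^ 2)] ([prior_expansion]). Against
    a Gaussian weight this polynomial has explicit integrals: all moments come
    from the moment generating function, which translation invariance of
    Lebesgue measure provides by completing the square ([gw_mgf],
    [mgf_moments]). Dividing the numerator of the posterior mean by the evidence,
    the rank one matrix [g g^T] cancels and
    [b = C g + C H x + o(N ^- 1 / 2 * (1 / N + |x| ^ 2))]
    ([quotient_expansion], [post_shift_expansion]).

    The prior may be improper and need not be regular away from [theta0], so the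
    remainder has to be controlled globally. Integrability of likelihood times
    prior at the sample size [n] makes the prior integrable against a fixed
    Gaussian weight ([rel_prior_int]), compared with which the likelihood at
    larger sample sizes is exponentially small outside a neighbourhood of [m]
    ([post_tail]). If [m] itself is far from [theta0], the same comparison gives
    [|b| <= c * (1 + |x|)] ([post_shift_crude]). Both cases combine into a
    pointwise estimate of the excess loss by
    [2 x . C g + 2 x . C H x + |C g| ^ 2], with error
    [eps * (1 / N + |x| ^ 2) ^ 2] plus a constant times [(1 / N + |x| ^ 2) ^ 3]
    ([risk_expansion]).

    Finally [x] is a centred Gaussian vector with covariance [C], so the same
    moment lemmas apply to it: the error has expectation at most a constant
    times [eps * N ^- 2] for large [N], and the main term has expectation
    [2 tr (C H C) + |C g| ^ 2] ([expected_excess_loss]). Multiplying by [N ^ 2]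
    and using [N C --> sigma2 Sigma ^- 1] ([covariance_limit]) gives the squared
    norm of the excess bias plus the trace of the excess variance
    ([excess_MSE_cvg], [limit_riskE]). The contribution of the hyper-parameter
    vanishes identically, the change of the estimator being zero
    ([excess_var_HPE_unit]). *)

Import Order.TTheory GRing.Theory Num.Theory.
Import numFieldNormedType.Exports.
Local Open Scope classical_set_scope.
Local Open Scope ring_scope.
Set Implicit Arguments.
Unset Strict Implicit.
Unset Printing Implicit Defensive.

Ltac nonneg := repeat first [done | exact: ltW | apply: addr_ge0 |
  apply: divr_ge0 | apply: mulr_ge0 | apply: exprn_ge0 | rewrite invr_ge0].

(** * Dot products and norms *)

Section LinearAlgebra.
Context {R : realType}.

Definition dot {n : nat} (x y : 'cV[R]_n) : R := \sum_i x i ord0 * y i ord0.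

Lemma dotC n (x y : 'cV[R]_n) : dot x y = dot y x.
Proof. by apply: eq_bigr => i _; rewrite mulrC. Qed.

Lemma dotDl n (x y z : 'cV[R]_n) : dot (x + y) z = dot x z + dot y z.
Proof. by rewrite -big_split; apply: eq_bigr => i _; rewrite !mxE mulrDl. Qed.

Lemma dotDr n (x y z : 'cV[R]_n) : dot z (x + y) = dot z x + dot z y.
Proof. by rewrite !(dotC z) dotDl. Qed.

Lemma dotZl n a (x y : 'cV[R]_n) : dot (a *: x) y = a * dot x y.
Proof. by rewrite mulr_sumr; apply: eq_bigr => i _; rewrite !mxE mulrA. Qed.

Lemma dotZr n a (x y : 'cV[R]_n) : dot x (a *: y) = a * dot x y.
Proof. by rewrite !(dotC x) dotZl. Qed.

Lemma dotNl n (x y : 'cV[R]_n) : dot (- x) y = - dot x y.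
Proof. by rewrite -scaleN1r dotZl mulN1r. Qed.

Lemma dotNr n (x y : 'cV[R]_n) : dot x (- y) = - dot x y.
Proof. by rewrite !(dotC x) dotNl. Qed.

Lemma dotBl n (x y z : 'cV[R]_n) : dot (x - y) z = dot x z - dot y z.
Proof. by rewrite dotDl dotNl. Qed.

Lemma dotBr n (x y z : 'cV[R]_n) : dot z (x - y) = dot z x - dot z y.
Proof. by rewrite dotDr dotNr. Qed.

Lemma dot0l n (x : 'cV[R]_n) : dot 0 x = 0.
Proof. by rewrite -(scale0r x) dotZl mul0r. Qed.

Lemma dot_mulmx m n (A : 'M[R]_(m, n)) (x : 'cV[R]_m) (y : 'cV[R]_n) :
  dot x (A *m y) = dot (A^T *m x) y.
Proof.
rewrite /dot; under eq_bigr do rewrite mxE mulr_sumr.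
rewrite exchange_big /=; apply: eq_bigr => j _.
rewrite mxE mulr_suml; apply: eq_bigr => i _.
by rewrite !mxE mulrCA mulrA.
Qed.

Lemma dot_sym n (A : 'M[R]_n) (x y : 'cV[R]_n) : A^T = A ->
  dot x (A *m y) = dot (A *m x) y.
Proof. by move=> sA; rewrite dot_mulmx sA. Qed.

Lemma dot_quadE n (A : 'M[R]_n) (x : 'cV[R]_n) :
  dot x (A *m x) = \sum_i \sum_j A i j * (x i ord0 * x j ord0).
Proof.
apply: eq_bigr => i _; rewrite mxE mulr_sumr; apply: eq_bigr => j _; ring.
Qed.

Lemma dot_mxE n (x y : 'cV[R]_n) : dot x y = (x^T *m y) ord0 ord0.
Proof. by rewrite mxE; apply: eq_bigr => i _; rewrite mxE. Qed.

Lemma sqnormE n (x : 'cV[R]_n) : sqnorm x = dot x x.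
Proof. by apply: eq_bigr => i _; rewrite expr2. Qed.

Lemma sqnorm_ge0 n (x : 'cV[R]_n) : 0 <= sqnorm x.
Proof. by apply: sumr_ge0 => i _; exact: sqr_ge0. Qed.

Lemma dot_delta n (x : 'cV[R]_n) i : dot (delta_mx i ord0) x = x i ord0.
Proof.
rewrite /dot (bigD1 i)//= mxE !eqxx mul1r big1 ?addr0// => j ji.
by rewrite mxE (negbTE ji) mul0r.
Qed.

Lemma coef_le_norm m n (x : 'M[R]_(m, n)) i j : `|x i j| <= `|x|.
Proof.
rewrite {2}/Num.norm/= mx_normrE.
exact: (le_bigmax _ (fun ij : 'I_m * 'I_n => `|x ij.1 ij.2|) (i, j)).
Qed.

Lemma norm_le_coef m n (x : 'M[R]_(m, n)) c :
  0 <= c -> (forall i j, `|x i j| <= c) -> `|x| <= c.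
Proof.
move=> c0 xc; rewrite /Num.norm/= mx_normrE.
by apply: bigmax_le => // -[i j] _; exact: xc.
Qed.

Lemma norm_mulmx_le m n p (A : 'M[R]_(m, n)) (B : 'M[R]_(n, p)) :
  `|A *m B| <= n%:R * `|A| * `|B|.
Proof.
apply: norm_le_coef => [|i j]; first by rewrite !mulr_ge0.
rewrite mxE (le_trans (ler_norm_sum _ _ _))//.
apply: (@le_trans _ _ (\sum_(k < n) (`|A| * `|B|))).
  by apply: ler_sum => k _; rewrite normrM ler_pM// coef_le_norm.
by rewrite sumr_const card_ord -mulrA mulr_natl.
Qed.

Lemma norm_dot_le n (x y : 'cV[R]_n) : `|dot x y| <= n%:R * `|x| * `|y|.
Proof.
rewrite (le_trans (ler_norm_sum _ _ _))//.
apply: (@le_trans _ _ (\sum_(k < n) (`|x| * `|y|))).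
  by apply: ler_sum => k _; rewrite normrM ler_pM// coef_le_norm.
by rewrite sumr_const card_ord -mulrA mulr_natl.
Qed.

Lemma norm_quad_le n (A : 'M[R]_n) (x y : 'cV[R]_n) :
  `|dot x (A *m y)| <= n%:R ^+ 2 * `|A| * `|x| * `|y|.
Proof.
apply: (le_trans (norm_dot_le _ _)).
have -> : n%:R ^+ 2 * `|A| * `|x| * `|y| =
  n%:R * `|x| * (n%:R * `|A| * `|y|) by ring.
by rewrite ler_wpM2l ?mulr_ge0// norm_mulmx_le.
Qed.

Lemma norm_exp_le_sum n (x : 'cV[R]_n) k : (0 < n)%N ->
  `|x| ^+ k <= \sum_i `|x i ord0| ^+ k.
Proof.
move=> n0; have [x0|/mx_norm_neq0[[i j] /= xi]] := eqVneq (mx_norm x) 0.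
  rewrite [X in X ^+ _]x0; case: k => [|k].
    under eq_bigr do rewrite expr0.
    by rewrite sumr_const card_ord expr0 ler1n.
  by rewrite exprS mul0r sumr_ge0// => i _; rewrite exprn_ge0.
by rewrite [X in X ^+ _]xi (ord1 j) (bigD1 i)//= lerDl sumr_ge0.
Qed.

Lemma sqr_norm_le_sqnorm n (x : 'cV[R]_n) : (0 < n)%N ->
  `|x| ^+ 2 <= sqnorm x.
Proof.
move=> n0; apply: le_trans (norm_exp_le_sum x 2 n0) _.
by apply: ler_sum => i _; rewrite real_normK ?num_real.
Qed.

Lemma sqnorm_le n (x : 'cV[R]_n) : sqnorm x <= n%:R * `|x| ^+ 2.
Proof.
apply: (@le_trans _ _ (\sum_(k < n) `|x| ^+ 2)).
  apply: ler_sum => i _; rewrite -[leLHS]real_normK ?num_real//.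
  by rewrite lerXn2r ?nnegrE ?coef_le_norm ?normr_ge0.
by rewrite sumr_const card_ord mulr_natl.
Qed.

End LinearAlgebra.

(** * Integration against a weight *)

Section WeightedIntegral.
Context d (T : measurableType d) (R : realType).
Context (mu : {measure set T -> \bar R}) (w : T -> R).
Hypothesis w_ge0 : forall t, 0 <= w t.
Hypothesis mw : measurable_fun setT w.
Implicit Types f g : T -> R.

(** Integrals are taken against a weight [w] instead of a measure of density [w],
    so that posterior weights, the weight dominating the prior and (with [w]
    equal to 1) the law of the noise are handled by the same lemmas. *)
Definition wint (f : T -> R) : Prop :=
  mu.-integrable setT (fun t => (f t * w t)%:E).

Definition wI (f : T -> R) : R := \int[mu]_t (f t * w t).

Lemma eq_wint f g : (forall t, f t = g t) -> wint f -> wint g.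
Proof. by move=> fg; rewrite (_ : g = f)//; apply/funext => t; rewrite fg. Qed.

Lemma eq_wI f g : (forall t, f t = g t) -> wI f = wI g.
Proof. by move=> fg; rewrite (_ : g = f)//; apply/funext => t; rewrite fg. Qed.

Lemma wintD f g : wint f -> wint g -> wint (fun t => f t + g t).
Proof.
move=> If Ig; apply: eq_integrable (integrableD measurableT If Ig) => //= t _.
by rewrite -EFinD mulrDl.
Qed.

Lemma wintZ c f : wint f -> wint (fun t => c * f t).
Proof.
move=> If; apply: eq_integrable (integrableZl measurableT c If) => //= t _.
by rewrite -EFinM mulrA.
Qed.

Lemma wintB f g : wint f -> wint g -> wint (fun t => f t - g t).
Proof.
move=> If /(wintZ (-1)) Ig; apply: eq_wint (wintD If Ig) => t.
by rewrite mulN1r.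
Qed.

Lemma wint0 : wint (fun=> 0).
Proof.
apply: eq_integrable (integrable0 mu setT) => // t _ /=.
by rewrite mul0r.
Qed.

Lemma wint_sum I (s : seq I) (f : I -> T -> R) :
  (forall i, wint (f i)) -> wint (fun t => \sum_(i <- s) f i t).
Proof.
move=> If; elim: s => [|i s IH].
  by apply: eq_wint wint0 => t; rewrite big_nil.
by apply: eq_wint (wintD (If i) IH) => t; rewrite big_cons.
Qed.

Lemma wint_le f g : measurable_fun setT f -> (forall t, `|f t| <= g t) ->
  wint g -> wint f.
Proof.
move=> mf fg; apply: le_integrable => //.
  by apply/measurable_EFinP; exact: measurable_funM.
move=> t _ /=; rewrite lee_fin !normrM ler_pM//.
by rewrite (le_trans (fg t))// ler_norm.
Qed.

Lemma wint_norm f : wint f -> wint (fun t => `|f t|).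
Proof.
move=> /integrable_abse; apply: eq_integrable => //= t _.
by rewrite normrM (ger0_norm (w_ge0 t)).
Qed.

Lemma wID f g : wint f -> wint g -> wI (fun t => f t + g t) = wI f + wI g.
Proof.
move=> If Ig; rewrite /wI -RintegralD//.
by apply: eq_Rintegral => t _; rewrite mulrDl.
Qed.

Lemma wIZ c f : wint f -> wI (fun t => c * f t) = c * wI f.
Proof.
move=> If; rewrite /wI -RintegralZl//.
by apply: eq_Rintegral => t _; rewrite mulrA.
Qed.

Lemma wIB f g : wint f -> wint g -> wI (fun t => f t - g t) = wI f - wI g.
Proof.
move=> If Ig; rewrite -[- wI g]mulN1r -wIZ// -wID//; last exact: wintZ.
by apply: eq_wI => t; rewrite mulN1r.
Qed.

Lemma wI0 : wI (fun=> 0) = 0.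
Proof.
have -> : wI (fun=> 0) = wI (fun=> 0 * 0) by apply: eq_wI => t; rewrite mul0r.
by rewrite wIZ ?mul0r//; exact: wint0.
Qed.

Lemma wI_sum I (s : seq I) (f : I -> T -> R) :
  (forall i, wint (f i)) ->
  wI (fun t => \sum_(i <- s) f i t) = \sum_(i <- s) wI (f i).
Proof.
move=> If; elim: s => [|i s IH].
  rewrite big_nil -[RHS]wI0; apply: eq_wI => t; exact: big_nil.
rewrite big_cons -IH -wID//; last exact: wint_sum.
by apply: eq_wI => t; rewrite big_cons.
Qed.

Lemma wI_ge0 f : (forall t, 0 <= f t) -> 0 <= wI f.
Proof. by move=> f0; apply: Rintegral_ge0 => t _; rewrite mulr_ge0. Qed.

Lemma wI_le f g : wint f -> wint g -> (forall t, f t <= g t) -> wI f <= wI g.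
Proof.
by move=> If Ig fg; apply: le_Rintegral => // t _; rewrite ler_wpM2r.
Qed.

Lemma wI_norm_le f g : wint f -> wint g -> (forall t, `|f t| <= g t) ->
  `|wI f| <= wI g.
Proof.
move=> If Ig fg; rewrite ler_norml; apply/andP; split.
  rewrite -[- wI g]mulN1r -wIZ//; apply: wI_le => //; first exact: wintZ.
  by move=> t; rewrite mulN1r; have := fg t; rewrite ler_norml => /andP[].
by apply: wI_le => // t; rewrite (le_trans (ler_norm _)).
Qed.

End WeightedIntegral.

(** * Bounds on the exponential *)

Section ExpBounds.
Context {R : realType}.

(** [1 + y <= expR y] at [y = x / k], raised to the power [k]. *)
Lemma expr_le_expR (x : R) k : 0 <= x -> x ^+ k <= k%:R ^+ k * expR x.
Proof.
move=> x0; case: k => [|k]; first by rewrite !expr0 mul1r -expR0 ler_expR.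
have k0 : (0 : R) < k.+1%:R by [].
have -> : x ^+ k.+1 = k.+1%:R ^+ k.+1 * (x / k.+1%:R) ^+ k.+1.
  by rewrite -exprMn mulrC divfK ?gt_eqF.
have -> : expR x = expR (x / k.+1%:R) ^+ k.+1.
  by rewrite -expRM_natl mulrC divfK ?gt_eqF.
rewrite ler_wpM2l ?exprn_ge0// lerXn2r ?nnegrE ?expR_ge0 ?divr_ge0//.
by apply: le_trans (expR_ge1Dx _); rewrite lerDr.
Qed.

Lemma expR_norm_le (y : R) : expR `|y| <= expR y + expR (- y).
Proof.
by case: (ger0P y) => _; rewrite ?lerDl ?lerDr expR_ge0.
Qed.

(** The remainder of the exponential series after [p] terms is dominated term
    by term by [`|y| ^+ p] times the series of [expR `|y|]. *)
Lemma expR_taylor_le (y : R) p :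
  `|expR y - \sum_(k < p) y ^+ k / k`!%:R| <= `|y| ^+ p * expR `|y|.
Proof.
have cvgE (z : R) : series (exp_coeff z) n @[n --> \oo] --> expR z.
  exact: is_cvg_series_exp_coeff.
have sE (z : R) n : series (exp_coeff z) n = \sum_(0 <= k < n) z ^+ k / k`!%:R.
  by [].
have cvgR : `|series (exp_coeff y) (n + p)%N - \sum_(k < p) y ^+ k / k`!%:R|
    @[n --> \oo] --> `|expR y - \sum_(k < p) y ^+ k / k`!%:R|.
  apply: cvg_norm; apply: cvgB; last exact: cvg_cst.
  by rewrite (cvg_shiftn p (series (exp_coeff y))).
apply: (ler_cvg_to cvgR (cvg_cst (`|y| ^+ p * expR `|y|))).
apply: nearW => n; rewrite sE.
rewrite (big_cat_nat (leq0n p) (leq_addl n p))/= big_mkord addrC addrK.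
have nd : {homo series (exp_coeff `|y|) : a b / (a <= b)%N >-> a <= b}.
  apply/nondecreasing_seqP => j; rewrite /series/= big_nat_recr//= lerDl.
  by rewrite /exp_coeff/= divr_ge0 ?exprn_ge0.
have le_e : series (exp_coeff `|y|) n <= expR `|y|.
  exact: nondecreasing_cvgn_le.
apply: le_trans (ler_wpM2l (exprn_ge0 p (normr_ge0 y)) le_e).
rewrite sE mulr_sumr (le_trans (ler_norm_sum _ _ _))//.
rewrite -{1}(add0n p) big_addn addnK; apply: ler_sum => k _.
rewrite normrM normrX normfV normr_nat mulrA -exprD addnC.
rewrite ler_wpM2l ?exprn_ge0// lef_pV2 ?posrE ?ltr0n ?fact_gt0//.
by rewrite ler_nat leq_fact ?leq_addl // leq_addr.
Qed.

Lemma expR_taylor4 (y : R) : `|expR y - (1 + y + y ^+ 2 / 2 + y ^+ 3 / 6)| <= y ^+ 4 * expR `|y|.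
Proof.
have -> : 1 + y + y ^+ 2 / 2 + y ^+ 3 / 6 = \sum_(k < 4) y ^+ k / k`!%:R.
  by rewrite !big_ord_recr big_ord0/= !factS fact0; field.
by have := expR_taylor_le y 4; rewrite -normrX [X in X * _]ger0_norm ?exprn_even_ge0.
Qed.

Lemma expR_taylor3 (y : R) : `|expR y - (1 + y + y ^+ 2 / 2)| <= `|y| ^+ 3 * expR `|y|.
Proof.
have -> : 1 + y + y ^+ 2 / 2 = \sum_(k < 3) y ^+ k / k`!%:R.
  by rewrite !big_ord_recr big_ord0/= !factS fact0; field.
exact: expR_taylor_le.
Qed.

Lemma expR_taylor2 (y : R) : `|expR y - (1 + y)| <= y ^+ 2 * expR `|y|.
Proof.
have -> : 1 + y = \sum_(k < 2) y ^+ k / k`!%:R.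
  by rewrite !big_ord_recr big_ord0/= !factS fact0; field.
by have := expR_taylor_le y 2; rewrite -normrX [X in X * _]ger0_norm ?exprn_even_ge0.
Qed.

Lemma eq0_le_linear (c D : R) :
  (forall tau, 0 < tau -> tau <= 1 -> `|c| <= D * tau) -> c = 0.
Proof.
move=> H; apply/normr0_eq0/eqP; rewrite eq_le normr_ge0 andbT.
apply/ler_addgt0Pl => e e0; rewrite addr0.
have D0 : 0 <= D by have := H 1 ltr01 (lexx _); rewrite mulr1; apply: le_trans.
have t0 : 0 < Num.min 1 (e / (D + 1)).
  by rewrite lt_min ltr01 divr_gt0// ltr_wpDl.
apply: le_trans (H _ t0 _) _; first by rewrite ge_min lexx.
apply: (@le_trans _ _ (D * (e / (D + 1)))).
  by rewrite ler_wpM2l// ge_min lexx orbT.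
by rewrite mulrCA ler_piMr ?(ltW e0)// ler_pdivrMr ?mul1r ?lerDl// ltr_wpDl.
Qed.

(** A cubic that is [O(tau ^ 4)] at the origin vanishes; even and odd parts
    are separated by evaluating at [tau] and [- tau]. *)
Lemma cubic_eq0 (c0 c1 c2 c3 D : R) :
  (forall tau, `|tau| <= 1 ->
    `|c0 + c1 * tau + c2 * tau ^+ 2 + c3 * tau ^+ 3| <= D * tau ^+ 4) ->
  [/\ c0 = 0, c1 = 0, c2 = 0 & c3 = 0].
Proof.
move=> H.
have c00 : c0 = 0.
  have := H 0; rewrite normr0 ler01 => /(_ isT).
  rewrite !expr0n/= !mulr0 !addr0 => h.
  by apply/normr0_eq0/eqP; rewrite eq_le h normr_ge0.
subst c0.
have Hp tau : 0 < tau -> tau <= 1 ->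
    `|c1 * tau + c2 * tau ^+ 2 + c3 * tau ^+ 3| <= D * tau ^+ 4.
  move=> t0 t1; have := H tau; rewrite gtr0_norm// add0r; exact.
have Hm tau : 0 < tau -> tau <= 1 ->
    `|- (c1 * tau) + c2 * tau ^+ 2 - c3 * tau ^+ 3| <= D * tau ^+ 4.
  move=> t0 t1; have := H (- tau); rewrite normrN gtr0_norm// add0r => /(_ t1).
  by rewrite mulrN sqrrN (_ : (- tau) ^+ 3 = - tau ^+ 3) ?mulrN;
    [rewrite (_ : (- tau) ^+ 4 = tau ^+ 4)//; ring|ring].
have c20 : c2 = 0.
  apply: (@eq0_le_linear _ D) => tau t0 t1.
  have t20 : 0 < tau ^+ 2 by rewrite exprn_gt0.
  have D0 : 0 <= D.
    by have := Hp _ ltr01 (lexx _); rewrite !expr1n !mulr1; apply: le_trans.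
  have h : `|c2 * tau ^+ 2| <= D * tau ^+ 4.
    have := Hp _ t0 t1; have := Hm _ t0 t1; rewrite !ler_norml; lra.
  apply: (@le_trans _ _ (D * tau ^+ 2)).
    rewrite -(ler_pM2r t20) -{1}(gtr0_norm t20) -normrM (le_trans h)//.
    by rewrite le_eqVlt; apply/orP; left; apply/eqP; ring.
  by rewrite ler_wpM2l// expr2 ler_piMr// ltW.
subst c2.
have Hp' tau : 0 < tau -> tau <= 1 ->
    `|c1 + c3 * tau ^+ 2| <= D * tau ^+ 3.
  move=> t0 t1; have := Hp _ t0 t1.
  rewrite (_ : _ + _ = tau * (c1 + c3 * tau ^+ 2)); last by ring.
  rewrite (_ : D * _ = tau * (D * tau ^+ 3)); last by ring.
  by rewrite normrM gtr0_norm// ler_pM2l.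
have D0 : 0 <= D.
  by have := Hp' _ ltr01 (lexx _); rewrite !expr1n !mulr1; apply: le_trans.
have c10 : c1 = 0.
  apply: (@eq0_le_linear _ (D + `|c3|)) => tau t0 t1.
  have t2 : tau ^+ 2 <= tau by rewrite expr2 ler_piMr// ltW.
  have t3 : tau ^+ 3 <= tau.
    by rewrite exprS ler_piMr ?(ltW t0)// exprn_ile1// ltW.
  have -> : c1 = (c1 + c3 * tau ^+ 2) - c3 * tau ^+ 2 by ring.
  rewrite (le_trans (ler_normB _ _))// mulrDl lerD//.
    by rewrite (le_trans (Hp' _ t0 t1))// ler_wpM2l.
  by rewrite normrM ler_wpM2l// ger0_norm// sqr_ge0.
subst c1; split=> //.
apply: (@eq0_le_linear _ D) => tau t0 t1.
have t20 : 0 < tau ^+ 2 by rewrite exprn_gt0.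
rewrite -(ler_pM2r t20) -{1}(gtr0_norm t20) -normrM.
rewrite -[X in `|X|]add0r (le_trans (Hp' _ t0 t1))//.
by rewrite le_eqVlt; apply/orP; left; apply/eqP; ring.
Qed.

End ExpBounds.

(** * Moments from the moment generating function *)

Section ScalarMoments.
Context d (T : measurableType d) (R : realType).
Context (mu : {measure set T -> \bar R}) (w : T -> R).
Hypothesis w_ge0 : forall t, 0 <= w t.
Hypothesis mw : measurable_fun setT w.
Context (v : T -> R) (K q : R).
Hypothesis mv : measurable_fun setT v.
Hypothesis q_ge0 : 0 <= q.
Hypothesis K_ge0 : 0 <= K.
Hypothesis mgf_int : forall tau, wint mu w (fun t => expR (tau * v t)).
Hypothesis mgf : forall tau,
  wI mu w (fun t => expR (tau * v t)) = K * expR (tau ^+ 2 * q / 2).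

Local Lemma wint_cosh a :
  wint mu w (fun t => expR (a * v t) + expR (- a * v t)).
Proof. by apply: wintD. Qed.

Lemma mgf_wint_pow k : wint mu w (fun t => v t ^+ k).
Proof.
apply: (wint_le mw _ _ (wintZ (k%:R ^+ k) (wint_cosh 1))).
  exact: measurable_funX.
move=> t; rewrite normrX mul1r mulN1r.
apply: le_trans (expr_le_expR k (normr_ge0 (v t))) _.
by rewrite ler_wpM2l ?exprn_ge0// expR_norm_le.
Qed.

(** Scaling by [a = Num.sqrt Lam ^- 1] makes the exponentials of [a * v] and
    [- a * v], which dominate every power of [a * v], have bounded integrals;
    hence the even moments are of the Gaussian order [Lam ^+ k]. *)
Lemma mgf_moment_le (Lam : R) k : 0 < Lam -> q <= Lam ->
  wI mu w (fun t => v t ^+ (2 * k)) <=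
    (2 * k)%:R ^+ (2 * k) * 2 * expR (2^-1) * K * Lam ^+ k.
Proof.
move=> L0 qL; set a : R := (Num.sqrt Lam)^-1.
have a2 : a ^+ 2 = Lam^-1 by rewrite exprVn sqr_sqrtr ?ltW.
have mgfa (s : R) : s ^+ 2 = Lam^-1 ->
    wI mu w (fun t => expR (s * v t)) <= K * expR 2^-1.
  move=> sL; rewrite mgf ler_wpM2l// ler_expR sL ler_pdivrMr// mulVf//.
  by rewrite mulrC ler_pdivrMr// mul1r.
set c : R := (2 * k)%:R ^+ (2 * k).
have -> : c * 2 * expR 2^-1 * K * Lam ^+ k =
  Lam ^+ k * c * (K * expR 2^-1 + K * expR 2^-1) by ring.
apply: (@le_trans _ _ (Lam ^+ k * c *
  (wI mu w (fun t => expR (a * v t)) + wI mu w (fun t => expR (- a * v t))))).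
  rewrite -wID// -wIZ; last exact: wint_cosh.
  apply: wI_le => //.
  - exact: mgf_wint_pow.
  - by apply: wintZ; exact: wint_cosh.
  - move=> t; rewrite -mulrA -ler_pdivrMl ?exprn_gt0// -exprVn -a2 -exprM.
    have -> : a ^+ (2 * k) * v t ^+ (2 * k) = `|a * v t| ^+ (2 * k).
      rewrite -normrX -exprMn exprM ger0_norm//.
      by apply: exprn_ge0; exact: sqr_ge0.
    apply: le_trans (expr_le_expR _ (normr_ge0 _)) _.
    by rewrite ler_wpM2l ?exprn_ge0// mulNr expR_norm_le.
rewrite ler_wpM2l ?mulr_ge0 ?exprn_ge0 ?(ltW L0)// lerD// mgfa//.
by rewrite sqrrN.
Qed.

(** The moment generating function agrees with its third order Taylor
    polynomial up to [O(tau ^ 4)], so the first three moments can be read off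
    by comparing coefficients. *)
Lemma mgf_moments : [/\ wI mu w (fun=> 1) = K, wI mu w v = 0,
  wI mu w (fun t => v t ^+ 2) = K * q & wI mu w (fun t => v t ^+ 3) = 0].
Proof.
have I1 : wint mu w (fun=> 1).
  by apply: eq_wint (mgf_wint_pow 0) => t; rewrite expr0.
have Iv : wint mu w v.
  by apply: eq_wint (mgf_wint_pow 1) => t; rewrite expr1.
have Ik := mgf_wint_pow.
set m0 := wI mu w (fun=> 1); set m1 := wI mu w v.
set m2 := wI _ _ (fun t => v t ^+ 2); set m3 := wI _ _ (fun t => v t ^+ 3).
(* An integrable majorant of the fourth order remainder; [256 = 4 ^ 4] is the
   constant of [expr_le_expR]. *)
pose dom t : R := 256 * (expR (2 * v t) + expR (- 2 * v t) + 2).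
have Idom : wint mu w dom.
  apply: wintZ; apply: wintD => //; first exact: wint_cosh.
  by apply: eq_wint (wintZ 2 I1) => t; rewrite mulr1.
have vdom t : v t ^+ 4 * expR `|v t| <= dom t.
  have e0 := expR_ge0 `|v t|.
  have h : v t ^+ 4 <= 256 * expR `|v t|.
    have -> : v t ^+ 4 = `|v t| ^+ 4 by rewrite -normrX ger0_norm ?exprn_even_ge0.
    apply: le_trans (expr_le_expR 4 (normr_ge0 (v t))) _.
    by rewrite ler_wpM2r// -natrX.
  apply: le_trans (ler_wpM2r e0 h) _.
  rewrite -mulrA ler_wpM2l// -expr2 -expRM_natl.
  apply: le_trans (_ : expR `|2 * v t| <= _).
    by rewrite normrM (ger0_norm (ler0n _ 2)).
  by apply: le_trans (expR_norm_le _) _; rewrite -mulNr lerDl.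
pose D := wI mu w dom + K * (q ^+ 2 / 4 * expR (q / 2)).
have [|h0 h1 h2 h3] := @cubic_eq0 R (m0 - K) m1 ((m2 - K * q) / 2) (m3 / 6) D.
  move=> tau tau1.
  have t2 : tau ^+ 2 <= 1 by rewrite -[leLHS]real_normK ?num_real// exprn_ile1.
  have t4 : 0 <= tau ^+ 4 by rewrite exprn_even_ge0.
  pose T3 t := 1 + tau * v t + tau ^+ 2 / 2 * v t ^+ 2 + tau ^+ 3 / 6 * v t ^+ 3.
  have It1 := wintD I1 (wintZ tau Iv).
  have It2 := wintD It1 (wintZ (tau ^+ 2 / 2) (Ik 2)).
  have IT3 : wint mu w T3 := wintD It2 (wintZ (tau ^+ 3 / 6) (Ik 3)).
  have ET3 : wI mu w T3 = m0 + tau * m1 + tau ^+ 2 / 2 * m2 + tau ^+ 3 / 6 * m3.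
    by rewrite !wID ?wIZ//; exact: wintZ.
  have A : `|K * expR (tau ^+ 2 * q / 2) - wI mu w T3| <= tau ^+ 4 * wI mu w dom.
    rewrite -mgf -wIB// -wIZ//; apply: wI_norm_le => //.
    - exact: wintB.
    - exact: wintZ.
    - move=> t; have := expR_taylor4 (tau * v t).
      have -> : 1 + tau * v t + (tau * v t) ^+ 2 / 2 + (tau * v t) ^+ 3 / 6 = T3 t.
        by rewrite /T3; field.
      move=> /le_trans; apply; rewrite exprMn -mulrA ler_wpM2l//.
      apply: le_trans (vdom t); rewrite ler_wpM2l ?exprn_even_ge0// ler_expR.
      by rewrite normrM ler_piMl.
  have B : `|expR (tau ^+ 2 * q / 2) - (1 + tau ^+ 2 * q / 2)| <=
      tau ^+ 4 * (q ^+ 2 / 4 * expR (q / 2)).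
    apply: le_trans (expR_taylor2 _) _.
    have -> : (tau ^+ 2 * q / 2) ^+ 2 = tau ^+ 4 * (q ^+ 2 / 4) by field.
    rewrite -[X in X <= _]mulrA (ler_wpM2l t4)// ler_wpM2l//.
      by rewrite mulr_ge0 ?sqr_ge0.
    rewrite ler_expR ger0_norm; last first.
      by apply: divr_ge0 => //; apply: mulr_ge0 => //; exact: sqr_ge0.
    by rewrite ler_wpM2r// ler_piMl.
  have -> : m0 - K + m1 * tau + (m2 - K * q) / 2 * tau ^+ 2 + m3 / 6 * tau ^+ 3 =
    K * (expR (tau ^+ 2 * q / 2) - (1 + tau ^+ 2 * q / 2)) -
    (K * expR (tau ^+ 2 * q / 2) - wI mu w T3).
    by rewrite ET3; field.
  rewrite (le_trans (ler_normB _ _))// /D mulrDl addrC lerD//.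
    by rewrite [leRHS]mulrC.
  rewrite normrM (ger0_norm K_ge0) -[leRHS]mulrA ler_wpM2l//.
  by rewrite [leRHS]mulrC.
by split; lra.
Qed.

End ScalarMoments.

(** * Gaussian vectors *)

Section MeasurableVector.
Context d (T : measurableType d) (R : realType).

Definition mcv m n (X : T -> 'M[R]_(m, n)) : Prop :=
  forall i j, measurable_fun setT (fun t => X t i j).

Lemma mcv_cst m n (A : 'M[R]_(m, n)) : mcv (fun=> A).
Proof. by move=> i j; exact: measurable_cst. Qed.

Lemma mcvD m n (X Y : T -> 'M[R]_(m, n)) : mcv X -> mcv Y ->
  mcv (fun t => X t + Y t).
Proof.
move=> mX mY i j; under eq_fun do rewrite mxE.
exact: measurable_funD.
Qed.

Lemma mcvN m n (X : T -> 'M[R]_(m, n)) : mcv X -> mcv (fun t => - X t).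
Proof.
move=> mX i j; under eq_fun do rewrite mxE.
exact: measurableT_comp.
Qed.

Lemma mcvB m n (X Y : T -> 'M[R]_(m, n)) : mcv X -> mcv Y ->
  mcv (fun t => X t - Y t).
Proof. by move=> mX mY; apply: mcvD => //; exact: mcvN. Qed.

Lemma mcvM m n p (X : T -> 'M[R]_(m, n)) (Y : T -> 'M[R]_(n, p)) :
  mcv X -> mcv Y -> mcv (fun t => X t *m Y t).
Proof.
move=> mX mY i j; under eq_fun do rewrite mxE.
by apply: measurable_sum => k; exact: measurable_funM.
Qed.

Lemma measurable_dot n (X Y : T -> 'cV[R]_n) : mcv X -> mcv Y ->
  measurable_fun setT (fun t => dot (X t) (Y t)).
Proof.
by move=> mX mY; apply: measurable_sum => k; exact: measurable_funM.
Qed.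

Lemma measurable_sqnorm n (X : T -> 'cV[R]_n) : mcv X ->
  measurable_fun setT (fun t => sqnorm (X t)).
Proof.
move=> mX; under eq_fun do rewrite sqnormE.
exact: measurable_dot.
Qed.

End MeasurableVector.

Lemma mcv_vec (R : realType) n : mcv (@vec R n).
Proof.
move=> i j; under eq_fun do rewrite mxE.
exact: measurable_tnth.
Qed.

Section VectorMoments.
Context d (T : measurableType d) (R : realType).
Context (mu : {measure set T -> \bar R}) (w : T -> R).
Hypothesis w_ge0 : forall t, 0 <= w t.
Hypothesis mw : measurable_fun setT w.
Context (n : nat) (X : T -> 'cV[R]_n) (K : R) (C : 'M[R]_n).
Hypothesis mX : mcv X.
Hypothesis C_sym : C^T = C.
Hypothesis C_psd : forall a, 0 <= dot a (C *m a).
Hypothesis K_ge0 : 0 <= K.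
Hypothesis mgf_int : forall a, wint mu w (fun t => expR (dot a (X t))).
Hypothesis mgf : forall a,
  wI mu w (fun t => expR (dot a (X t))) = K * expR (dot a (C *m a) / 2).

Let mgf_int1 a tau : wint mu w (fun t => expR (tau * dot a (X t))).
Proof. by apply: eq_wint (mgf_int (tau *: a)) => t; rewrite dotZl. Qed.

Let mgf1 a tau : wI mu w (fun t => expR (tau * dot a (X t))) =
  K * expR (tau ^+ 2 * dot a (C *m a) / 2).
Proof.
rewrite -(_ : dot (tau *: a) (C *m (tau *: a)) = tau ^+ 2 * dot a (C *m a)).
  by rewrite -mgf; apply: eq_wI => t; rewrite dotZl.
by rewrite -scalemxAr dotZl dotZr mulrA.
Qed.

Let mdot a : measurable_fun setT (fun t => dot a (X t)).
Proof. by apply: measurable_dot => //; exact: mcv_cst. Qed.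

(** Every moment below is derived from the moment generating function alone,
    so the results hold both for the posterior weight and for the law of the
    maximum likelihood error. *)
Lemma gaussian_wint_pow a k : wint mu w (fun t => dot a (X t) ^+ k).
Proof. exact: (mgf_wint_pow mw (mdot a) (mgf_int1 a)). Qed.

Lemma gaussian_wint1 : wint mu w (fun=> 1).
Proof. by apply: eq_wint (gaussian_wint_pow 0 0) => t; rewrite expr0. Qed.

Lemma gaussian_wint_dot a : wint mu w (fun t => dot a (X t)).
Proof. by apply: eq_wint (gaussian_wint_pow a 1) => t; rewrite expr1. Qed.

Let moments a := mgf_moments w_ge0 mw (mdot a) (C_psd a) K_ge0 (mgf_int1 a) (mgf1 a).

Lemma gaussian_mass : wI mu w (fun=> 1) = K.
Proof. by have [] := moments 0. Qed.

Lemma gaussian_dot a : wI mu w (fun t => dot a (X t)) = 0.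
Proof. by have [] := moments a. Qed.

(* The mixed moments are obtained from the pure ones by polarization. *)
Let pol2 a b t : dot a (X t) * dot b (X t) =
  4^-1 * (dot (a + b) (X t) ^+ 2 - dot (a - b) (X t) ^+ 2).
Proof. by rewrite dotBl dotDl; field. Qed.

Lemma gaussian_wint_dot2 a b : wint mu w (fun t => dot a (X t) * dot b (X t)).
Proof.
apply: eq_wint (wintZ 4^-1
  (wintB (gaussian_wint_pow (a + b) 2) (gaussian_wint_pow (a - b) 2))) => t.
by rewrite pol2.
Qed.

Lemma gaussian_dot2 a b :
  wI mu w (fun t => dot a (X t) * dot b (X t)) = K * dot a (C *m b).
Proof.
have [_ _ hp _] := moments (a + b); have [_ _ hm _] := moments (a - b).
under eq_wI do rewrite pol2.
have Ip := gaussian_wint_pow (a + b) 2; have Im := gaussian_wint_pow (a - b) 2.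
rewrite wIZ ?wIB//; last exact: wintB.
rewrite hp hm mulmxBr mulmxDr !dotBl !dotBr !dotDl !dotDr.
have -> : dot b (C *m a) = dot a (C *m b) by rewrite dot_sym// dotC.
by field.
Qed.

Let pol3 a b c t : dot a (X t) * dot b (X t) * dot c (X t) =
  24^-1 * ((dot (a + b + c) (X t) ^+ 3 - dot (a + b - c) (X t) ^+ 3) -
           (dot (a - b + c) (X t) ^+ 3 - dot (a - b - c) (X t) ^+ 3)).
Proof. by rewrite !(dotBl, dotDl); field. Qed.

Lemma gaussian_wint_dot3 a b c :
  wint mu w (fun t => dot a (X t) * dot b (X t) * dot c (X t)).
Proof.
apply: eq_wint (wintZ 24^-1 (wintB
  (wintB (gaussian_wint_pow (a + b + c) 3) (gaussian_wint_pow (a + b - c) 3))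
  (wintB (gaussian_wint_pow (a - b + c) 3) (gaussian_wint_pow (a - b - c) 3))))
  => t.
by rewrite pol3.
Qed.

Lemma gaussian_dot3 a b c :
  wI mu w (fun t => dot a (X t) * dot b (X t) * dot c (X t)) = 0.
Proof.
under eq_wI do rewrite pol3.
have Ip := gaussian_wint_pow ^~ 3.
have h e : wI mu w (fun t => dot e (X t) ^+ 3) = 0 by have [] := moments e.
have IB e f := wintB (Ip e) (Ip f).
by rewrite wIZ ?wIB ?h ?subr0 ?mulr0//; exact: wintB.
Qed.

Let quadE (M : 'M[R]_n) t : dot (X t) (M *m X t) =
  \sum_i \sum_j M i j * (dot (delta_mx i ord0) (X t) * dot (delta_mx j ord0) (X t)).
Proof.
rewrite dot_quadE; apply: eq_bigr => i _; apply: eq_bigr => j _.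
by rewrite !dot_delta.
Qed.

Lemma gaussian_wint_quad (M : 'M[R]_n) :
  wint mu w (fun t => dot (X t) (M *m X t)).
Proof.
apply: eq_wint (_ : wint mu w (fun t => \sum_i \sum_j
  M i j * (dot (delta_mx i ord0) (X t) * dot (delta_mx j ord0) (X t)))) => [t|].
  by rewrite quadE.
apply: wint_sum => i; apply: wint_sum => j.
by apply: wintZ; exact: gaussian_wint_dot2.
Qed.

Lemma gaussian_quad (M : 'M[R]_n) :
  wI mu w (fun t => dot (X t) (M *m X t)) = K * \tr (M *m C).
Proof.
under eq_wI do rewrite quadE.
have I2 i j : wint mu w (fun t => M i j *
    (dot (delta_mx i ord0) (X t) * dot (delta_mx j ord0) (X t))).
  by apply: wintZ; exact: gaussian_wint_dot2.
rewrite wI_sum; last by move=> i; exact: wint_sum.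
rewrite /mxtrace mulr_sumr; apply: eq_bigr => i _.
rewrite wI_sum// mxE mulr_sumr; apply: eq_bigr => j _.
rewrite wIZ; last exact: gaussian_wint_dot2.
rewrite gaussian_dot2 dot_delta.
rewrite -(colE j C : _ = _ *m delta_mx j ord0) mxE.
by rewrite -[in C i j]C_sym mxE mulrCA.
Qed.

Lemma gaussian_wint_dot_quad a (M : 'M[R]_n) :
  wint mu w (fun t => dot a (X t) * dot (X t) (M *m X t)).
Proof.
apply: eq_wint (_ : wint mu w (fun t => \sum_i \sum_j M i j *
  (dot a (X t) * dot (delta_mx i ord0) (X t) * dot (delta_mx j ord0) (X t))))
  => [t|].
  rewrite quadE mulr_sumr; apply: eq_bigr => i _.
  rewrite mulr_sumr; apply: eq_bigr => j _; ring.
apply: wint_sum => i; apply: wint_sum => j.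
by apply: wintZ; exact: gaussian_wint_dot3.
Qed.

Lemma gaussian_dot_quad a (M : 'M[R]_n) :
  wI mu w (fun t => dot a (X t) * dot (X t) (M *m X t)) = 0.
Proof.
have I3 i j : wint mu w (fun t => M i j *
  (dot a (X t) * dot (delta_mx i ord0) (X t) * dot (delta_mx j ord0) (X t))).
  by apply: wintZ; exact: gaussian_wint_dot3.
transitivity (wI mu w (fun t => \sum_i \sum_j M i j *
  (dot a (X t) * dot (delta_mx i ord0) (X t) * dot (delta_mx j ord0) (X t)))).
  apply: eq_wI => t; rewrite quadE mulr_sumr; apply: eq_bigr => i _.
  rewrite mulr_sumr; apply: eq_bigr => j _; ring.
rewrite wI_sum; last by move=> i; exact: wint_sum.
rewrite big1// => i _; rewrite wI_sum// big1// => j _.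
rewrite wIZ; last exact: gaussian_wint_dot3.
by rewrite gaussian_dot3 mulr0.
Qed.

(** A majorant of the powers of the sup norm whose integral reduces to scalar
    moments. *)
Definition powsum (x : 'cV[R]_n) k : R := \sum_i x i ord0 ^+ (2 * k).

Lemma powsum_ge0 x k : 0 <= powsum x k.
Proof.
by apply: sumr_ge0 => i _; rewrite exprM; apply: exprn_ge0; exact: sqr_ge0.
Qed.

Lemma norm_le_powsum (x : 'cV[R]_n) k : (0 < n)%N ->
  `|x| ^+ (2 * k) <= powsum x k.
Proof.
move=> n0; apply: le_trans (norm_exp_le_sum x (2 * k) n0) _.
apply: ler_sum => i _; rewrite !exprM real_normK ?num_real//.
Qed.

Lemma gaussian_wint_powsum k : wint mu w (fun t => powsum (X t) k).
Proof.
apply: wint_sum => i.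
apply: eq_wint (gaussian_wint_pow (delta_mx i ord0) (2 * k)) => t.
by rewrite dot_delta.
Qed.

Lemma gaussian_powsum_le (Lam : R) k : 0 < Lam -> (forall i, C i i <= Lam) ->
  wI mu w (fun t => powsum (X t) k) <=
  n%:R * ((2 * k)%:R ^+ (2 * k) * 2 * expR (2^-1)) * K * Lam ^+ k.
Proof.
move=> L0 CL; rewrite wI_sum; last first.
  move=> i; apply: eq_wint (gaussian_wint_pow (delta_mx i ord0) (2 * k)) => t.
  by rewrite dot_delta.
rewrite -!mulrA mulr_natl -[n in X in _ <= X]card_ord -sumr_const.
apply: ler_sum => i _; rewrite !mulrA.
have Cii : dot (delta_mx i ord0) (C *m delta_mx i ord0) = C i i.
  by rewrite dot_delta -(colE i C : _ = _ *m delta_mx i ord0) mxE.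
have := mgf_moment_le w_ge0 mw (mdot (delta_mx i ord0)) K_ge0
  (mgf_int1 (delta_mx i ord0)) (mgf1 (delta_mx i ord0)) k L0.
rewrite Cii => /(_ (CL i)); apply: le_trans.
rewrite le_eqVlt; apply/orP; left; apply/eqP.
by apply: eq_wI => t; rewrite dot_delta.
Qed.

End VectorMoments.

(** * Lebesgue measure on tuples *)

Section LebesgueRn.
Context {R : realType}.
Local Open Scope ereal_scope.

(** The translated measure gives each interval its length, which determines
    Lebesgue measure. *)
Lemma ge0_integral_lebesgue_shift (a : R) (f : measurableTypeR R -> \bar R) :
  measurable_fun setT f -> (forall x, 0 <= f x) ->
  \int[lebesgue_measure]_x f (x + a)%R = \int[lebesgue_measure]_x f x.
Proof.
move=> mf f0.
pose phi : measurableTypeR R -> measurableTypeR R := fun x => (x + a)%R.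
have mphi : measurable_fun setT phi by exact: measurable_funD.
pose phiM : {mfun _ >-> _} := HB.pack phi (isMeasurableFun.Build _ _ _ _ _ mphi).
transitivity (\int[pushforward lebesgue_measure phiM]_x f x).
  by rewrite ge0_integral_pushforward// preimage_setT.
apply: eq_measure_integral => /= A mA _; apply/esym/lebesgue_measure_unique => //.
move=> _ [[x y]] _ <-/=.
have E : phi @^-1` `]x, y]%classic = `](x - a)%R, (y - a)%R]%classic.
  apply/seteqP; split=> z; rewrite /phi /preimage/= !in_itv/=;
    by rewrite ltrBlDr lerBrDr.
rewrite -[RHS]/(lebesgue_measure (phi @^-1` `]x, y]%classic)) E.
rewrite !lebesgue_measure_itv/= !lte_fin ltrD2r.
by case: ifP => // _; rewrite -!EFinD; congr EFin; ring.
Qed.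

Lemma ge0_integral_lebesgueRnS n (f : Rtuple R n.+1 -> \bar R) :
  measurable_fun setT f -> (forall x, 0 <= f x) ->
  \int[lebesgueRn R n.+1]_t f t =
  \int[lebesgue_measure]_x \int[lebesgueRn R n]_t f [tuple of x :: t].
Proof.
move=> mf f0.
have mp := @measurable_pair_cons R n.
transitivity (\int[lebesgue_measure \x lebesgueRn R n]_z f (pair_cons z)).
  rewrite -[LHS]/(\int[pushforward (lebesgue_measure \x lebesgueRn R n) (@pair_cons R n)]_t f t).
  by rewrite ge0_integral_pushforward.
rewrite fubini_tonelli1//.
exact: measurableT_comp.
Qed.

Definition tshift n (a : 'I_n -> R) (t : Rtuple R n) : Rtuple R n :=
  [tuple (tnth t i + a i)%R | i < n].

Lemma measurable_tshift n (a : 'I_n -> R) : measurable_fun setT (tshift a).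
Proof.
apply/measurable_fun_tnthP => i.
rewrite (_ : _ \o _ = fun t : Rtuple R n => tnth t i + a i)%R; last first.
  by apply/funext => t /=; rewrite tnth_mktuple.
by apply: measurable_funD => //; exact: measurable_tnth.
Qed.

(** The measure being an iterated product, one coordinate is translated at a
    time. *)
Lemma ge0_integral_tshift n (a : 'I_n -> R) (f : Rtuple R n -> \bar R) :
  measurable_fun setT f -> (forall x, 0 <= f x) ->
  \int[lebesgueRn R n]_t f (tshift a t) = \int[lebesgueRn R n]_t f t.
Proof.
elim: n a f => [|n IH] a f mf f0.
  by apply: eq_integral => t _; congr f; apply: eq_from_tnth => -[].
have mfa : measurable_fun setT (f \o tshift a).
  by apply: measurableT_comp => //; exact: measurable_tshift.
rewrite [RHS]ge0_integral_lebesgueRnS// [LHS](ge0_integral_lebesgueRnS mfa)//.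
have mcons x : measurable_fun setT (fun t : Rtuple R n => f [tuple of x :: t]).
  apply: measurableT_comp => //.
  exact: (measurable_cons (measurable_cst x) (@measurable_id _ _ setT)).
transitivity (\int[lebesgue_measure]_x \int[lebesgueRn R n]_t
    f [tuple of (x + a ord0)%R :: t]).
  apply: eq_integral => x _.
  rewrite -[RHS](IH (a \o lift ord0) (fun t => f [tuple of (x + a ord0)%R :: t]))//.
  apply: eq_integral => t _; congr f; apply: eq_from_tnth => i.
  rewrite tnth_mktuple; have [j ->|->] := unliftP ord0 i.
    by rewrite !tnthS tnth_mktuple.
  by rewrite !tnth0.
rewrite (ge0_integral_lebesgue_shift (a ord0)
  (f := fun x => \int[lebesgueRn R n]_t f [tuple of x :: t]))//.
- have mp : measurable_fun setT (f \o @pair_cons R n).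
    by apply: measurableT_comp => //; exact: measurable_pair_cons.
  exact: (@measurable_fun_fubini_tonelli_F _ _ _ _ _ (lebesgueRn R n) _ mp (fun=> f0 _)).
- by move=> x; exact: integral_ge0.
- by move=> x; exact: f0.
Qed.

Definition box n (c : 'cV[R]_n) (eta : R) : set (Rtuple R n) :=
  [set t | forall i, (`|tnth t i - c i ord0| <= eta)%R].

Lemma measurable_box n (c : 'cV[R]_n) eta : measurable (box c eta).
Proof.
rewrite (_ : box c eta = \bigcap_(i in [set: 'I_n])
    [set t | (`|tnth t i - c i ord0| <= eta)%R]); last first.
  by apply/seteqP; split=> t /= ht i => [_|]; exact: ht.
apply: fin_bigcap_measurable => // i _.
rewrite -[X in measurable X]setTI.
have mg : measurable_fun setT (fun t : Rtuple R n => `|tnth t i - c i ord0|)%R.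
  apply: measurableT_comp => //; apply: measurable_funB => //.
  exact: measurable_tnth.
rewrite (_ : [set t | _] = (fun t : Rtuple R n => `|tnth t i - c i ord0|%R) @^-1`
  `]-oo, eta]%classic); first exact: mg.
by apply/seteqP; split=> t /=; rewrite in_itv.
Qed.

Lemma lebesgueRn_box n (c : 'cV[R]_n) (eta : R) : (0 < eta)%R ->
  lebesgueRn R n (box c eta) = ((2 * eta) ^+ n)%:E.
Proof.
move=> eta0; elim: n c => [|n IH] c.
  rewrite expr0 /= diracE mem_set//; by case.
pose c' : 'cV[R]_n := (\col_i c (lift ord0 i) ord0)%R.
rewrite -[LHS]/((lebesgue_measure \x lebesgueRn R n) ((@pair_cons R n) @^-1` box c eta)).
have -> : (@pair_cons R n) @^-1` box c eta =
  `[c ord0 ord0 - eta, c ord0 ord0 + eta]%classic%R `*` box c' eta.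
  apply/seteqP; split=> -[x t]/= h.
    split=> /= [|i].
      by have := h ord0; rewrite tnth0 in_itv/= ler_distl.
    by have := h (lift ord0 i); rewrite tnthS mxE.
  move=> i; have [j ->|->] := unliftP ord0 i.
    by rewrite tnthS; have := h.2 j; rewrite mxE.
  by rewrite tnth0 ler_distl; have := h.1; rewrite /= in_itv.
rewrite product_measure1E//; last exact: measurable_box.
rewrite [X in _ * X]IH [X in X * _]lebesgue_measure_itv/= lte_fin.
rewrite ifT; last by lra.
by rewrite -EFinD -EFinM exprS; congr EFin; ring.
Qed.

End LebesgueRn.

(** * Gaussian weights *)

Section Density.
Context d (T : measurableType d) (R : realType).
Local Open Scope ereal_scope.

(** The density [p] is a Radon-Nikodym derivative of [nu], hence almost
    everywhere equal to the chosen one. *)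
Lemma ge0_integral_density (nu : {finite_measure set T -> \bar R})
    (mu : {sigma_finite_measure set T -> \bar R}) (p : T -> \bar R)
    (f : T -> \bar R) :
  measurable_fun setT p -> (forall t, 0 <= p t) ->
  (forall A, measurable A -> nu A = \int[mu]_(t in A) p t) ->
  measurable_fun setT f -> (forall t, 0 <= f t) ->
  \int[nu]_t f t = \int[mu]_t (f t * p t).
Proof.
move=> mp p0 nuE mf f0.
have dom : nu `<< mu.
  apply/null_content_dominatesP => A mA A0.
  by rewrite nuE//; apply: null_set_integral => //; exact: measurable_funTS.
rewrite -(Radon_Nikodym_SigmaFinite.change_of_variables dom)//.
have mg := measurable_int _ (Radon_Nikodym_SigmaFinite.f_integrable dom).
apply: ae_eq_integral => //.
- exact: emeasurable_funM.
- exact: emeasurable_funM.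
- apply: ae_eqe_mul2l; apply: integral_ae_eq => //.
    exact: Radon_Nikodym_SigmaFinite.f_integrable.
  by move=> A _ mA; rewrite -Radon_Nikodym_SigmaFinite.f_integral// nuE.
Qed.

End Density.

Section GaussianWeight.
Context {R : realType} {n : nat}.
Implicit Types (Q C : 'M[R]_n) (m : 'cV[R]_n).

Definition gw Q (z : 'cV[R]_n) : R := expR (- (dot z (Q *m z) / 2)).

Lemma gw_ge0 Q z : 0 <= gw Q z.
Proof. exact: expR_ge0. Qed.

Lemma measurable_gw d (T : measurableType d) (Z : T -> 'cV[R]_n) Q :
  mcv Z -> measurable_fun setT (fun t => gw Q (Z t)).
Proof.
move=> mZ; apply: measurableT_comp => //; apply: measurableT_comp => //.
apply: measurable_funM => //; apply: measurable_dot => //.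
by apply: mcvM => //; exact: mcv_cst.
Qed.

(** Completing the square: an exponential tilt of a Gaussian weight is a
    translate of it. *)
Lemma gw_shift Q C (a z : 'cV[R]_n) : Q^T = Q -> Q *m C = 1%:M ->
  expR (dot a z) * gw Q z = expR (dot a (C *m a) / 2) * gw Q (z - C *m a).
Proof.
move=> sQ QC; rewrite /gw -!expRD; congr expR.
have QCa : Q *m (C *m a) = a by rewrite mulmxA QC mul1mx.
rewrite mulmxBr QCa !dotBl !dotBr (dot_sym (C *m a) z sQ) QCa.
rewrite (dotC z a) (dotC (C *m a) a); lra.
Qed.

Lemma mcv_centered m : mcv (fun t : Rtuple R n => vec t - m).
Proof. by apply: mcvB; [exact: mcv_vec | exact: mcv_cst]. Qed.

Lemma vec_tshift (a : 'cV[R]_n) (t : Rtuple R n) :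
  vec (tshift (fun i => a i ord0) t) = vec t + a.
Proof. by apply/matrixP => i j; rewrite !mxE tnth_mktuple (ord1 j). Qed.

Lemma integral_gw_shift m (f : 'cV[R]_n -> R) :
  measurable_fun setT (fun t : Rtuple R n => f (vec t)) -> (forall x, 0 <= f x) ->
  (\int[lebesgueRn R n]_t (f (vec t - m))%:E =
   \int[lebesgueRn R n]_t (f (vec t))%:E)%E.
Proof.
move=> mf f0.
rewrite -(ge0_integral_tshift (fun i => (- m) i ord0)
  (f := fun t => (f (vec t))%:E))//.
- by apply: eq_integral => t _; rewrite vec_tshift.
- exact/measurable_EFinP.
- by move=> t; rewrite lee_fin.
Qed.

Section mgf.
Context (Q C : 'M[R]_n) (m : 'cV[R]_n).
Hypothesis Q_sym : Q^T = Q.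
Hypothesis QC1 : Q *m C = 1%:M.
Hypothesis gw_int :
  (lebesgueRn R n).-integrable setT (fun t => (gw Q (vec t))%:E).

Let w (t : Rtuple R n) : R := gw Q (vec t - m).

Let mgw : measurable_fun setT (fun t : Rtuple R n => gw Q (vec t)).
Proof. by apply: measurable_gw; exact: mcv_vec. Qed.

Definition gmass : R := \int[lebesgueRn R n]_t gw Q (vec t).

Let gmassE : (gmass%:E = \int[lebesgueRn R n]_t (gw Q (vec t))%:E)%E.
Proof.
rewrite /gmass /Rintegral fineK//.
exact: integrable_fin_num.
Qed.

Lemma gmass_ge0 : 0 <= gmass.
Proof. by apply: Rintegral_ge0 => t _; exact: gw_ge0. Qed.

Let integral_mgf a :
  (\int[lebesgueRn R n]_t (expR (dot a (vec t - m)) * w t)%:E =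
   (gmass * expR (dot a (C *m a) / 2))%:E)%E.
Proof.
under eq_integral => t _ do rewrite (gw_shift _ _ Q_sym QC1) EFinM -addrA -opprD.
rewrite [RHS]EFinM gmassE [RHS]muleC.
set c := m + C *m a.
rewrite -(@integral_gw_shift c (gw Q) mgw (gw_ge0 Q)).
have mgc : measurable_fun setT (fun t : Rtuple R n => (gw Q (vec t - c))%:E).
  by apply/measurable_EFinP; apply: measurable_gw; exact: mcv_centered.
have gc0 t : setT t -> (0 <= (gw Q (vec t - c))%:E)%E.
  by rewrite lee_fin gw_ge0.
exact: (ge0_integralZl_EFin _ measurableT gc0 mgc (expR_ge0 _)).
Qed.

Lemma gw_mgf_int a : wint (lebesgueRn R n) w (fun t => expR (dot a (vec t - m))).
Proof.
apply/integrableP; split.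
  apply/measurable_EFinP; apply: measurable_funM.
    apply: measurableT_comp => //.
    by apply: measurable_dot; [exact: mcv_cst | exact: mcv_centered].
  by apply: measurable_gw; exact: mcv_centered.
under eq_integral => t _.
  rewrite gee0_abs; last by rewrite lee_fin mulr_ge0 ?expR_ge0 ?gw_ge0.
  over.
by rewrite integral_mgf ltry.
Qed.

(** By [gw_shift], translation invariance of Lebesgue measure yields the moment
    generating function, with the total mass [gmass] as an unevaluated
    factor. *)
Lemma gw_mgf a : wI (lebesgueRn R n) w (fun t => expR (dot a (vec t - m))) =
  gmass * expR (dot a (C *m a) / 2).
Proof. by rewrite /wI /Rintegral integral_mgf. Qed.

End mgf.
End GaussianWeight.

(** * Second order Taylor expansion *)

Section SecondOrderTaylor.
Context {R : realType} {n : nat}.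
Implicit Types (f : 'cV[R]_n -> R) (x h : 'cV[R]_n).

Lemma cV_sum_delta x : x = \sum_i x i ord0 *: delta_mx i ord0.
Proof.
apply/matrixP => i j; rewrite (ord1 j) summxE (bigD1 i)//= big1 => [|k ki].
  by rewrite !mxE !eqxx mulr1 addr0.
by rewrite !mxE eq_sym (negbTE ki) mulr0.
Qed.

Lemma derive_gradient f x h : differentiable f x ->
  'D_h f x = dot (gradient f x) h.
Proof.
move=> df; rewrite deriveE// {1}(cV_sum_delta h) linear_sum; apply: eq_bigr => i _.
by rewrite linearZ/= mxE deriveE// mulrC.
Qed.

Lemma diff_gradient f x h : differentiable (gradient f) x ->
  'd (gradient f) x h = hessian f x *m h.
Proof.
move=> df; rewrite {1}(cV_sum_delta h) linear_sum.
apply/matrixP => i j; rewrite (ord1 j) summxE !mxE; apply: eq_bigr => k _.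
rewrite linearZ/= !mxE mulrC; congr (_ * _).
rewrite -deriveE// derive_mx; last exact: diff_derivable.
by rewrite mxE.
Qed.

Lemma is_derive_line f x h (s : R) : derivable f (x + s *: h) h ->
  is_derive s 1 (fun t : R => f (x + t *: h)) ('D_h f (x + s *: h)).
Proof.
move=> df.
have E : (fun t : R => t^-1 *: (f (x + (t *: (1 : R) + s) *: h) - f (x + s *: h))) =
    (fun t => t^-1 *: (f (t *: h + (x + s *: h)) - f (x + s *: h))).
  apply/funext => t; congr (_ *: (f _ - _)).
  by rewrite [t *: 1]mulr1 scalerDl addrCA.
apply: DeriveDef.
  by rewrite /derivable /= [X in X @ _]E.
by rewrite /derive /= [X in X @ _]E.
Qed.

(** Along a segment, the derivative of the Taylor defect is the first order
    defect of the gradient, which is small because the gradient is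
    differentiable at the base point; the mean value theorem integrates this
    bound. *)
Lemma second_order_taylor f x : twice_differentiable f x ->
  forall eps : R, 0 < eps -> exists2 r : R, 0 < r & forall h, `|h| <= r ->
    `|f (x + h) - (f x + dot (gradient f x) h + dot h (hessian f x *m h) / 2)|
      <= eps * `|h| ^+ 2.
Proof.
move=> [df dG] eps eps0.
set g := gradient f x; set H := hessian f x.
pose e1 := eps / (n%:R + 1).
have n1 : (0 : R) < n%:R + 1 by rewrite ltr_wpDl.
have e10 : 0 < e1 by rewrite divr_gt0.
have [r0 /= r00 hr] : exists2 r : R, 0 < r & forall h, `|h| < r ->
    differentiable f (x + h) /\ `|gradient f (x + h) - g - H *m h| <= e1 * `|h|.
  have hG : \forall h \near (0 : 'cV[R]_n),
      `|gradient f (x + h) - g - H *m h| <= e1 * `|h|.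
    have := diff_locallyxC dG; set k := 'o _ => hk.
    have /eqoP/(_ _ e10) := littleo_eqo k; apply: filterS => h /=.
    move=> kh; rewrite hk diff_gradient//; apply: le_trans kh.
    by rewrite -/g -/H -[X in X <= _]/(`|_ - _ - _|) -addrA -opprD [X in X - _]addrC addrK.
  have hf : \forall h \near (0 : 'cV[R]_n), differentiable f (x + h).
    move: df; rewrite (near_shift 0 x) subr0; apply: filterS => h /=.
    by rewrite addrC.
  have [r r0 hr] := (nbhs_ballP _ _).1 (filterI hf hG).
  exists r => // h hh; apply: hr.
  by rewrite -ball_normE /= sub0r normrN.
exists (r0 / 2); first by rewrite divr_gt0.
move=> h hh.
have hr0 : `|h| < r0 by rewrite (le_lt_trans hh)// gtr_pMr// invf_lt1// ltr1n.
have hs (s : R) : 0 <= s -> s <= 1 -> `|s *: h| < r0.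
  by move=> s0 s1; rewrite normrZ ger0_norm// (le_lt_trans _ hr0)// ler_piMl.
pose a := dot g h; pose b := dot h (H *m h).
pose psi := (fun t : R => f (x + t *: h)) - (fun t => a * t + b / 2 * t ^+ 2).
pose dpsi t := 'D_h f (x + t *: h) - (a + b * t).
have dline (s : R) : 0 <= s -> s <= 1 -> is_derive s 1 psi (dpsi s).
  move=> s0 s1; have [dfs _] := hr _ (hs _ s0 s1).
  apply: is_deriveB; first by apply: is_derive_line; exact: diff_derivable.
  have dp := is_derive_poly (a *: 'X + (b / 2) *: 'X^2 : {poly R}) s.
  rewrite (_ : (fun t => _) = (fun t => (a *: 'X + (b / 2) *: 'X^2 : {poly R}).[t])).
    apply: is_derive_eq dp _.
    by rewrite !(poly.derivE, hornerE) /=; field.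
  by apply: boolp.funext => t; rewrite !hornerE.
have [||c c01 psiE] := @MVT_segment R psi dpsi 0 1 ler01.
  by move=> s; rewrite in_itv/= => /andP[/ltW s0 /ltW s1]; exact: dline.
  apply: continuous_in_subspaceT => s; rewrite inE/= in_itv/= => /andP[s0 s1].
  by apply/differentiable_continuous/derivable1_diffP; have [] := dline _ s0 s1.
move: c01; rewrite in_itv/= => /andP[c0 c1].
have [dfc hGc] := hr _ (hs _ c0 c1).
have -> : f (x + h) - (f x + a + b / 2) = dpsi c.
  have := psiE; rewrite subr0 mulr1 => <-.
  rewrite /psi !fctE !scale1r !scale0r addr0 !(mulr0, mulr1, expr0n, expr1n)/=.
  by lra.
have -> : dpsi c = dot (gradient f (x + c *: h) - g - H *m (c *: h)) h.
  rewrite /dpsi derive_gradient// !dotBl -scalemxAr dotZl /a /b (dotC (H *m h)).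
  by ring.
apply: le_trans (norm_dot_le _ _) _.
apply: (@le_trans _ _ (n%:R * (e1 * `|h|) * `|h|)).
  rewrite ler_wpM2r// ler_wpM2l// (le_trans hGc)// ler_wpM2l ?(ltW e10)//.
  by rewrite normrZ ger0_norm// ler_piMl.
have -> : n%:R * (e1 * `|h|) * `|h| = n%:R * e1 * `|h| ^+ 2 by ring.
rewrite ler_wpM2r ?sqr_ge0//.
rewrite /e1 mulrCA ger_pMr// ler_pdivrMr// mul1r.
by rewrite lerDl.
Qed.

End SecondOrderTaylor.

(** * The prior relative to its value at the true parameter *)

Section RelativePrior.
Context {R : realType} {n : nat}.

Lemma dot_outer (g h : 'cV[R]_n) : dot h ((g *m g^T) *m h) = dot g h ^+ 2.
Proof.
rewrite -mulmxA (_ : g^T *m h = (dot g h)%:M); last first.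
  by rewrite [LHS]mx11_scalar dot_mxE.
by rewrite mul_mx_scalar dotZr dotC expr2.
Qed.

(** A second order expansion only sees the quadratic form of the Hessian; the
    symmetric representative is the one to which moment formulas obtained by
    polarization apply. *)
Definition symm (H : 'M[R]_n) : 'M[R]_n := 2^-1 *: (H + H^T).

Lemma tr_symm H : (symm H)^T = symm H.
Proof. by rewrite /symm linearZ/= linearD/= trmxK addrC. Qed.

Lemma dot_symm H (h : 'cV[R]_n) : dot h (symm H *m h) = dot h (H *m h).
Proof.
rewrite /symm -scalemxAl mulmxDl dotZr dotDr [dot h (H^T *m h)]dot_mulmx trmxK.
by rewrite (dotC (H *m h)); field.
Qed.

(** Exponentiating a second order expansion of the logarithm: the square of
    the linear part joins the Hessian. *)
Lemma prior_expansion (prior : 'cV[R]_n -> R) (x : 'cV[R]_n) :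
  (\forall y \near x, 0 < prior y) ->
  twice_differentiable (fun y => ln (prior y)) x ->
  let g := gradient (fun y => ln (prior y)) x in
  let M := symm (hessian (fun y => ln (prior y)) x) + g *m g^T in
  forall eps : R, 0 < eps -> exists2 r : R, 0 < r & forall h, `|h| <= r ->
    `|prior (x + h) / prior x - (1 + dot g h + dot h (M *m h) / 2)|
      <= eps * `|h| ^+ 2.
Proof.
move=> pos d2 g M eps eps0.
set H := hessian (fun y => ln (prior y)) x in M *.
pose e1 := Num.min 1 (eps / 2).
have e10 : 0 < e1 by rewrite lt_min ltr01 divr_gt0.
have e11 : e1 <= 1 by rewrite ge_min lexx.
have e1e : e1 <= eps / 2 by rewrite ge_min lexx orbT.
have [r1 r10 taylor] := second_order_taylor d2 e10.
have [r2 r20 posr] : exists2 r : R, 0 < r & forall h, `|h| < r -> 0 < prior (x + h).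
  have := pos; rewrite (near_shift 0 x) subr0 => /nbhs_ballP[r r0 hr].
  exists r => // h hh; rewrite addrC; apply: hr.
  by rewrite -ball_normE /= sub0r normrN.
pose c := n%:R * `|g| + n%:R ^+ 2 * `|H| + 1.
have c1 : 1 <= c by rewrite lerDr addr_ge0 ?mulr_ge0 ?exprn_ge0.
have c0 : 0 < c by exact: lt_le_trans c1.
pose D := c ^+ 2 + c ^+ 3 * expR c.
have D0 : 0 < D by rewrite addr_gt0 ?mulr_gt0 ?exprn_gt0 ?expR_gt0.
pose r := Num.min (Num.min r1 (r2 / 2)) (Num.min 1 (eps / 2 / D)).
exists r; first by rewrite !lt_min r10 ltr01 !divr_gt0.
move=> h; rewrite !le_min => /andP[/andP[hr1 hr2] /andP[h1 hD]].
set a := `|h| in hr1 hr2 h1 hD *.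
have a0 : 0 <= a by exact: normr_ge0.
have hpos : 0 < prior (x + h).
  by apply: posr; rewrite (le_lt_trans hr2)// gtr_pMr// invf_lt1// ltr1n.
have xpos : 0 < prior x by rewrite -(addr0 x); apply: posr; rewrite normr0.
pose v := ln (prior (x + h)) - ln (prior x).
have -> : prior (x + h) / prior x = expR v by rewrite expRB !lnK.
pose l := dot g h; pose b := dot h (H *m h).
have -> : dot h (M *m h) = b + l ^+ 2.
  by rewrite mulmxDl dotDr dot_symm dot_outer.
have hl : `|l| <= c * a.
  apply: le_trans (norm_dot_le _ _) _; rewrite ler_wpM2r//.
  by rewrite /c -addrA lerDl addr_ge0 ?mulr_ge0 ?exprn_ge0.
have taylor' : `|v - (l + b / 2)| <= e1 * a ^+ 2.
  have := taylor h hr1; rewrite -/g -/H -/l -/b -/a.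
  by rewrite (_ : _ - (_ + _ + _) = v - (l + b / 2))// /v; ring.
have hb : `|b| <= n%:R ^+ 2 * `|H| * a ^+ 2.
  by apply: le_trans (norm_quad_le _ _ _) _; rewrite -!mulrA.
have a2 : 0 <= a ^+ 2 by exact: exprn_ge0.
have hvl : `|v - l| <= c * a ^+ 2.
  have -> : v - l = (v - (l + b / 2)) + b / 2 by ring.
  apply: le_trans (ler_normD _ _) _.
  have e1a : e1 * a ^+ 2 <= 1 * a ^+ 2 by rewrite ler_wpM2r.
  have ga : 0 <= n%:R * `|g| * a ^+ 2 by rewrite !mulr_ge0.
  have ha : 0 <= n%:R ^+ 2 * `|H| * a ^+ 2 by rewrite !mulr_ge0 ?exprn_ge0.
  have hb2 : `|b / 2| <= n%:R ^+ 2 * `|H| * a ^+ 2 / 2.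
    by rewrite normrM (ger0_norm (_ : 0 <= 2^-1)) ?invr_ge0// ler_wpM2r.
  by rewrite /c !mulrDl; lra.
have hv : `|v| <= c * a.
  have -> : v = (v - (l + b / 2)) + l + b / 2 by ring.
  have aa : a ^+ 2 <= a by rewrite expr2 ler_piMr.
  have gl := norm_dot_le g h.
  apply: le_trans (ler_normD _ _) _.
  have hb2 : `|b / 2| <= n%:R ^+ 2 * `|H| * a.
    rewrite normrM (ger0_norm (_ : 0 <= 2^-1)) ?invr_ge0//.
    apply: le_trans (_ : `|b| <= _); first by rewrite ler_piMr// invf_le1// ler1n.
    by apply: le_trans hb _; rewrite ler_wpM2l// mulr_ge0 ?exprn_ge0.
  have e1a : e1 * a ^+ 2 <= a.
    by apply: le_trans (_ : 1 * a ^+ 2 <= _); [rewrite ler_wpM2r|rewrite mul1r].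
  have := ler_normD (v - (l + b / 2)) l.
  rewrite /c !mulrDl mul1r -/a -/l in gl *; lra.
have hq : `|v ^+ 2 - l ^+ 2| <= 2 * c ^+ 2 * a ^+ 3.
  have -> : v ^+ 2 - l ^+ 2 = (v - l) * (v + l) by ring.
  have -> : 2 * c ^+ 2 * a ^+ 3 = (c * a ^+ 2) * (c * a + c * a) by ring.
  by rewrite normrM ler_pM// (le_trans (ler_normD _ _))// lerD.
have he := expR_taylor3 v.
have hc3 : `|v| ^+ 3 * expR `|v| <= c ^+ 3 * expR c * a ^+ 3.
  have -> : c ^+ 3 * expR c * a ^+ 3 = (c * a) ^+ 3 * expR c by ring.
  rewrite ler_pM ?exprn_ge0 ?expR_ge0//.
    by rewrite lerXn2r// nnegrE// mulr_ge0// ltW.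
  by rewrite ler_expR (le_trans hv)// ler_piMr// ltW.
have hDa : D * a ^+ 3 <= eps / 2 * a ^+ 2.
  have -> : D * a ^+ 3 = a * D * a ^+ 2 by ring.
  by rewrite ler_wpM2r// -ler_pdivlMr.
have -> : expR v - (1 + l + (b + l ^+ 2) / 2) =
    (expR v - (1 + v + v ^+ 2 / 2)) + (v ^+ 2 - l ^+ 2) / 2 + (v - (l + b / 2)).
  by field.
have hq2 : `|(v ^+ 2 - l ^+ 2) / 2| <= c ^+ 2 * a ^+ 3.
  rewrite normrM (ger0_norm (_ : 0 <= 2^-1)) ?invr_ge0//; lra.
have t1 := ler_normD (expR v - (1 + v + v ^+ 2 / 2) + (v ^+ 2 - l ^+ 2) / 2) (v - (l + b / 2)).
have t2 := ler_normD (expR v - (1 + v + v ^+ 2 / 2)) ((v ^+ 2 - l ^+ 2) / 2).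
have e1a : e1 * a ^+ 2 <= eps / 2 * a ^+ 2 by rewrite ler_wpM2r.
by move: hDa; rewrite /D mulrDl; lra.
Qed.

End RelativePrior.

(** * Posterior integrals: mass, tails and remainders *)

Section BoxLowerBound.
Context {R : realType} {n : nat}.

(** Normalizing integrals are bounded below by their contribution from a small
    box, on which the integrand is explicit. *)
Lemma wI_box_ge (w f : Rtuple R n -> R) (c : 'cV[R]_n) (eta v : R) :
  0 < eta -> 0 <= v -> (forall t, 0 <= f t * w t) ->
  wint (lebesgueRn R n) w f -> (forall t, box c eta t -> v <= f t * w t) ->
  v * (2 * eta) ^+ n <= wI (lebesgueRn R n) w f.
Proof.
move=> eta0 v0 fw0 If hv.
have mB := measurable_box c eta; have muB := lebesgueRn_box c eta0.
have I1 : (lebesgueRn R n).-integrable setT (EFin \o \1_(box c eta)).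
  apply/integrableP; split; first exact/measurable_EFinP.
  under eq_integral => t _ do rewrite /= ger0_norm//.
  by rewrite integral_indic// setIT [X in (X < _)%E]muB ltry.
have Iv : (lebesgueRn R n).-integrable setT (fun t => (v * \1_(box c eta) t)%:E).
  exact: (integrableZl measurableT v I1).
have -> : v * (2 * eta) ^+ n = \int[lebesgueRn R n]_t (v * \1_(box c eta) t).
  rewrite RintegralZl//; congr (_ * _).
  by rewrite /Rintegral integral_indic// setIT [X in fine X]muB.
apply: le_Rintegral => // t _; rewrite indicE.
case: (boolP (t \in box c eta)) => [/set_mem /hv h|_] /=.
  by rewrite mulr1.
by rewrite mulr0.
Qed.

Lemma box_norm (c : 'cV[R]_n) (eta : R) (t : Rtuple R n) : 0 <= eta ->
  box c eta t -> `|vec t - c| <= eta.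
Proof.
move=> e0 h; apply: norm_le_coef => // i j.
by rewrite (ord1 j) !mxE; exact: h.
Qed.

End BoxLowerBound.

Section Posterior.
Context {R : realType} {n : nat}.
Hypothesis n_gt0 : (0 < n)%N.
Context (theta0 : 'cV[R]_n) (kap kap' Lam k0 : R).
Hypothesis kap_gt0 : 0 < kap.
Hypothesis kap'_gt0 : 0 < kap'.
Hypothesis Lam_gt0 : 0 < Lam.
Hypothesis k0_gt0 : 0 < k0.

Let mu := lebesgueRn R n.

(** For a large enough rate [k0] the likelihood at the smallest sample size
    dominates a multiple of this weight, so that the prior is integrable against
    it. That takes the place of tail conditions on the prior. *)
Definition ref_weight (t : Rtuple R n) : R :=
  expR (- (k0 * sqnorm (vec t - theta0))).

Lemma ref_weight_ge0 t : 0 <= ref_weight t.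
Proof. exact: expR_ge0. Qed.

Lemma measurable_ref_weight : measurable_fun setT ref_weight.
Proof.
apply: measurableT_comp => //; apply: measurableT_comp => //.
by apply: measurable_funM => //; apply: measurable_sqnorm; exact: mcv_centered.
Qed.

Lemma measurable_wint_ref (f : Rtuple R n -> R) :
  wint mu ref_weight f -> measurable_fun setT f.
Proof.
move=> If; have [/measurable_EFinP mf _] := integrableP _ _ _ If.
have -> : f = fun t => (f t * ref_weight t) * expR (k0 * sqnorm (vec t - theta0)).
  by apply/funext => t; rewrite /ref_weight -mulrA -expRD addNr expR0 mulr1.
apply: measurable_funM => //; apply: measurableT_comp => //.
by apply: measurable_funM => //; apply: measurable_sqnorm; exact: mcv_centered.
Qed.

(** The data of one posterior: its precision [Q] is of exact order [N], and its
    covariance [C] of order [N^-1]. *)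
Record precision (N : R) (Q C : 'M[R]_n) : Prop := Precision {
  prec_N : 1 <= N;
  prec_Qsym : Q^T = Q;
  prec_Csym : C^T = C;
  prec_inv : Q *m C = 1%:M;
  prec_int : mu.-integrable setT (fun t => (gw Q (vec t))%:E);
  prec_low : forall z, kap * N * `|z| ^+ 2 <= dot z (Q *m z) / 2;
  prec_up : forall z, dot z (Q *m z) / 2 <= kap' * N * `|z| ^+ 2;
  prec_C : `|C| <= Lam / N }.

Section fixed_precision.
Context (N : R) (Q C : 'M[R]_n) (m : 'cV[R]_n).
Hypothesis prec : precision N Q C.

Let x := m - theta0.
Let X (t : Rtuple R n) := vec t - m.
Let w (t : Rtuple R n) := gw Q (X t).
Let K := gmass Q.

Let N1 := prec_N prec.
Let N0 : 0 < N := lt_le_trans ltr01 N1.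

Let w_ge0 t : 0 <= w t. Proof. exact: gw_ge0. Qed.

Let mX : mcv X. Proof. exact: mcv_centered. Qed.

Let mw : measurable_fun setT w. Proof. exact: measurable_gw. Qed.

Let hX t : vec t - theta0 = x + X t.
Proof. by rewrite /x /X [RHS]addrC addrA subrK. Qed.

Lemma prec_psd a : 0 <= dot a (C *m a).
Proof.
have QCa : Q *m (C *m a) = a by rewrite mulmxA (prec_inv prec) mul1mx.
have := prec_low prec (C *m a); rewrite QCa dotC.
have : 0 <= kap * N * `|C *m a| ^+ 2.
  by apply: mulr_ge0; [rewrite mulr_ge0 ?ltW | exact: sqr_ge0].
by move=> /le_trans h /h; lra.
Qed.

Let K_ge0 : 0 <= K. Proof. exact: gmass_ge0. Qed.

Lemma post_mgf_int a : wint mu w (fun t => expR (dot a (X t))).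
Proof. exact: (gw_mgf_int m (prec_Qsym prec) (prec_inv prec) (prec_int prec)). Qed.

Lemma post_mgf a : wI mu w (fun t => expR (dot a (X t))) = K * expR (dot a (C *m a) / 2).
Proof. exact: (gw_mgf m (prec_Qsym prec) (prec_inv prec) (prec_int prec)). Qed.

Lemma post_wint1 : wint mu w (fun=> 1).
Proof. exact: (gaussian_wint1 mw mX post_mgf_int). Qed.

Lemma post_mass : wI mu w (fun=> 1) = K.
Proof.
exact: (gaussian_mass w_ge0 mw mX prec_psd K_ge0 post_mgf_int post_mgf).
Qed.

Lemma post_mass_ge eta : 0 < eta ->
  expR (- (kap' * N * eta ^+ 2)) * (2 * eta) ^+ n <= K.
Proof.
move=> eta0; rewrite -post_mass; apply: (@wI_box_ge _ _ _ _ m) => //.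
- by move=> t; rewrite mul1r.
- exact: post_wint1.
- move=> t /(box_norm (ltW eta0)) h; rewrite mul1r ler_expR lerN2.
  apply: le_trans (prec_up prec _) _.
  rewrite ler_wpM2l ?mulr_ge0 ?(ltW kap'_gt0) ?(ltW N0)//.
  by rewrite lerXn2r ?nnegrE ?(ltW eta0).
Qed.

Lemma post_mass_gt0 : 0 < K.
Proof.
apply: lt_le_trans (post_mass_ge ltr01).
by rewrite mulr_gt0 ?expR_gt0 ?exprn_gt0.
Qed.

(** Far from the maximum likelihood estimate the likelihood is exponentially
    small compared with the reference weight. *)
Lemma post_tail rho t : 2 * (2 * n%:R * k0 + 1) <= kap * N -> 0 <= rho ->
  rho <= `|X t| ->
  (1 + N * `|X t|) * w t <=
  2 * N * expR (2 * n%:R * k0 * `|x| ^+ 2 - kap * N * rho ^+ 2 / 2) * ref_weight t.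
Proof.
move=> hN rho0 hrho; set a := `|X t| in hrho *.
have a0 : 0 <= a by exact: normr_ge0.
have h1 : 1 + N * a <= 2 * N * expR (a ^+ 2).
  have e1 : 1 + a ^+ 2 <= expR (a ^+ 2) by exact: expR_ge1Dx.
  have : 1 + N * a <= N * (1 + a) by rewrite mulrDr mulr1 lerD2r.
  move/le_trans; apply; rewrite (mulrC 2) -mulrA ler_wpM2l// ?ltW//.
  have := sqr_ge0 (2 * a - 1).
  have -> : (2 * a - 1) ^+ 2 = 4 * a ^+ 2 - 4 * a + 1 by ring.
  lra.
have h2 : w t <= expR (- (kap * N * a ^+ 2)).
  by rewrite ler_expR lerN2; exact: (prec_low prec).
have h3 : sqnorm (vec t - theta0) <= 2 * n%:R * (`|x| ^+ 2 + a ^+ 2).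
  apply: le_trans (sqnorm_le _) _; rewrite [2 * _]mulrC -mulrA ler_wpM2l//.
  have : `|vec t - theta0| <= `|x| + a by rewrite hX; exact: ler_normD.
  have := sqr_ge0 (`|x| - a); have x0 : 0 <= `|x| by exact: normr_ge0.
  have -> : (`|x| - a) ^+ 2 = `|x| ^+ 2 - 2 * (`|x| * a) + a ^+ 2 by ring.
  move=> h hh; apply: le_trans (_ : (`|x| + a) ^+ 2 <= _).
    by rewrite lerXn2r ?nnegrE ?addr_ge0.
  have -> : (`|x| + a) ^+ 2 = `|x| ^+ 2 + 2 * (`|x| * a) + a ^+ 2 by ring.
  lra.
apply: (@le_trans _ _ (2 * N * expR (a ^+ 2) * expR (- (kap * N * a ^+ 2)))).
  by rewrite ler_pM// addr_ge0// mulr_ge0// ltW.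
rewrite -[leLHS]mulrA -[leRHS]mulrA /ref_weight -!expRD.
rewrite ler_wpM2l ?mulr_ge0 ?(ltW N0)// ler_expR.
have h4 : k0 * sqnorm (vec t - theta0) <= k0 * (2 * n%:R * (`|x| ^+ 2 + a ^+ 2)).
  by rewrite ler_wpM2l// ltW.
have h5 : (2 * (2 * n%:R * k0 + 1)) * a ^+ 2 <= kap * N * a ^+ 2.
  by rewrite ler_wpM2r ?sqr_ge0.
have h6 : kap * N * rho ^+ 2 <= kap * N * a ^+ 2.
  by rewrite ler_wpM2l ?lerXn2r// mulr_ge0 ?ltW.
have : k0 * (2 * n%:R * (`|x| ^+ 2 + a ^+ 2)) =
  2 * n%:R * k0 * `|x| ^+ 2 + 2 * n%:R * k0 * a ^+ 2 by ring.
have : 2 * (2 * n%:R * k0 + 1) * a ^+ 2 = 2 * (2 * n%:R * k0 * a ^+ 2) + 2 * a ^+ 2.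
  by ring.
move: h4 h5 h6; lra.
Qed.

End fixed_precision.
(** The constant of [gaussian_powsum_le]. *)
Definition moment_cst k : R := n%:R * ((2 * k)%:R ^+ (2 * k) * 2 * expR 2^-1).

Lemma moment_cst_ge0 k : 0 <= moment_cst k.
Proof. by rewrite !mulr_ge0 ?exprn_ge0 ?expR_ge0. Qed.

(** Collects the Gaussian moments of order two and four that enter
    [post_remainder]. *)
Definition remainder_cst : R :=
  2 * (2 + 3 * (moment_cst 1 * Lam) + moment_cst 2 * Lam ^+ 2) + 1.

Lemma remainder_cst_gt0 : 0 < remainder_cst.
Proof.
have h1 : 0 <= moment_cst 1 * Lam by rewrite mulr_ge0 ?moment_cst_ge0 ?ltW.
have h2 : 0 <= moment_cst 2 * Lam ^+ 2.
  by rewrite mulr_ge0 ?moment_cst_ge0 ?exprn_ge0 ?ltW.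
by rewrite /remainder_cst; lra.
Qed.

Section fixed_precision2.
Context (N : R) (Q C : 'M[R]_n) (m : 'cV[R]_n).
Hypothesis prec : precision N Q C.

Let x := m - theta0.
Let X (t : Rtuple R n) := vec t - m.
Let w (t : Rtuple R n) := gw Q (X t).
Let K := gmass Q.

Let N1 := prec_N prec.
Let N0 : 0 < N := lt_le_trans ltr01 N1.
Let w_ge0 t : 0 <= w t. Proof. exact: gw_ge0. Qed.
Let mX : mcv X. Proof. exact: mcv_centered. Qed.
Let mw : measurable_fun setT w. Proof. exact: measurable_gw. Qed.
Let hX t : vec t - theta0 = x + X t.
Proof. by rewrite /x /X [RHS]addrC addrA subrK. Qed.
Let C_psd := prec_psd prec.
Let C_sym := prec_Csym prec.
Let K_ge0 : 0 <= K. Proof. exact: gmass_ge0. Qed.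
Let mgf_int := post_mgf_int m prec.
Let mgf := post_mgf m prec.
Let wint1 : wint mu w (fun=> 1) := post_wint1 m prec.
Let wmass : wI mu w (fun=> 1) = K := post_mass m prec.

Lemma post_wint_powsum k : wint mu w (fun t => powsum (X t) k).
Proof. exact: (gaussian_wint_powsum mw mX mgf_int). Qed.

Lemma post_powsum_le k :
  wI mu w (fun t => powsum (X t) k) <= moment_cst k * K * (Lam / N) ^+ k.
Proof.
apply: (gaussian_powsum_le w_ge0 mw mX K_ge0 mgf_int mgf).
  exact: divr_gt0.
move=> i; apply: le_trans (ler_norm _) _.
by apply: le_trans (coef_le_norm _ _ _) (prec_C prec).
Qed.

(** Near [theta0] the remainder is [eps * `|h| ^+ 2], which the Gaussian moments
    turn into [eps * (N^-1 + `|x| ^+ 2)]; away from it the tail bound makes the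
    contribution exponentially small. The factor [f] is 1 for the evidence and
    [Num.sqrt N] times a coordinate for the posterior mean. *)
Lemma post_remainder (f rem : Rtuple R n -> R) (eps r : R) :
  0 <= eps ->
  measurable_fun setT f -> (forall t, `|f t| <= 1 + Num.sqrt N * `|X t|) ->
  wint mu ref_weight rem ->
  (forall t, `|vec t - theta0| <= r -> `|rem t| <= eps * `|vec t - theta0| ^+ 2) ->
  0 <= r -> `|x| <= r / 2 ->
  2 * (2 * n%:R * k0 + 1) <= kap * N ->
  2 * N * expR (2 * n%:R * k0 * `|x| ^+ 2 - kap * N * (r / 2) ^+ 2 / 2) *
    wI mu ref_weight (fun t => `|rem t|) <= eps / N * K ->
  wint mu w (fun t => f t * rem t) /\
  `|wI mu w (fun t => f t * rem t)| <=
    remainder_cst * eps * (N^-1 + `|x| ^+ 2) * K.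
Proof.
move=> eps0 mf fX Irem hrem r0 xr hN.
set TC := 2 * N * expR _ => htail.
have TC0 : 0 <= TC by rewrite !mulr_ge0 ?expR_ge0 ?ltW.
pose S t := 2 * `|x| ^+ 2 + ((2 + N * `|x| ^+ 2) * powsum (X t) 1 + N * powsum (X t) 2).
have Ia := wintZ (2 * `|x| ^+ 2) wint1.
have Ib := wintZ (2 + N * `|x| ^+ 2) (post_wint_powsum 1).
have Ic := wintZ N (post_wint_powsum 2).
have IS : wint mu w S.
  by apply: eq_wint (wintD Ia (wintD Ib Ic)) => t; rewrite mulr1.
have ES : wI mu w S <= (remainder_cst - 1) / 2 * (N^-1 + `|x| ^+ 2) * K.
  have -> : wI mu w S = 2 * `|x| ^+ 2 * K + ((2 + N * `|x| ^+ 2) *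
      wI mu w (fun t => powsum (X t) 1) + N * wI mu w (fun t => powsum (X t) 2)).
    rewrite -(wIZ _ (post_wint_powsum 1)) -(wIZ _ (post_wint_powsum 2)) -wmass.
    rewrite -wIZ// -(wID Ib Ic) -(wID Ia (wintD Ib Ic)).
    by apply: eq_wI => t; rewrite mulr1.
  set a1 := moment_cst 1 * Lam; set a2 := moment_cst 2 * Lam ^+ 2.
  have a10 : 0 <= a1 by rewrite mulr_ge0 ?moment_cst_ge0 ?ltW.
  have a20 : 0 <= a2 by rewrite mulr_ge0 ?moment_cst_ge0 ?exprn_ge0 ?ltW.
  have Nx0 : 0 <= 2 + N * `|x| ^+ 2 by rewrite addr_ge0 ?mulr_ge0 ?exprn_ge0 ?(ltW N0).
  have p1 : (2 + N * `|x| ^+ 2) * wI mu w (fun t => powsum (X t) 1) <=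
      K * (a1 * (2 * N^-1 + `|x| ^+ 2)).
    have -> : K * (a1 * (2 * N^-1 + `|x| ^+ 2)) =
      (2 + N * `|x| ^+ 2) * (moment_cst 1 * K * (Lam / N) ^+ 1).
      by rewrite /a1; field; rewrite gt_eqF.
    by rewrite ler_wpM2l// post_powsum_le.
  have p2 : N * wI mu w (fun t => powsum (X t) 2) <= K * (a2 * N^-1).
    have -> : K * (a2 * N^-1) = N * (moment_cst 2 * K * (Lam / N) ^+ 2).
      by rewrite /a2; field; rewrite gt_eqF.
    by rewrite ler_wpM2l ?post_powsum_le// ltW.
  have -> : (remainder_cst - 1) / 2 = 2 + 3 * a1 + a2.
    by rewrite /remainder_cst -/a1 -/a2; lra.
  have Ni : 0 <= N^-1 by rewrite invr_ge0 ltW.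
  have x2 : 0 <= `|x| ^+ 2 by exact: exprn_ge0.
  have q1 := mulr_ge0 K_ge0 (mulr_ge0 a10 Ni).
  have q2 := mulr_ge0 K_ge0 (mulr_ge0 a10 x2).
  have q3 := mulr_ge0 K_ge0 (mulr_ge0 a20 x2).
  have q4 := mulr_ge0 K_ge0 Ni.
  have -> : (2 + 3 * a1 + a2) * (N^-1 + `|x| ^+ 2) * K =
    2 * `|x| ^+ 2 * K + 2 * (K * N^-1) + (K * (a1 * (2 * N^-1 + `|x| ^+ 2)) + K * (a2 * N^-1))
      + K * (a1 * N^-1) + 2 * (K * (a1 * `|x| ^+ 2)) + K * (a2 * `|x| ^+ 2) by ring.
  lra.
have sN2 : Num.sqrt N ^+ 2 = N by rewrite sqr_sqrtr// ltW.
have sN0 : 0 <= Num.sqrt N by exact: sqrtr_ge0.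
have sN1 : 1 <= Num.sqrt N by rewrite -[leLHS]sqrtr1 ler_wsqrtr.
have sNN : Num.sqrt N <= N.
  by rewrite -[leRHS]sN2 expr2 ler_peMr ?sN0.
pose A t := 2 * eps * (S t * w t) + TC * (`|rem t| * ref_weight t).
have pt t : `|f t * rem t * w t| <= A t.
  rewrite !normrM (ger0_norm (w_ge0 t)) /A.
  have S0 : 0 <= S t.
    rewrite !addr_ge0 ?mulr_ge0 ?addr_ge0 ?mulr_ge0 ?exprn_ge0 ?powsum_ge0 ?(ltW N0)//.
  have [hr|hr] := leP `|vec t - theta0| r.
    apply: ler_wpDr.
      exact: mulr_ge0 TC0 (mulr_ge0 (normr_ge0 _) (ref_weight_ge0 _)).
    rewrite mulrA ler_wpM2r//.
    set a := `|X t|; have a0 : 0 <= a by exact: normr_ge0.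
    have h1 : `|vec t - theta0| ^+ 2 <= 2 * (`|x| ^+ 2 + a ^+ 2).
      rewrite hX; apply: le_trans (_ : (`|x| + a) ^+ 2 <= _).
        by rewrite lerXn2r ?nnegrE ?addr_ge0// ler_normD.
      have := sqr_ge0 (`|x| - a).
      have -> : (`|x| - a) ^+ 2 = `|x| ^+ 2 - 2 * (`|x| * a) + a ^+ 2 by ring.
      have -> : (`|x| + a) ^+ 2 = `|x| ^+ 2 + 2 * (`|x| * a) + a ^+ 2 by ring.
      lra.
    have h2 : 1 + Num.sqrt N * a <= 2 + N * a ^+ 2.
      have := sqr_ge0 (Num.sqrt N * a - 1).
      have -> : (Num.sqrt N * a - 1) ^+ 2 =
        Num.sqrt N ^+ 2 * a ^+ 2 - 2 * (Num.sqrt N * a) + 1 by ring.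
      have sa0 : 0 <= Num.sqrt N * a by exact: mulr_ge0.
      have := mulr_ge0 (ltW N0) (exprn_ge0 2 a0); rewrite sN2.
      lra.
    apply: (@le_trans _ _ ((2 + N * a ^+ 2) * (eps * (2 * (`|x| ^+ 2 + a ^+ 2))))).
      rewrite ler_pM// ?(le_trans (fX t))//.
      by rewrite (le_trans (hrem t hr))// ler_wpM2l.
    have P1 : a ^+ 2 <= powsum (X t) 1 by have := norm_le_powsum (X t) 1 n_gt0.
    have P2 : a ^+ 4 <= powsum (X t) 2 by have := norm_le_powsum (X t) 2 n_gt0.
    have -> : (2 + N * a ^+ 2) * (eps * (2 * (`|x| ^+ 2 + a ^+ 2))) =
      2 * eps * (2 * `|x| ^+ 2 + ((2 + N * `|x| ^+ 2) * a ^+ 2 + N * a ^+ 4)) by ring.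
    rewrite ler_wpM2l ?mulr_ge0// lerD2l lerD//; rewrite ler_wpM2l// ?(ltW N0)//.
    by rewrite addr_ge0 ?mulr_ge0 ?exprn_ge0 ?(ltW N0).
  apply: ler_wpDl.
    by apply: mulr_ge0; apply: mulr_ge0 => //.
  have r2 : r / 2 <= `|X t|.
    have : `|vec t - theta0| <= `|x| + `|X t| by rewrite hX ler_normD.
    move: xr hr; lra.
  have := post_tail prec hN (divr_ge0 r0 (ler0n R 2)) r2.
  rewrite -/TC -/x -/X -/(w t) => ht.
  have -> : `|f t| * `|rem t| * w t = `|rem t| * (`|f t| * w t) by ring.
  have -> : TC * (`|rem t| * ref_weight t) = `|rem t| * (TC * ref_weight t) by ring.
  rewrite ler_wpM2l//; apply: le_trans ht.
  rewrite ler_wpM2r// (le_trans (fX t))// lerD2l ler_wpM2r//.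
have IA : mu.-integrable setT (fun t => (A t)%:E).
  have I1 := wintZ (2 * eps) IS.
  have I2 := wintZ TC (wint_norm ref_weight_ge0 Irem).
  apply: eq_integrable (integrableD measurableT I1 I2) => // t _.
  by rewrite /= -EFinD /A !mulrA.
have mrem : measurable_fun setT rem := measurable_wint_ref Irem.
have If : wint mu w (fun t => f t * rem t).
  apply: le_integrable IA => //.
    apply/measurable_EFinP; apply: measurable_funM => //.
    exact: measurable_funM.
  move=> t _ /=; rewrite lee_fin; apply: le_trans (pt t) (ler_norm _).
split=> //.
apply: le_trans (le_normr_Rintegral _ _) _ => //.
apply: (@le_trans _ _ (\int[mu]_t A t)).
  by apply: (le_Rintegral measurableT (integrable_norm If) IA) => t _; exact: pt.
have -> : \int[mu]_t A t = 2 * eps * wI mu w S + TC * wI mu ref_weight (fun t => `|rem t|).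
  rewrite -(wIZ _ IS) -(wIZ _ (wint_norm ref_weight_ge0 Irem)) /wI -RintegralD//.
  - by apply: eq_Rintegral => t _; rewrite /A !mulrA.
  - exact: wintZ.
  - by apply: wintZ; exact: (wint_norm ref_weight_ge0 Irem).
have h1 : 2 * eps * wI mu w S <= 2 * eps * ((remainder_cst - 1) / 2 * (N^-1 + `|x| ^+ 2) * K).
  by rewrite ler_wpM2l// mulr_ge0.
apply: le_trans (lerD h1 htail) _.
have h3 : 0 <= eps * `|x| ^+ 2 * K by rewrite !mulr_ge0 ?exprn_ge0.
have -> : remainder_cst * eps * (N^-1 + `|x| ^+ 2) * K =
  2 * eps * ((remainder_cst - 1) / 2 * (N^-1 + `|x| ^+ 2) * K) + eps / N * K +
  eps * `|x| ^+ 2 * K by field; rewrite gt_eqF.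
by rewrite lerDl.
Qed.

End fixed_precision2.

End Posterior.

(** * Posterior integrals of quadratic polynomials, and crude bounds *)

Section PosteriorExpansion.
Context {R : realType} {n : nat}.
Context (theta0 : 'cV[R]_n) (kap kap' Lam : R).
Hypothesis kap_gt0 : 0 < kap.
Context (N : R) (Q C : 'M[R]_n) (m : 'cV[R]_n).
Hypothesis prec : precision kap kap' Lam N Q C.
Context (g : 'cV[R]_n) (M : 'M[R]_n).
Hypothesis M_sym : M^T = M.

Let mu := lebesgueRn R n.
Let x := m - theta0.
Let X (t : Rtuple R n) := vec t - m.
Let w (t : Rtuple R n) := gw Q (X t).
Let K := gmass Q.
Let w_ge0 t : 0 <= w t. Proof. exact: gw_ge0. Qed.
Let mX : mcv X. Proof. exact: mcv_centered. Qed.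
Let mw : measurable_fun setT w. Proof. exact: measurable_gw. Qed.
Let hX t : vec t - theta0 = x + X t.
Proof. by rewrite /x /X [RHS]addrC addrA subrK. Qed.
Let C_psd := prec_psd kap_gt0 prec.
Let C_sym := prec_Csym prec.
Let K_ge0 : 0 <= K. Proof. exact: gmass_ge0. Qed.
Let mgf_int := post_mgf_int m prec.
Let mgf := post_mgf m prec.
Let wint1 : wint mu w (fun=> 1) := post_wint1 m prec.
Let wmass : wI mu w (fun=> 1) = K := post_mass kap_gt0 m prec.

Definition quad2 (h : 'cV[R]_n) : R := 1 + dot g h + dot h (M *m h) / 2.

Lemma quad2D (a b : 'cV[R]_n) : quad2 (a + b) =
  (1 + dot g a + dot a (M *m a) / 2) * 1 + dot (g + M *m a) b +
  2^-1 * dot b (M *m b).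
Proof.
rewrite /quad2 mulmxDr !dotDr !dotDl (dot_sym a b M_sym).
by rewrite (dotC b (M *m a)); field.
Qed.

Let c0 := 1 + dot g x + dot x (M *m x) / 2.
Let v0 := g + M *m x.

Let quad2E t : quad2 (vec t - theta0) =
  c0 * 1 + dot v0 (X t) + 2^-1 * dot (X t) (M *m X t).
Proof. by rewrite hX quad2D. Qed.

Let wint_dot a : wint mu w (fun t => dot a (X t)).
Proof. exact: (gaussian_wint_dot mw mX mgf_int). Qed.

Let wint_quad : wint mu w (fun t => dot (X t) (M *m X t)).
Proof. exact: (gaussian_wint_quad mw mX mgf_int). Qed.

Lemma post_wint_quad2 : wint mu w (fun t => quad2 (vec t - theta0)).
Proof.
apply: eq_wint (wintD (wintD (wintZ c0 wint1) (wint_dot v0))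
  (wintZ 2^-1 wint_quad)) => t.
by rewrite quad2E.
Qed.

Lemma post_quad2 : wI mu w (fun t => quad2 (vec t - theta0)) =
  K * (c0 + \tr (M *m C) / 2).
Proof.
have I1 := wintZ c0 wint1; have I3 := wintZ 2^-1 wint_quad.
under eq_wI do rewrite quad2E.
rewrite (wID (wintD I1 (wint_dot v0)) I3) (wID I1 (wint_dot v0)) !wIZ//.
rewrite wmass (gaussian_dot w_ge0 mw mX C_psd K_ge0 mgf_int mgf).
rewrite (gaussian_quad w_ge0 mw mX C_sym C_psd K_ge0 mgf_int mgf).
by ring.
Qed.

Let dot_quad2E a t : dot a (X t) * quad2 (vec t - theta0) =
  c0 * dot a (X t) + dot a (X t) * dot v0 (X t) +
  2^-1 * (dot a (X t) * dot (X t) (M *m X t)).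
Proof. by rewrite quad2E; ring. Qed.

Let wint_dot2 a b : wint mu w (fun t => dot a (X t) * dot b (X t)).
Proof. exact: (gaussian_wint_dot2 mw mX mgf_int). Qed.

Let wint_dot_quad a : wint mu w (fun t => dot a (X t) * dot (X t) (M *m X t)).
Proof. exact: (gaussian_wint_dot_quad mw mX mgf_int). Qed.

Lemma post_wint_dot_quad2 a :
  wint mu w (fun t => dot a (X t) * quad2 (vec t - theta0)).
Proof.
apply: eq_wint (wintD (wintD (wintZ c0 (wint_dot a)) (wint_dot2 a v0))
  (wintZ 2^-1 (wint_dot_quad a))) => t.
by rewrite dot_quad2E.
Qed.

(** Moments of odd order vanish, so only the part of the polynomial linear in
    the centred variable contributes. *)
Lemma post_dot_quad2 a :
  wI mu w (fun t => dot a (X t) * quad2 (vec t - theta0)) = K * dot a (C *m v0).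
Proof.
have I1 := wintZ c0 (wint_dot a); have I3 := wintZ 2^-1 (wint_dot_quad a).
under eq_wI do rewrite dot_quad2E.
rewrite (wID (wintD I1 (wint_dot2 a v0)) I3) (wID I1 (wint_dot2 a v0)) !wIZ//.
rewrite (gaussian_dot w_ge0 mw mX C_psd K_ge0 mgf_int mgf).
rewrite (gaussian_dot2 w_ge0 mw mX C_sym C_psd K_ge0 mgf_int mgf).
rewrite (gaussian_dot_quad w_ge0 mw mX C_psd K_ge0 mgf_int mgf).
by ring.
Qed.

End PosteriorExpansion.

Section CrudeBound.
Context {R : realType} {n : nat}.
Context (theta0 : 'cV[R]_n) (kap kap' Lam k0 : R).
Hypothesis kap_gt0 : 0 < kap.
Hypothesis kap'_gt0 : 0 < kap'.
Hypothesis k0_gt0 : 0 < k0.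
Context (N : R) (Q C : 'M[R]_n) (m : 'cV[R]_n).
Hypothesis prec : precision kap kap' Lam N Q C.
Context (p : 'cV[R]_n -> R).
Hypothesis p_ge0 : forall t, 0 <= p t.
Hypothesis p_int : wint (lebesgueRn R n) (ref_weight theta0 k0) (fun t => p (vec t)).

Let mu := lebesgueRn R n.
Let x := m - theta0.
Let X (t : Rtuple R n) := vec t - m.
Let w (t : Rtuple R n) := gw Q (X t).
Let w_ge0 t : 0 <= w t. Proof. exact: gw_ge0. Qed.
Let mX : mcv X. Proof. exact: mcv_centered. Qed.
Let mw : measurable_fun setT w. Proof. exact: measurable_gw. Qed.
Let N1 := prec_N prec.
Let N0 : 0 < N := lt_le_trans ltr01 N1.
Let hX t : vec t - theta0 = x + X t.
Proof. by rewrite /x /X [RHS]addrC addrA subrK. Qed.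

(** The box around [theta0] on which the prior is bounded below lies within
    [`|x| + eta] of the centre of the weight. *)
Lemma post_evidence_ge (eta c : R) : 0 < eta -> 0 <= c ->
  (forall h, `|h| <= eta -> c <= p (theta0 + h)) ->
  wint mu w (fun t => p (vec t)) ->
  c * expR (- (kap' * N * (`|x| + eta) ^+ 2)) * (2 * eta) ^+ n <=
  wI mu w (fun t => p (vec t)).
Proof.
move=> eta0 c_ge0 hc Ip; apply: (@wI_box_ge _ _ _ _ theta0) => //.
- by rewrite mulr_ge0 ?expR_ge0.
- by move=> t; rewrite mulr_ge0.
- move=> t /(box_norm (ltW eta0)) ht.
  rewrite ler_pM ?expR_ge0//.
    by rewrite -(subrK theta0 (vec t)) addrC hc.
  rewrite ler_expR lerN2; apply: le_trans (prec_up prec _) _.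
  rewrite ler_wpM2l ?mulr_ge0 ?(ltW kap'_gt0) ?(ltW N0)//.
  rewrite lerXn2r ?nnegrE ?addr_ge0 ?(ltW eta0)//.
  have -> : X t = (vec t - theta0) - x by rewrite hX addrC addKr.
  by rewrite (le_trans (ler_normB _ _))// addrC lerD2l.
Qed.

(** The posterior mean exceeds [rho] in distance from the maximum likelihood
    estimate only through the mass at distance at least [rho], which is
    controlled by the tail bound. *)
Lemma post_mean_crude (rho : R) (i : 'I_n) :
  2 * (2 * n%:R * k0 + 1) <= kap * N -> 0 <= rho ->
  wint mu w (fun t => p (vec t)) ->
  wint mu w (fun t => X t i ord0 * p (vec t)) ->
  `|wI mu w (fun t => X t i ord0 * p (vec t))| <=
  rho * wI mu w (fun t => p (vec t)) +
  2 * N * expR (2 * n%:R * k0 * `|x| ^+ 2 - kap * N * rho ^+ 2 / 2) *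
    wI mu (ref_weight theta0 k0) (fun t => p (vec t)).
Proof.
move=> hN rho0 Ip IXp; set TC := 2 * N * expR _.
have TC0 : 0 <= TC by rewrite mulr_ge0 ?expR_ge0 ?mulr_ge0 ?(ltW N0).
pose A t := rho * (p (vec t) * w t) + TC * (p (vec t) * ref_weight theta0 k0 t).
have I1 := wintZ rho Ip; have I2 := wintZ TC p_int.
have IA : mu.-integrable setT (fun t => (A t)%:E).
  apply: eq_integrable (integrableD measurableT I1 I2) => // t _.
  by rewrite /= -EFinD /A !mulrA.
have -> : rho * wI mu w (fun t => p (vec t)) +
    TC * wI mu (ref_weight theta0 k0) (fun t => p (vec t)) = \int[mu]_t A t.
  rewrite -(wIZ _ Ip) -(wIZ _ p_int) /wI -RintegralD//.
  by apply: eq_Rintegral => t _; rewrite /A !mulrA.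
apply: le_trans (le_normr_Rintegral _ _) _ => //.
apply: (le_Rintegral measurableT (integrable_norm IXp) IA) => t _ /=.
have r0 : 0 <= ref_weight theta0 k0 t by exact: expR_ge0.
rewrite /A !normrM (ger0_norm (w_ge0 t)) (ger0_norm (p_ge0 _)).
have Xi := coef_le_norm (X t) i ord0.
have [hr|hr] := leP rho `|X t|.
  apply: ler_wpDl; first by apply: mulr_ge0 => //; exact: mulr_ge0.
  have := post_tail theta0 kap_gt0 k0_gt0 prec hN rho0 hr; rewrite -/TC -/x -/X -/(w t) => ht.
  have -> : `|X t i ord0| * p (vec t) * w t = p (vec t) * (`|X t i ord0| * w t) by ring.
  have -> : TC * (p (vec t) * ref_weight theta0 k0 t) =
    p (vec t) * (TC * ref_weight theta0 k0 t) by ring.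
  rewrite ler_wpM2l//; apply: le_trans ht; rewrite ler_wpM2r//.
  apply: le_trans Xi _; apply: (@le_trans _ _ (N * `|X t|)).
    by rewrite ler_peMl.
  by rewrite lerDr.
apply: ler_wpDr.
  by apply: mulr_ge0 => //; apply: mulr_ge0.
rewrite -mulrA ler_wpM2r ?mulr_ge0//.
exact: le_trans Xi (ltW hr).
Qed.

(** [post_tail] with radius 0 bounds the likelihood by the reference weight
    everywhere. *)
Lemma post_wint_prior (f : Rtuple R n -> R) :
  2 * (2 * n%:R * k0 + 1) <= kap * N ->
  measurable_fun setT f -> (forall t, `|f t| <= 1 + N * `|X t|) ->
  wint mu w (fun t => f t * p (vec t)).
Proof.
move=> hN mf hf.
pose TC := 2 * N * expR (2 * n%:R * k0 * `|x| ^+ 2 - kap * N * 0 ^+ 2 / 2).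
have TC0 : 0 <= TC by rewrite mulr_ge0 ?expR_ge0 ?mulr_ge0 ?(ltW N0).
have I2 := wintZ TC p_int.
have mref : measurable_fun setT (ref_weight theta0 k0) := measurable_ref_weight theta0 k0.
have mp : measurable_fun setT (fun t : Rtuple R n => p (vec t)) :=
  measurable_wint_ref p_int.
apply: le_integrable I2 => //.
  by apply/measurable_EFinP; do ! apply: measurable_funM => //.
move=> t _ /=; rewrite lee_fin.
have r0 : 0 <= ref_weight theta0 k0 t by exact: expR_ge0.
rewrite [leRHS]ger0_norm; last by apply: mulr_ge0 => //; exact: mulr_ge0.
have := post_tail (t := t) (m := m) theta0 kap_gt0 k0_gt0 prec hN (lexx 0) (normr_ge0 _).
rewrite -/X -/x -/TC -/(w t) => ht.
rewrite !normrM (ger0_norm (w_ge0 t)) (ger0_norm (p_ge0 _)).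
have -> : `|f t| * p (vec t) * w t = p (vec t) * (`|f t| * w t) by ring.
have -> : TC * p (vec t) * ref_weight theta0 k0 t =
    p (vec t) * (TC * ref_weight theta0 k0 t) by ring.
rewrite ler_wpM2l//; apply: le_trans ht; rewrite ler_wpM2r//; exact: hf.
Qed.

End CrudeBound.

(** * Expansion of the posterior mean *)

Section QuotientExpansion.
Context {R : realType} {n : nat}.
Context (g : 'cV[R]_n) (H : 'M[R]_n) (Lam rc : R).
Hypothesis Lam_gt0 : 0 < Lam.
Hypothesis rc_ge0 : 0 <= rc.

(** The second derivative of a function with value 1, in terms of the gradient
    [g] and the Hessian [H] of its logarithm. *)
Definition logM : 'M[R]_n := H + g *m g^T.

(** One constant above every coefficient occurring in the expansion. *)
Definition expansion_cst : R := 1 + rc + n%:R * `|g| + n%:R ^+ 2 * `|logM| +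
  n%:R * Lam * `|g| + n%:R ^+ 2 * Lam * `|H| + n%:R ^+ 2 * Lam * `|logM|.

Let B := expansion_cst.

Let parts : [/\ 0 <= n%:R * `|g|, 0 <= n%:R ^+ 2 * `|logM|, 0 <= n%:R * Lam * `|g|,
  0 <= n%:R ^+ 2 * Lam * `|H| & 0 <= n%:R ^+ 2 * Lam * `|logM|].
Proof. by split; rewrite ?mulr_ge0 ?exprn_ge0 ?(ltW Lam_gt0). Qed.

Lemma expansion_cst_ge1 : 1 <= B.
Proof.
have [] := parts; rewrite /B /expansion_cst; move: rc_ge0; lra.
Qed.

Context (N : R) (C : 'M[R]_n) (x : 'cV[R]_n).
Hypothesis N1 : 1 <= N.
Hypothesis CN : `|C| <= Lam / N.

Let N0 : 0 < N := lt_le_trans ltr01 N1.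
Let B1 := expansion_cst_ge1.
Let s := N^-1 + `|x| ^+ 2.

Let iN0 : 0 <= N^-1. Proof. by rewrite invr_ge0 ltW. Qed.

Lemma norm_Cg_le : `|C *m g| <= B / N.
Proof.
apply: le_trans (norm_mulmx_le _ _) _.
apply: (@le_trans _ _ (n%:R * (Lam / N) * `|g|)).
  by rewrite ler_wpM2r// ler_wpM2l.
have -> : n%:R * (Lam / N) * `|g| = n%:R * Lam * `|g| / N by ring.
rewrite ler_wpM2r//; have [] := parts; rewrite /B /expansion_cst.
by move: rc_ge0; lra.
Qed.

Lemma norm_CHx_le : `|C *m (H *m x)| <= B / N * `|x|.
Proof.
apply: le_trans (norm_mulmx_le _ _) _.
apply: (@le_trans _ _ (n%:R * (Lam / N) * (n%:R * `|H| * `|x|))).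
  by rewrite ler_pM ?mulr_ge0 ?norm_mulmx_le// ler_wpM2l.
have -> : n%:R * (Lam / N) * (n%:R * `|H| * `|x|) =
  n%:R ^+ 2 * Lam * `|H| / N * `|x| by ring.
rewrite ler_wpM2r// ler_wpM2r//; have [] := parts; rewrite /B /expansion_cst.
by move: rc_ge0; lra.
Qed.

Let norm_gx : `|dot g x| <= B * `|x|.
Proof.
apply: le_trans (norm_dot_le _ _) _; rewrite ler_wpM2r//.
by have [] := parts; rewrite /B /expansion_cst; move: rc_ge0; lra.
Qed.

Let norm_xMx : `|dot x (logM *m x)| <= B * `|x| ^+ 2.
Proof.
apply: le_trans (norm_quad_le _ _ _) _; rewrite -mulrA -expr2 ler_wpM2r ?exprn_ge0//.
by have [] := parts; rewrite /B /expansion_cst; move: rc_ge0; lra.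
Qed.

Let norm_trMC : `|\tr (logM *m C)| <= B / N.
Proof.
apply: le_trans (ler_norm_sum _ _ _) _.
apply: (@le_trans _ _ (\sum_(i < n) (n%:R * `|logM| * (Lam / N)))).
  apply: ler_sum => i _; apply: le_trans (coef_le_norm _ _ _) _.
  apply: le_trans (norm_mulmx_le _ _) _; rewrite ler_wpM2l// mulr_ge0//.
rewrite sumr_const card_ord -[leLHS]mulr_natl.
have -> : n%:R * (n%:R * `|logM| * (Lam / N)) = n%:R ^+ 2 * Lam * `|logM| / N by ring.
rewrite ler_wpM2r//; have [] := parts; rewrite /B /expansion_cst.
by move: rc_ge0; lra.
Qed.

Context (eps Z rho0 : R) (rho1 : 'cV[R]_n).
Hypothesis eps0 : 0 <= eps.
Hypothesis eps1 : eps <= 1.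
Hypothesis Neps : (Num.sqrt N)^-1 <= eps.
Hypothesis xB : `|x| <= (8 * B)^-1.
Hypothesis NB : 8 * B <= N.
Hypothesis h0 : `|rho0| <= rc * eps * s.
Hypothesis h1 : `|rho1| <= rc * eps * s / Num.sqrt N.
Hypothesis ZE : Z = 1 + dot g x + dot x (logM *m x) / 2 + \tr (logM *m C) / 2 + rho0.

(** Dividing the expansion of the numerator by that of the evidence cancels
    the rank one part [g *m g^T] of [logM] and leaves the Hessian [H] of the
    log-prior. *)
Lemma quotient_expansion (V : 'cV[R]_n) : V = C *m (g + logM *m x) + rho1 ->
  `|Z^-1 *: V - (C *m g + C *m (H *m x))| <=
    2 * (rc + 5 * B ^+ 2) * eps * s / Num.sqrt N.
Proof.
move=> VE; set S := Num.sqrt N.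
have S1 : 1 <= S by rewrite -[leLHS]sqrtr1 ler_wsqrtr.
have S0 : 0 < S := lt_le_trans ltr01 S1.
have S2 : S ^+ 2 = N by rewrite sqr_sqrtr// ltW.
have B0 : 0 < B := lt_le_trans ltr01 B1.
have x0 : 0 <= `|x| by exact: normr_ge0.
have s0 : 0 <= s by rewrite addr_ge0// exprn_ge0.
have iNs : N^-1 <= s by rewrite /s lerDl exprn_ge0.
have xs : `|x| ^+ 2 <= s by rewrite /s lerDr.
have x18 : B * `|x| <= 8^-1.
  by rewrite -ler_pdivlMl// -invfM mulrC.
have x8 : `|x| <= 8^-1 by have := ler_wpM2r x0 B1; rewrite mul1r; move: x18; lra.
have x1 : `|x| <= 1 by move: x8; lra.
have BN : B / N <= 8^-1.
  by rewrite ler_pdivrMr// mulrC ler_pdivlMr// mulrC.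
pose q := dot x (logM *m x) / 2 + \tr (logM *m C) / 2 + rho0.
have rcB : rc <= B by have [] := parts; rewrite /B /expansion_cst; lra.
have rces : rc * eps * s <= B * s.
  by rewrite ler_wpM2r// -[leRHS]mulr1 ler_pM.
have h2 (a : R) : `|a / 2| <= `|a| / 2.
  by rewrite normrM (ger0_norm (_ : 0 <= 2^-1)) ?invr_ge0.
have qs : `|q| <= 2 * B * s.
  have t1 := ler_normD (dot x (logM *m x) / 2 + \tr (logM *m C) / 2) rho0.
  have t2 := ler_normD (dot x (logM *m x) / 2) (\tr (logM *m C) / 2).
  have u1 := h2 (dot x (logM *m x)); have u2 := h2 (\tr (logM *m C)).
  have : B * s = B / N + B * `|x| ^+ 2 by rewrite /s mulrDr.
  have : 0 <= B / N by rewrite divr_ge0 ?ltW.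
  have : 0 <= B * `|x| ^+ 2 by rewrite mulr_ge0 ?exprn_ge0// ltW.
  move: t1 t2 u1 u2 norm_xMx norm_trMC h0 rces; rewrite /q; lra.
(* The factor 8 in [xB] and [NB] keeps the normalized evidence at least 1 / 2. *)
have Zge : 1 / 2 <= Z.
  have ZE' : Z = 1 + dot g x + q by rewrite ZE /q; ring.
  have l1 : - `|dot g x| <= dot g x by rewrite lerNl -normrN ler_norm.
  have l2 : - `|q| <= q by rewrite lerNl -normrN ler_norm.
  have : B * `|x| ^+ 2 <= 8^-1 * 8^-1.
    by rewrite expr2 mulrA ler_pM// mulr_ge0// ltW.
  have : 2 * B * s = 2 * (B / N) + 2 * (B * `|x| ^+ 2) by rewrite /s; ring.
  by rewrite ZE'; move: l1 l2 qs norm_gx x18 BN; lra.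
have Z0 : 0 < Z by apply: lt_le_trans Zge; lra.
set L := C *m g + C *m (H *m x).
have VL : V - Z *: L = rho1 - dot g x *: (C *m (H *m x)) - q *: L.
  have ZE' : Z = 1 + dot g x + q by rewrite ZE /q; ring.
  have -> : V = C *m g + C *m (H *m x) + dot g x *: (C *m g) + rho1.
    rewrite VE mulmxDr /logM mulmxDl !mulmxDr addrA; congr (_ + _ + _).
    rewrite -(mulmxA g) (_ : g^T *m x = (dot g x)%:M); last first.
      by rewrite [LHS]mx11_scalar dot_mxE.
    by rewrite mul_mx_scalar scalemxAr.
  rewrite ZE' !scalerDl scale1r /L !scalerDr !opprD !addrA.
  by apply/matrixP => i j; rewrite !mxE; ring.
have LN : `|L| <= 2 * (B / N).
  apply: le_trans (ler_normD _ _) _; rewrite mulr2n mulrDl mul1r lerD ?norm_Cg_le//.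
  by apply: le_trans norm_CHx_le _; rewrite ler_piMr// divr_ge0 ?(ltW B0) ?(ltW N0).
have NS : N^-1 <= eps / S.
  by rewrite -S2 expr2 invfM ler_wpM2r// invr_ge0 ltW.
have VLn : `|V - Z *: L| <= (rc + 5 * B ^+ 2) * eps * s / S.
  rewrite VL; apply: le_trans (ler_normB _ _) _.
  have t := ler_normB rho1 (dot g x *: (C *m (H *m x))).
  have t1 : `|dot g x *: (C *m (H *m x))| <= B ^+ 2 * s * (eps / S).
    rewrite normrZ.
    apply: (@le_trans _ _ ((B * `|x|) * (B / N * `|x|))).
      by rewrite ler_pM// norm_CHx_le.
    have -> : (B * `|x|) * (B / N * `|x|) = B ^+ 2 * `|x| ^+ 2 * N^-1 by ring.
    rewrite ler_pM// ?mulr_ge0 ?exprn_ge0 ?(ltW B0)//.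
    by rewrite ler_wpM2l// exprn_ge0// ltW.
  have t2 : `|q *: L| <= 4 * (B ^+ 2 * s * (eps / S)).
    rewrite normrZ; apply: (@le_trans _ _ (2 * B * s * (2 * (B / N)))).
      exact: ler_pM (normr_ge0 _) (normr_ge0 _) qs LN.
    have -> : 2 * B * s * (2 * (B / N)) = 4 * (B ^+ 2 * s) * N^-1 by ring.
    rewrite [leRHS]mulrA ler_wpM2l//.
    by apply: mulr_ge0 => //; apply: mulr_ge0 => //; apply: exprn_ge0; exact: ltW.
  have -> : (rc + 5 * B ^+ 2) * eps * s / S = rc * eps * s / S +
    B ^+ 2 * s * (eps / S) + 4 * (B ^+ 2 * s * (eps / S)) by ring.
  by move: h1 t t1 t2; rewrite -/S; lra.
have -> : Z^-1 *: V - L = Z^-1 *: (V - Z *: L).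
  by rewrite scalerBr scalerA mulVf ?scale1r// gt_eqF.
rewrite normrZ gtr0_norm ?invr_gt0//.
apply: (@le_trans _ _ (2 * ((rc + 5 * B ^+ 2) * eps * s / S))); last first.
  by rewrite le_eqVlt; apply/orP; left; apply/eqP; ring.
rewrite ler_pM ?invr_ge0 ?(ltW Z0)//.
by rewrite -[leRHS]invrK lef_pV2 ?posrE// (le_trans _ Zge)// div1r.
Qed.

End QuotientExpansion.

Section PosteriorMean.
Context {R : realType} {n : nat}.
Hypothesis n_gt0 : (0 < n)%N.
Context (theta0 : 'cV[R]_n) (kap kap' Lam k0 : R).
Hypothesis kap_gt0 : 0 < kap.
Hypothesis kap'_gt0 : 0 < kap'.
Hypothesis Lam_gt0 : 0 < Lam.
Hypothesis k0_gt0 : 0 < k0.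
Context (g : 'cV[R]_n) (H : 'M[R]_n) (p : 'cV[R]_n -> R).
Hypothesis H_sym : H^T = H.

Let mu := lebesgueRn R n.
Let M := logM g H.

Hypothesis p_int : wint mu (ref_weight theta0 k0) (fun t => p (vec t)).
Hypothesis quad_int :
  wint mu (ref_weight theta0 k0) (fun t => quad2 g M (vec t - theta0)).
Hypothesis taylor : forall eps : R, 0 < eps -> exists2 r : R, 0 < r &
  forall h, `|h| <= r -> `|p (theta0 + h) - quad2 g M h| <= eps * `|h| ^+ 2.

Let rc : R := @remainder_cst R n Lam.
Let B := expansion_cst g H Lam rc.

(** Displacement of the posterior mean from the centre [m] of the likelihood. *)
Definition post_shift (Q : 'M[R]_n) (m : 'cV[R]_n) : 'cV[R]_n :=
  \col_i (wI mu (fun t => gw Q (vec t - m)) (fun t => (vec t - m) i ord0 * p (vec t)) /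
          wI mu (fun t => gw Q (vec t - m)) (fun t => p (vec t))).

Lemma sqr_expR_small (c a delta : R) : 0 <= c -> 0 < a -> 0 < delta ->
  exists2 Ns : R, 0 < Ns & forall N, Ns <= N -> c * N ^+ 2 * expR (- (a * N)) <= delta.
Proof.
move=> c0 a0 d0; exists (27 * (c + 1) / (a ^+ 3 * delta)).
  by rewrite divr_gt0 ?mulr_gt0 ?exprn_gt0// ltr_wpDl.
move=> N; rewrite ler_pdivrMr ?mulr_gt0 ?exprn_gt0// => hN.
have N0 : 0 < N.
  have c1 : 0 < 27 * (c + 1) by rewrite mulr_gt0// ltr_wpDl.
  have := lt_le_trans c1 hN.
  by rewrite pmulr_lgt0// mulr_gt0 ?exprn_gt0.
have e3 := expr_le_expR 3 (ltW (mulr_gt0 a0 N0)).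
rewrite expRN ler_pdivrMr ?expR_gt0//.
have aN : 0 < a ^+ 3 * N by rewrite mulr_gt0 ?exprn_gt0.
rewrite -(ler_pM2l aN).
have -> : a ^+ 3 * N * (c * N ^+ 2) = c * (a * N) ^+ 3 by ring.
have -> : a ^+ 3 * N * (delta * expR (a * N)) = N * (a ^+ 3 * delta) * expR (a * N) by ring.
apply: (@le_trans _ _ (c * (27 * expR (a * N)))).
  by rewrite ler_wpM2l// (le_trans e3)// -natrX.
rewrite mulrA ler_wpM2r ?expR_ge0//; apply: le_trans hN.
by rewrite mulrC ler_wpM2l// lerDl.
Qed.

Let M_sym : M^T = M.
Proof. by rewrite /M /logM linearD/= H_sym trmx_mul trmxK. Qed.

(** When the maximum likelihood estimate is close to [theta0], the numerator and
    the evidence are those of the Taylor polynomial up to remainders bounded by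
    [post_remainder], and [quotient_expansion] divides them. *)
Lemma post_shift_expansion (eps : R) : 0 < eps -> eps <= 1 ->
  exists r Ns : R, [/\ 0 < r, r <= eps & forall N Q C m, Ns <= N ->
    precision kap kap' Lam N Q C -> `|m - theta0| <= r ->
    `|post_shift Q m - (C *m g + C *m (H *m (m - theta0)))| <=
      2 * (rc + 5 * B ^+ 2) * eps * (N^-1 + `|m - theta0| ^+ 2) / Num.sqrt N].
Proof.
move=> eps0 eps1; have [rT rT0 hT] := taylor eps0.
have rc0 : 0 < rc := @remainder_cst_gt0 R n Lam Lam_gt0.
have B1 : 1 <= B := expansion_cst_ge1 g H Lam_gt0 (ltW rc0).
have B0 : 0 < B := lt_le_trans ltr01 B1.
pose rem t := p (vec t) - quad2 g M (vec t - theta0).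
have Irem : wint mu (ref_weight theta0 k0) rem := wintB p_int quad_int.
pose GR := wI mu (ref_weight theta0 k0) (fun t => `|rem t|).
have GR0 : 0 <= GR by apply: wI_ge0 => // t; exact: expR_ge0.
(* [eta] is small enough for the mass of the likelihood within [eta] of its
   centre, at least [expR (- (a * N))] up to a constant, to exceed its tail
   beyond [rT / 2], which is of order [expR (- (2 * a * N))]. *)
pose tt := Num.min 1 (kap / (16 * kap')).
have tt0 : 0 < tt by rewrite lt_min ltr01 divr_gt0// mulr_gt0.
have tt1 : tt <= 1 by rewrite ge_min lexx.
have ttk : tt <= kap / (16 * kap') by rewrite ge_min lexx orbT.
pose eta := rT * tt.
have eta0 : 0 < eta by rewrite mulr_gt0.
pose a := kap * rT ^+ 2 / 16.
have a0 : 0 < a by rewrite !mulr_gt0 ?exprn_gt0.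
have etaa : kap' * eta ^+ 2 <= a.
  have -> : a = rT ^+ 2 * (kap' * (kap / (16 * kap'))).
    by rewrite /a; field; rewrite gt_eqF.
  have -> : kap' * eta ^+ 2 = rT ^+ 2 * (kap' * tt ^+ 2) by rewrite /eta; ring.
  rewrite ler_wpM2l ?exprn_ge0 ?(ltW rT0)// ler_wpM2l ?(ltW kap'_gt0)//.
  by apply: le_trans ttk; rewrite expr2 ler_piMr ?(ltW tt0).
pose E2 := expR (2 * n%:R * k0).
have [||N1 N10 hN1] := @sqr_expR_small (2 * E2 * GR) a (eps * (2 * eta) ^+ n) _ a0.
- by apply: mulr_ge0 => //; apply: mulr_ge0 => //; exact: expR_ge0.
- by rewrite mulr_gt0 ?exprn_gt0 ?mulr_gt0 ?eta0.
pose r := Num.min (Num.min (rT / 2) eps) (Num.min 1 (8 * B)^-1).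
pose Ns := Num.max (Num.max N1 (8 * B))
  (Num.max ((eps^-1) ^+ 2) (2 * (2 * n%:R * k0 + 1) / kap)).
exists r, Ns; split.
- by rewrite !lt_min divr_gt0// eps0 ltr01 invr_gt0 mulr_gt0.
- by rewrite !ge_min lexx orbT.
move=> N Q C m; rewrite !ge_max => /andP[/andP[NN1 NB] /andP[Neps Nkap]] prec.
rewrite !le_min => /andP[/andP[xrT xeps] /andP[x1 xB]].
set x := m - theta0 in xrT xeps x1 xB *.
have N1' := prec_N prec; have N0 : 0 < N := lt_le_trans ltr01 N1'.
have K0 := post_mass_gt0 kap_gt0 kap'_gt0 m prec; set K := gmass Q in K0.
have hN : 2 * (2 * n%:R * k0 + 1) <= kap * N by rewrite [leRHS]mulrC -ler_pdivrMr.
pose S := Num.sqrt N.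
have S0 : 0 < S by rewrite sqrtr_gt0.
have S2 : S ^+ 2 = N by rewrite sqr_sqrtr// ltW.
have Seps : S^-1 <= eps.
  rewrite -[leRHS]invrK lef_pV2 ?posrE ?invr_gt0//.
  by rewrite -(@ler_pXn2r _ 2) ?nnegrE ?invr_ge0 ?(ltW eps0) ?(ltW S0)// S2.
have htail : 2 * N * expR (2 * n%:R * k0 * `|x| ^+ 2 - kap * N * (rT / 2) ^+ 2 / 2) *
    GR <= eps / N * K.
  have h1 : expR (2 * n%:R * k0 * `|x| ^+ 2 - kap * N * (rT / 2) ^+ 2 / 2) <=
      E2 * (expR (- (a * N)) * expR (- (a * N))).
    rewrite -!expRD ler_expR.
    have -> : kap * N * (rT / 2) ^+ 2 / 2 = a * N + a * N by rewrite /a; field.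
    rewrite opprD lerD2r -[leRHS]mulr1 ler_wpM2l ?exprn_ile1//.
    by rewrite !mulr_ge0// ltW.
  have h2 : expR (- (a * N)) * (2 * eta) ^+ n <= K.
    apply: le_trans (post_mass_ge kap_gt0 kap'_gt0 m prec eta0).
    apply: ler_wpM2r; first by apply: exprn_ge0; apply: mulr_ge0 => //; exact: ltW.
    rewrite ler_expR lerN2.
    by rewrite mulrAC ler_wpM2r ?(ltW N0).
  have h3 := hN1 N NN1.
  apply: (@le_trans _ _ (2 * N * (E2 * (expR (- (a * N)) * expR (- (a * N)))) * GR)).
    by rewrite ler_wpM2r// ler_wpM2l// mulr_ge0 ?(ltW N0).
  apply: (@le_trans _ _ (eps / N * (expR (- (a * N)) * (2 * eta) ^+ n))); last first.
    by rewrite ler_wpM2l// divr_ge0 ?(ltW eps0) ?(ltW N0).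
  have -> : 2 * N * (E2 * (expR (- (a * N)) * expR (- (a * N)))) * GR =
    (expR (- (a * N)) / N) * (2 * E2 * GR * N ^+ 2 * expR (- (a * N))).
    by field; rewrite gt_eqF.
  have -> : eps / N * (expR (- (a * N)) * (2 * eta) ^+ n) =
    (expR (- (a * N)) / N) * (eps * (2 * eta) ^+ n) by ring.
  by rewrite ler_wpM2l// divr_ge0 ?expR_ge0 ?(ltW N0).
have hrem t : `|vec t - theta0| <= rT -> `|rem t| <= eps * `|vec t - theta0| ^+ 2.
  by move=> /hT; rewrite [theta0 + _]addrC subrK.
pose w (t : Rtuple R n) := gw Q (vec t - m).
have mXi i : measurable_fun setT (fun t : Rtuple R n => (vec t - m) i ord0).
  exact: mcv_centered.
have rem1 f mf hf := @post_remainder _ _ n_gt0 theta0 kap kap' Lam k0 kap_gt0 Lam_gt0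
  k0_gt0 N Q C m prec f rem eps rT (ltW eps0) mf hf Irem hrem (ltW rT0) xrT hN htail.
have [//||I0 e0] := rem1 (fun _ : Rtuple R n => 1 : R).
  by move=> t /=; rewrite normr1 lerDl mulr_ge0 ?sqrtr_ge0.
have rem2 i : wint mu w (fun t => S * (vec t - m) i ord0 * rem t) /\
    `|wI mu w (fun t => S * (vec t - m) i ord0 * rem t)| <=
    rc * eps * (N^-1 + `|x| ^+ 2) * K.
  apply: rem1.
    exact: measurable_funM.
  move=> t /=; rewrite normrM (ger0_norm (ltW S0)).
  apply: (@le_trans _ _ (S * `|vec t - m|)).
    by rewrite ler_wpM2l ?(ltW S0)// coef_le_norm.
  by rewrite lerDr.
pose X (t : Rtuple R n) := vec t - m.
have Iq : wint mu w (fun t => quad2 g M (vec t - theta0)) :=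
  post_wint_quad2 theta0 m prec g M_sym.
have Eq : wI mu w (fun t => quad2 g M (vec t - theta0)) = _ :=
  post_quad2 theta0 kap_gt0 m prec g M_sym.
have Iqi a' : wint mu w (fun t => dot a' (X t) * quad2 g M (vec t - theta0)) :=
  post_wint_dot_quad2 theta0 m prec g M_sym a'.
have Eqi a' : wI mu w (fun t => dot a' (X t) * quad2 g M (vec t - theta0)) = _ :=
  post_dot_quad2 theta0 kap_gt0 m prec g M_sym a'.
have Xd i t : X t i ord0 = dot (delta_mx i ord0) (X t) by rewrite dot_delta.
have Irem0 : wint mu w rem by apply: eq_wint I0 => t; rewrite mul1r.
have Iremi i : wint mu w (fun t => X t i ord0 * rem t).
  apply: eq_wint (wintZ S^-1 (rem2 i).1) => t.
  by rewrite -mulrA mulKf// gt_eqF.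
pose Z := wI mu w (fun t => p (vec t)) / K.
pose rho0 := wI mu w rem / K.
have pE t : p (vec t) = quad2 g M (vec t - theta0) + rem t by rewrite /rem addrC subrK.
have ZE : Z = 1 + dot g x + dot x (M *m x) / 2 + \tr (M *m C) / 2 + rho0.
  have E : wI mu w (fun t => p (vec t)) =
      wI mu w (fun t => quad2 g M (vec t - theta0)) + wI mu w rem.
    by rewrite -wID//; apply: eq_wI => t; exact: pE.
  by rewrite /Z E Eq -/K /rho0; field; rewrite gt_eqF.
have h0 : `|rho0| <= rc * eps * (N^-1 + `|x| ^+ 2).
  rewrite /rho0 normrM normfV (gtr0_norm K0) ler_pdivrMr//.
  by move: e0; congr (`|_| <= _); apply: eq_wI => t; rewrite mul1r.
pose V : 'cV[R]_n := \col_i (wI mu w (fun t => X t i ord0 * p (vec t)) / K).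
pose rho1 : 'cV[R]_n := \col_i (wI mu w (fun t => X t i ord0 * rem t) / K).
have VE : V = C *m (g + M *m x) + rho1.
  apply/matrixP => i j; rewrite (ord1 j) [LHS]mxE [RHS]mxE.
  rewrite -[(C *m _) i ord0]dot_delta mxE.
  have E : wI mu w (fun t => X t i ord0 * p (vec t)) =
      wI mu w (fun t => dot (delta_mx i ord0) (X t) * quad2 g M (vec t - theta0)) +
      wI mu w (fun t => X t i ord0 * rem t).
    by rewrite -wID//; apply: eq_wI => t; rewrite pE mulrDr -Xd.
  by rewrite E Eqi -/K; field; rewrite gt_eqF.
have h1 : `|rho1| <= rc * eps * (N^-1 + `|x| ^+ 2) / Num.sqrt N.
  apply: norm_le_coef => [|i j].
    apply: divr_ge0; last exact: sqrtr_ge0.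
    apply: mulr_ge0; first by apply: mulr_ge0; exact: ltW.
    by rewrite addr_ge0 ?exprn_ge0 ?invr_ge0 ?(ltW N0).
  rewrite mxE normrM normfV (gtr0_norm K0) ler_pdivrMr// mulrAC ler_pdivlMr//.
  have [_] := rem2 i; congr (_ <= _).
  rewrite -[X in _ * X](gtr0_norm S0) -normrM mulrC -wIZ//.
  by congr (`|_|); apply: eq_wI => t; rewrite mulrA.
have := quotient_expansion Lam_gt0 (ltW rc0) N1' (prec_C prec) (ltW eps0) eps1
  Seps xB NB h0 h1 ZE VE.
congr (`|_ - _| <= _).
apply/matrixP => i j; rewrite !mxE /Z invf_div.
by rewrite [LHS]mulrC mulrA divfK ?gt_eqF.
Qed.

End PosteriorMean.

(** * A bound on the posterior mean far from the true parameter *)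

Section PosteriorShiftRisk.
Context {R : realType} {n : nat}.
Context (theta0 : 'cV[R]_n) (kap kap' Lam k0 : R).
Hypothesis kap_gt0 : 0 < kap.
Hypothesis kap'_gt0 : 0 < kap'.
Hypothesis k0_gt0 : 0 < k0.
Context (g : 'cV[R]_n) (H : 'M[R]_n) (p : 'cV[R]_n -> R).
Hypothesis p_ge0 : forall t, 0 <= p t.

Let mu := lebesgueRn R n.
Let M := logM g H.

Hypothesis p_int : wint mu (ref_weight theta0 k0) (fun t => p (vec t)).
Hypothesis taylor : forall eps : R, 0 < eps -> exists2 r : R, 0 < r &
  forall h, `|h| <= r -> `|p (theta0 + h) - quad2 g M h| <= eps * `|h| ^+ 2.

Lemma taylor_lower : exists2 eta : R, 0 < eta &
  forall h, `|h| <= eta -> 2^-1 <= p (theta0 + h).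
Proof.
have [r r0 hr] := taylor ltr01.
pose D := n%:R * `|g| + n%:R ^+ 2 * `|M| + 1.
have D0 : 0 < D by rewrite ltr_wpDl// addr_ge0 ?mulr_ge0 ?exprn_ge0.
exists (Num.min r (Num.min 1 (2 * D)^-1)).
  by rewrite !lt_min r0 ltr01 invr_gt0 mulr_gt0.
move=> h; rewrite !le_min => /and3P[hr1 h1 hD].
have a0 : 0 <= `|h| by exact: normr_ge0.
have aa : `|h| ^+ 2 <= `|h| by rewrite expr2 ler_piMr.
have t1 := norm_dot_le g h; have t2 := norm_quad_le M h h.
have t2' : `|dot h (M *m h)| <= n%:R ^+ 2 * `|M| * `|h|.
  apply: le_trans t2 _.
  have -> : n%:R ^+ 2 * `|M| * `|h| * `|h| = n%:R ^+ 2 * `|M| * `|h| ^+ 2 by ring.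
  by apply: ler_wpM2l => //; apply: mulr_ge0 => //; exact: exprn_ge0.
have t3 := hr h hr1; rewrite mul1r in t3.
have l1 : - `|dot g h| <= dot g h by rewrite lerNl -normrN ler_norm.
have l2 : - `|dot h (M *m h)| <= dot h (M *m h) by rewrite lerNl -normrN ler_norm.
have l3 : - `|p (theta0 + h) - quad2 g M h| <= p (theta0 + h) - quad2 g M h.
  by rewrite lerNl -normrN ler_norm.
have hD2 : D * `|h| <= 2^-1.
  rewrite -ler_pdivlMl//; apply: le_trans hD _.
  by rewrite invfM mulrC.
have n0 : 0 <= `|dot h (M *m h)| by exact: normr_ge0.
move: hD2 l3; rewrite /D /quad2 !mulrDl mul1r; lra.
Qed.

(** Far from [theta0] the Taylor expansion carries no information, and the prior
    is compared with the reference weight instead: the evidence is at least the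
    contribution of a box around [theta0], against which the tail beyond a
    multiple of [`|m - theta0| + eta] is negligible. *)
Lemma post_shift_crude : exists c Ns : R, 0 < c /\ forall N Q C m, Ns <= N ->
  precision kap kap' Lam N Q C ->
  `|post_shift p Q m| <= c * (1 + `|m - theta0|).
Proof.
have [eta eta0 hlow] := taylor_lower.
(* With this [L] the tail beyond [L * (`|x| + eta)] decays faster, by a factor
   [expR (- (N * eta ^+ 2 / 2))], than the lower bound on the evidence. *)
pose L := 1 + 2 * (kap' + 1) / kap.
have L1 : 1 <= L by rewrite lerDl divr_ge0 ?mulr_ge0 ?addr_ge0 ?(ltW kap'_gt0) ?(ltW kap_gt0).
have L0 : 0 < L := lt_le_trans ltr01 L1.
have Lk : kap' + 1 <= kap * L ^+ 2 / 2.
  have : L <= L ^+ 2 by rewrite expr2 ler_peMl// ltW.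
  have kL : kap * L = kap + 2 * (kap' + 1) by rewrite /L; field; rewrite gt_eqF.
  move=> /(ler_wpM2l (ltW kap_gt0)); rewrite kL; move: kap_gt0; lra.
pose G := wI mu (ref_weight theta0 k0) (fun t => p (vec t)).
have G0 : 0 <= G by apply: wI_ge0 => // t; exact: expR_ge0.
have box0 : 0 < (2 * eta) ^+ n by rewrite exprn_gt0// mulr_gt0.
pose c1 := 8 * G / (eta ^+ 2 * (2 * eta) ^+ n).
have c10 : 0 <= c1.
  apply: divr_ge0; first exact: mulr_ge0.
  by apply: mulr_ge0; [apply: exprn_ge0 | ]; exact: ltW.
exists (L + (L * eta + c1)), (Num.max (4 * n%:R * k0) (2 * (2 * n%:R * k0 + 1) / kap)).
split; first by rewrite ltr_wpDr// addr_ge0// mulr_ge0 ?(ltW L0) ?(ltW eta0).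
move=> N Q C m; rewrite ge_max => /andP[N4 Nkap] prec.
have N1 := prec_N prec; have N0 : 0 < N := lt_le_trans ltr01 N1.
have hN : 2 * (2 * n%:R * k0 + 1) <= kap * N by rewrite [leRHS]mulrC -ler_pdivrMr.
set x := m - theta0; have x0 : 0 <= `|x| by exact: normr_ge0.
pose X (t : Rtuple R n) := vec t - m; pose w (t : Rtuple R n) := gw Q (X t).
have Ip : wint mu w (fun t => p (vec t)).
  have : wint mu w (fun t => 1 * p (vec t)).
    apply: (post_wint_prior kap_gt0 k0_gt0 prec p_ge0 p_int hN) => // t.
    by rewrite normr1 lerDl mulr_ge0 ?(ltW N0).
  by apply: eq_wint => t; rewrite mul1r.
have IXp i : wint mu w (fun t => X t i ord0 * p (vec t)).
  apply: (post_wint_prior kap_gt0 k0_gt0 prec p_ge0 p_int hN).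
    exact: mcv_centered.
  move=> t; apply: le_trans (coef_le_norm _ _ _) _.
  apply: (@le_trans _ _ (N * `|X t|)); first by rewrite ler_peMl.
  by rewrite lerDr.
pose Z := wI mu w (fun t => p (vec t)).
pose e := expR (- (kap' * N * (`|x| + eta) ^+ 2)).
have Zge : 2^-1 * e * (2 * eta) ^+ n <= Z.
  exact: (post_evidence_ge kap'_gt0 prec p_ge0 eta0 _ hlow Ip).
have Z0 : 0 < Z.
  by apply: lt_le_trans Zge; rewrite !mulr_gt0 ?expR_gt0.
pose rho := L * (`|x| + eta).
have xe0 : 0 <= `|x| + eta by rewrite addr_ge0// ltW.
have rho0 : 0 <= rho by rewrite mulr_ge0// ltW.
have tailZ : 2 * N * expR (2 * n%:R * k0 * `|x| ^+ 2 - kap * N * rho ^+ 2 / 2) * G <= c1 * Z.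
  pose f := expR (- (N * eta ^+ 2 / 2)).
  have h1 : expR (2 * n%:R * k0 * `|x| ^+ 2 - kap * N * rho ^+ 2 / 2) <= f * e.
    rewrite /f /e -expRD ler_expR.
    pose y := `|x| + eta; rewrite -/y in xe0 *.
    have xy : `|x| ^+ 2 <= y ^+ 2 by rewrite lerXn2r ?nnegrE// lerDl ltW.
    have ey : eta ^+ 2 <= y ^+ 2 by rewrite lerXn2r ?nnegrE ?(ltW eta0)// lerDr.
    have y2 : 0 <= y ^+ 2 by exact: exprn_ge0.
    have u1 : 2 * n%:R * k0 * `|x| ^+ 2 <= N / 2 * y ^+ 2.
      by rewrite ler_pM ?exprn_ge0 ?mulr_ge0 ?(ltW k0_gt0)//; move: N4; lra.
    have u2 : (kap' + 1) * (N * y ^+ 2) <= kap * L ^+ 2 / 2 * (N * y ^+ 2).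
      by rewrite ler_wpM2r// mulr_ge0 ?(ltW N0).
    have u3 : N * eta ^+ 2 <= N * y ^+ 2 by rewrite ler_wpM2l ?(ltW N0).
    have -> : kap * N * rho ^+ 2 / 2 = kap * L ^+ 2 / 2 * (N * y ^+ 2).
      by rewrite /rho -/y; ring.
    have u4 : (kap' + 1) * (N * y ^+ 2) = kap' * N * y ^+ 2 + N * y ^+ 2 by ring.
    by move: u1 u2 u3 u4; lra.
  have h2 : N * f <= 2 / eta ^+ 2.
    rewrite /f expRN ler_pdivrMr ?expR_gt0// mulrAC ler_pdivlMr ?exprn_gt0//.
    have := expR_ge1Dx (N * eta ^+ 2 / 2); lra.
  apply: (@le_trans _ _ (2 * N * (f * e) * G)).
    by rewrite ler_wpM2r// ler_wpM2l// mulr_ge0// ltW.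
  have -> : 2 * N * (f * e) * G = 2 * G * e * (N * f) by ring.
  apply: (@le_trans _ _ (2 * G * e * (2 / eta ^+ 2))).
    by rewrite ler_wpM2l// !mulr_ge0 ?expR_ge0.
  have -> : 2 * G * e * (2 / eta ^+ 2) = c1 * (2^-1 * e * (2 * eta) ^+ n).
    by rewrite /c1; field; rewrite !gt_eqF.
  by rewrite ler_wpM2l.
apply: norm_le_coef => [|i j].
  apply: mulr_ge0; last by rewrite addr_ge0.
  by rewrite addr_ge0 ?(ltW L0)// addr_ge0// mulr_ge0 ?(ltW L0) ?(ltW eta0).
rewrite mxE normrM normfV (gtr0_norm Z0) ler_pdivrMr//.
have := post_mean_crude kap_gt0 k0_gt0 prec p_ge0 p_int hN rho0 Ip (IXp i).
move=> /le_trans; apply.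
apply: le_trans (lerD (lexx _) tailZ) _.
rewrite -mulrDl ler_wpM2r ?(ltW Z0)//.
have : 0 <= (L * eta + c1) * `|x|.
  by rewrite mulr_ge0// addr_ge0// mulr_ge0 ?(ltW L0) ?(ltW eta0).
have -> : (L + (L * eta + c1)) * (1 + `|x|) =
  rho + c1 + (L + (L * eta + c1) * `|x|) by rewrite /rho; ring.
by move=> h; rewrite lerDl addr_ge0 ?(ltW L0).
Qed.

End PosteriorShiftRisk.

(** * Pointwise expansion of the excess loss *)

Section RiskExpansion.
Context {R : realType} {n : nat}.
Hypothesis n_gt0 : (0 < n)%N.
Context (theta0 : 'cV[R]_n) (kap kap' Lam k0 : R).
Hypothesis kap_gt0 : 0 < kap.
Hypothesis kap'_gt0 : 0 < kap'.
Hypothesis Lam_gt0 : 0 < Lam.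
Hypothesis k0_gt0 : 0 < k0.
Context (g : 'cV[R]_n) (H : 'M[R]_n) (p : 'cV[R]_n -> R).
Hypothesis H_sym : H^T = H.
Hypothesis p_ge0 : forall t, 0 <= p t.

Let mu := lebesgueRn R n.
Let M := logM g H.

Hypothesis p_int : wint mu (ref_weight theta0 k0) (fun t => p (vec t)).
Hypothesis quad_int :
  wint mu (ref_weight theta0 k0) (fun t => quad2 g M (vec t - theta0)).
Hypothesis taylor : forall eps : R, 0 < eps -> exists2 r : R, 0 < r &
  forall h, `|h| <= r -> `|p (theta0 + h) - quad2 g M h| <= eps * `|h| ^+ 2.

Definition excess_loss (x b : 'cV[R]_n) : R := 2 * dot x b + sqnorm b.

Lemma sqnormD_excess (x b : 'cV[R]_n) :
  sqnorm (x + b) = sqnorm x + excess_loss x b.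
Proof. by rewrite /excess_loss !sqnormE !dotDl !dotDr (dotC b x); ring. Qed.

(** The excess loss at the shift [C *m g + C *m (H *m x)], without the part of
    its square that is smaller than [N ^- 2] when [x] is of order [N ^- 1 / 2]
    and [C] of order [N^-1]. *)
Definition excess_loss2 (C : 'M[R]_n) (x : 'cV[R]_n) : R :=
  2 * dot x (C *m g) + 2 * dot x (C *m (H *m x)) + sqnorm (C *m g).

Lemma excess_lossB (C : 'M[R]_n) (x b : 'cV[R]_n) :
  excess_loss x b - excess_loss2 C x =
  2 * dot x (b - (C *m g + C *m (H *m x))) + dot (b - C *m g) (b + C *m g).
Proof.
rewrite /excess_loss /excess_loss2 !sqnormE !dotBr !dotDr !dotBl.
by rewrite (dotC (C *m g) b); ring.
Qed.

(** For errors of the typical size [N ^- 1 / 2] the first term of the bound is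
    [eps * N ^- 2] and the second one is [O(N ^- 3)]. The first comes from
    [post_shift_expansion]. The second covers errors larger than a fixed [r],
    where [post_shift_crude] bounds the loss by [1 + `|x| ^+ 2] and
    [1 <= (`|x| / r) ^+ 4]. *)
Lemma risk_expansion : exists2 c : R, 0 < c & forall eps : R, 0 < eps -> eps <= 1 ->
  exists ce Ns : R, 0 <= ce /\ forall N Q C m, Ns <= N ->
    precision kap kap' Lam N Q C ->
    `|excess_loss (m - theta0) (post_shift p Q m) - excess_loss2 C (m - theta0)| <=
      c * eps * (N^-1 + `|m - theta0| ^+ 2) ^+ 2 +
      ce * (N^-1 + `|m - theta0| ^+ 2) ^+ 3.
Proof.
pose rc : R := @remainder_cst R n Lam.
pose B := expansion_cst g H Lam rc.
have rc0 : 0 < rc := @remainder_cst_gt0 R n Lam Lam_gt0.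
have B1 : 1 <= B := expansion_cst_ge1 g H Lam_gt0 (ltW rc0).
have B0 : 0 < B := lt_le_trans ltr01 B1.
pose c5 := 2 * (rc + 5 * B ^+ 2).
have c50 : 0 < c5 by rewrite mulr_gt0// ltr_wpDr// mulr_ge0// exprn_ge0// ltW.
have nR : (0 : R) <= n%:R by [].
have cBn : 0 <= n%:R * (c5 + B) * (c5 + 3 * B).
  by nonneg.
exists (n%:R * c5 + n%:R * (c5 + B) * (c5 + 3 * B) + 1).
  by rewrite ltr_wpDl// addr_ge0// mulr_ge0// ltW.
move=> eps eps0 eps1.
have [r [N1 [r0 reps hgood]]] := post_shift_expansion n_gt0 kap_gt0 kap'_gt0 Lam_gt0
  k0_gt0 H_sym p_int quad_int taylor eps0 eps1.
have [c7 [N2 [c70 hcrude]]] := post_shift_crude Lam kap_gt0 kap'_gt0 k0_gt0 p_ge0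
  p_int taylor.
pose E := 2 * n%:R * c7 + n%:R * c7 ^+ 2 + 4 * n%:R * B + n%:R * B ^+ 2.
have E0 : 0 <= E.
  by rewrite /E; nonneg.
exists (E * (r^-1 + 1) ^+ 2 / r ^+ 4), (Num.max N1 N2); split.
  by nonneg.
move=> N Q C m; rewrite ge_max => /andP[NN1 NN2] prec.
have N1' := prec_N prec; have N0 : 0 < N := lt_le_trans ltr01 N1'.
have iN1 : N^-1 <= 1 by rewrite invf_le1.
have iN0 : 0 <= N^-1 by rewrite invr_ge0 ltW.
have hg := hgood N Q C m NN1 prec; have hc := hcrude N Q C m NN2 prec.
move: hg hc; set x := m - theta0; set b := post_shift p Q m => hg hc.
set s := N^-1 + `|x| ^+ 2 in hg *.
have x0 : 0 <= `|x| by exact: normr_ge0.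
have x20 : 0 <= `|x| ^+ 2 by exact: exprn_ge0.
have s0 : 0 <= s by exact: addr_ge0.
have iNs : N^-1 <= s by rewrite /s lerDl.
have xs : `|x| ^+ 2 <= s by rewrite /s lerDr.
have nCg : `|C *m g| <= B / N := norm_Cg_le g H Lam_gt0 (ltW rc0) N1' (prec_C prec).
have nCHx : `|C *m (H *m x)| <= B / N * `|x|.
  exact: (norm_CHx_le _ _ Lam_gt0 (ltW rc0) _ N1' (prec_C prec)).
have [hx|hx] := leP `|x| r.
  apply: ler_wpDr.
    apply: mulr_ge0; last exact: exprn_ge0.
    by nonneg.
  have {}hg := hg hx; rewrite -/c5 in hg.
  set D := b - (C *m g + C *m (H *m x)) in hg.
  pose S := Num.sqrt N.
  have S1 : 1 <= S by rewrite -[leLHS]sqrtr1 ler_wsqrtr.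
  have S0 : 0 < S := lt_le_trans ltr01 S1.
  have S2 : S ^+ 2 = N by rewrite sqr_sqrtr// ltW.
  have xS : 2 * (`|x| / S) <= s.
    have := sqr_ge0 (`|x| - S^-1).
    have -> : (`|x| - S^-1) ^+ 2 = `|x| ^+ 2 - 2 * (`|x| / S) + (S ^+ 2)^-1.
      by field; rewrite gt_eqF.
    by rewrite S2 /s; lra.
  have cs0 : 0 <= c5 * eps * s by nonneg.
  rewrite excess_lossB -/D; apply: le_trans (ler_normD _ _) _.
  have t1 : `|2 * dot x D| <= n%:R * c5 * eps * s ^+ 2.
    rewrite normrM (ger0_norm (ler0n R 2)).
    apply: (@le_trans _ _ (2 * (n%:R * `|x| * (c5 * eps * s / S)))).
      rewrite ler_wpM2l//; apply: le_trans (norm_dot_le _ _) _.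
      by rewrite ler_wpM2l// mulr_ge0.
    have -> : 2 * (n%:R * `|x| * (c5 * eps * s / S)) =
      n%:R * (c5 * eps * s) * (2 * (`|x| / S)) by ring.
    have -> : n%:R * c5 * eps * s ^+ 2 = n%:R * (c5 * eps * s) * s by ring.
    by rewrite ler_wpM2l// mulr_ge0.
  have t2 : `|b - C *m g| <= (c5 + B) * (eps * s).
    have -> : b - C *m g = D + C *m (H *m x).
      by rewrite /D opprD addrA subrK.
    apply: le_trans (ler_normD _ _) _; rewrite mulrDl lerD//.
      apply: le_trans hg _; rewrite mulrA ler_piMr// invf_le1//.
    apply: le_trans nCHx _; rewrite -mulrA ler_wpM2l ?(ltW B0)// mulrC ler_pM//.
    exact: le_trans hx reps.
  have t3 : `|b + C *m g| <= (c5 + 3 * B) * s.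
    have -> : b + C *m g = (b - C *m g) + (C *m g + C *m g) by rewrite addrA subrK.
    apply: le_trans (ler_normD _ _) _.
    have t4 := ler_normD (C *m g) (C *m g).
    have t5 : B / N <= B * s by rewrite ler_wpM2l ?(ltW B0).
    have t6 : (c5 + B) * (eps * s) <= (c5 + B) * s.
      rewrite ler_wpM2l//; first by rewrite addr_ge0// ltW.
      by rewrite ler_piMl.
    have -> : (c5 + 3 * B) * s = (c5 + B) * s + (B * s + B * s) by ring.
    by move: t2 t4 t5 t6 nCg; lra.
  have t4 : `|dot (b - C *m g) (b + C *m g)| <=
      n%:R * (c5 + B) * (c5 + 3 * B) * eps * s ^+ 2.
    apply: le_trans (norm_dot_le _ _) _.
    have -> : n%:R * (c5 + B) * (c5 + 3 * B) * eps * s ^+ 2 =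
      n%:R * ((c5 + B) * (eps * s)) * ((c5 + 3 * B) * s) by ring.
    by rewrite ler_pM ?mulr_ge0// ler_wpM2l.
  apply: le_trans (lerD t1 t4) _.
  have es0 : 0 <= eps * s ^+ 2 by nonneg.
  rewrite -subr_ge0 [X in 0 <= X](_ : _ = eps * s ^+ 2)//.
  by ring.
apply: ler_wpDl.
  by nonneg.
set y := 1 + `|x| in hc.
have y0 : 0 <= y by rewrite addr_ge0.
have xy : `|x| <= y by rewrite lerDr.
have y1 : 1 <= y by rewrite lerDl.
have BN : B / N <= B by rewrite ler_piMr ?(ltW B0).
have Cg1 : `|C *m g| <= B * y.
  by apply: le_trans nCg (le_trans BN _); rewrite ler_peMr ?(ltW B0).
have CHx1 : `|C *m (H *m x)| <= B * y.
  by apply: le_trans nCHx _; rewrite ler_pM ?divr_ge0 ?(ltW B0) ?(ltW N0).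
have dot_le (u v : 'cV[R]_n) a1 a2 : `|u| <= a1 -> `|v| <= a2 ->
    `|dot u v| <= n%:R * (a1 * a2).
  move=> h1 h2; apply: le_trans (norm_dot_le _ _) _.
  by rewrite -mulrA ler_wpM2l// ler_pM.
have hE : `|excess_loss x b - excess_loss2 C x| <= E * y ^+ 2.
  rewrite /excess_loss /excess_loss2.
  have d1 := dot_le _ _ _ _ xy hc; have d2 := dot_le _ _ _ _ hc hc.
  have d3 := dot_le _ _ _ _ xy Cg1; have d4 := dot_le _ _ _ _ xy CHx1.
  have d5 := dot_le _ _ _ _ Cg1 Cg1.
  rewrite !sqnormE; set q1 := dot x b in d1 *; set q2 := dot b b in d2 *.
  set q3 := dot x (C *m g) in d3 *; set q4 := dot x _ in d4 *; set q5 := dot _ _ in d5 *.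
  have -> : E * y ^+ 2 = 2 * (n%:R * (y * (c7 * y))) + n%:R * (c7 * y * (c7 * y)) +
    (2 * (n%:R * (y * (B * y))) + 2 * (n%:R * (y * (B * y))) + n%:R * (B * y * (B * y))).
    by rewrite /E; ring.
  move: d1 d2 d3 d4 d5; rewrite !ler_norml.
  move=> /andP[? ?] /andP[? ?] /andP[? ?] /andP[? ?] /andP[? ?].
  by apply/andP; split; lra.
apply: le_trans hE _.
have yr : y <= (r^-1 + 1) * `|x|.
  rewrite mulrDl mul1r lerD2r// -(mulVf (_ : r != 0)) ?gt_eqF//.
  by rewrite ler_wpM2l ?invr_ge0 ?(ltW r0)// ltW.
have r4 : r ^+ 4 <= `|x| ^+ 4 by rewrite lerXn2r ?nnegrE ?(ltW r0)// ltW.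
have x6 : `|x| ^+ 6 <= s ^+ 3.
  have -> : `|x| ^+ 6 = (`|x| ^+ 2) ^+ 3 by rewrite -exprM.
  by rewrite lerXn2r ?nnegrE.
apply: (@le_trans _ _ (E * ((r^-1 + 1) * `|x|) ^+ 2)).
  by rewrite ler_wpM2l// lerXn2r ?nnegrE// mulr_ge0// addr_ge0// invr_ge0 ltW.
rewrite exprMn mulrA -[leRHS]mulrA ler_wpM2l//.
  by nonneg.
rewrite mulrC ler_pdivlMr ?exprn_gt0//.
apply: le_trans x6.
have -> : `|x| ^+ 6 = `|x| ^+ 2 * `|x| ^+ 4 by rewrite -exprD.
by rewrite ler_wpM2l.
Qed.

End RiskExpansion.

(** * Growth of the information matrix *)

Lemma cvg_big_sum (R : realType) (T I : Type) (F : set_system T) {FF : Filter F}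
  (s : seq I) (f : I -> T -> R) (l : I -> R) :
  (forall i, f i x @[x --> F] --> l i) ->
  (\sum_(i <- s) f i x) @[x --> F] --> \sum_(i <- s) l i.
Proof.
move=> fl; elim: s => [|i s IH].
  by rewrite big_nil; under eq_fun do rewrite big_nil; exact: cvg_cst.
by rewrite big_cons; under eq_fun do rewrite big_cons; exact: cvgD.
Qed.

Section Coercivity.
Context {R : realType} {n : nat}.
Hypothesis n_gt0 : (0 < n)%N.

Lemma norm_trmx m1 n1 (A : 'M[R]_(m1, n1)) : `|A^T| = `|A|.
Proof.
apply/eqP; rewrite eq_le; apply/andP; split; apply: norm_le_coef => // i j.
  by rewrite mxE coef_le_norm.
by have := coef_le_norm A^T j i; rewrite mxE.
Qed.

(** The quadratic form attains a positive minimum on the unit sphere. *)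
Lemma posdef_coercive (S : 'M[R]_n) : posdefmx S ->
  exists2 lam : R, 0 < lam & forall x, lam * `|x| ^+ 2 <= dot x (S *m x).
Proof.
move=> [_ Spos].
pose f (v : 'rV[R]_n) := dot v^T (S *m v^T).
pose A := [set v : 'rV[R]_n | `|v| = 1].
have cf : continuous f.
  have -> : f = fun v => \sum_i \sum_j S i j * (v ord0 i * v ord0 j).
    apply/funext => v; rewrite /f dot_quadE.
    by apply: eq_bigr => i _; apply: eq_bigr => j _; rewrite !mxE.
  move=> v; apply: (cvg_big_sum (F := nbhs v)) => i.
  apply: (cvg_big_sum (F := nbhs v)) => j.
  apply: cvgM; first exact: cvg_cst.
  by apply: cvgM; exact: coord_continuous.
have A0 : A !=set0.
  exists (const_mx 1); rewrite /A /=; apply/eqP; rewrite eq_le; apply/andP; split.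
    by apply: norm_le_coef => // i j; rewrite mxE normr1.
  have := coef_le_norm (const_mx 1 : 'rV[R]_n) ord0 (Ordinal n_gt0).
  by rewrite mxE normr1.
have cA : compact A.
  apply: bounded_closed_compact.
    by exists 1; split => // M M1 v; rewrite /A /= => ->; exact: ltW.
  rewrite (_ : A = (fun v : 'rV[R]_n => `|v|) @^-1` [set 1]) //.
  apply: closed_comp; last exact: closed_eq.
  by move=> v _; exact: norm_continuous.
have [v Av vmin] := EVT_min_rV A0 cA (continuous_subspaceT cf).
have v1 : `|v| = 1 by move: Av; rewrite inE.
have v0 : v != 0 by apply/eqP => v0; move: v1; rewrite v0 normr0 => /esym/eqP; rewrite oner_eq0.
exists (f v).
  rewrite /f dot_mxE mulmxA; apply: Spos.
  by apply/eqP => h; move: v0; rewrite -(trmxK v) h trmx0 eqxx.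
move=> x; have [->|x0] := eqVneq x 0.
  by rewrite normr0 expr0n/= mulr0 mulmx0 dot0l.
have nx0 : 0 < `|x| by rewrite normr_gt0.
have hx : A (`|x|^-1 *: x^T).
  by rewrite /A /= normrZ norm_trmx normfV normr_id mulVf// gt_eqF.
have := vmin (`|x|^-1 *: x^T); rewrite inE => /(_ hx).
rewrite {2}/f linearZ/= trmxK -scalemxAr dotZl dotZr mulrA -expr2 exprVn.
by rewrite mulrC ler_pdivlMr ?exprn_gt0.
Qed.

Lemma unitmx_pos (A : 'M[R]_n) : (forall x, x != 0 -> 0 < dot x (A *m x)) -> A \in unitmx.
Proof.
move=> pos; rewrite unitmxE unitfE; apply/negP => /det0P[v v0 vA].
have vT0 : v^T != 0 by apply/eqP => h; move: v0; rewrite -(trmxK v) h trmx0 eqxx.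
by have := pos _ vT0; rewrite dot_mulmx -trmx_mul vA trmx0 dot0l ltxx.
Qed.

Lemma invmx_sym (A : 'M[R]_n) : A^T = A -> (invmx A)^T = invmx A.
Proof. by move=> sA; rewrite trmx_inv sA. Qed.

Context (s2 : R) (A : nat -> 'M[R]_n) (S : 'M[R]_n).
Hypothesis s2_gt0 : 0 < s2.
Hypothesis A_sym : forall N, (A N)^T = A N.
Hypothesis A_cvg : (fun N : nat => N%:R^-1 *: A N) @ \oo --> S.
Hypothesis S_pos : posdefmx S.
Hypothesis std_int :
  (lebesgueRn R n).-integrable setT (fun t => (gw (s2^-1)%:M (vec t))%:E).

(** After division by [N] the information matrices converge, so their quadratic
    forms eventually lie between half the coercivity constant of the limit and a
    fixed upper bound. A lower bound on a quadratic form is an upper bound on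
    the columns of the inverse matrix. *)
Lemma precision_eventually : exists kap kap' Lam : R,
  [/\ 0 < kap, 0 < kap', 0 < Lam & \forall N \near \oo,
    A N \in unitmx /\ precision kap kap' Lam N%:R (s2^-1 *: A N) (s2 *: invmx (A N))].
Proof.
have [lam lam0 hlam] := posdef_coercive S_pos.
have nR : (0 : R) < n%:R by rewrite ltr0n.
(* Entries within [del] of the limit change the quadratic form by [lam / 2]. *)
pose del := lam / (2 * n%:R ^+ 2).
have del0 : 0 < del by rewrite divr_gt0 ?mulr_gt0 ?exprn_gt0.
pose kap := lam / (4 * s2).
pose kap' := n%:R ^+ 2 * (`|S| + del) / (2 * s2).
have kap0 : 0 < kap by rewrite divr_gt0 ?mulr_gt0.
have kap'0 : 0 < kap'.
  by rewrite divr_gt0 ?mulr_gt0 ?exprn_gt0// ltr_wpDl.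
pose Lam := (2 * kap)^-1.
have Lam0 : 0 < Lam by rewrite invr_gt0 mulr_gt0.
exists kap, kap', Lam; split => //.
have hB : \forall N \near \oo, `|S - N%:R^-1 *: A N| <= del.
  by move/cvgrPdist_le : A_cvg => /(_ _ del0).
have [N1 hN1] : exists N1 : nat, n%:R / (2 * s2 * kap) <= N1%:R.
  exists (Num.bound (n%:R / (2 * s2 * kap))); apply/ltW/archi_boundP.
  by nonneg.
near=> N.
have N0 : (0 < N)%N by near: N; exact: nbhs_infty_gt.
have NR : (0 : R) < N%:R by rewrite ltr0n.
have hBN : `|S - N%:R^-1 *: A N| <= del by near: N.
have hN : n%:R / (2 * s2 * kap) <= N%:R.
  by apply: le_trans hN1 _; rewrite ler_nat; near: N; exact: nbhs_infty_ge.
set Bm := N%:R^-1 *: A N in hBN.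
have AE : A N = N%:R *: Bm by rewrite scalerA divff ?gt_eqF// scale1r.
have quadA x : dot x (A N *m x) = N%:R * dot x (Bm *m x).
  by rewrite AE -scalemxAl dotZr.
have quadD x : `|dot x (S *m x) - dot x (Bm *m x)| <= n%:R ^+ 2 * del * `|x| ^+ 2.
  rewrite -dotBr -mulmxBl; apply: le_trans (norm_quad_le _ _ _) _.
  rewrite -mulrA -expr2 ler_wpM2r ?exprn_ge0// ler_wpM2l ?exprn_ge0// ltW.
have lowB x : lam / 2 * `|x| ^+ 2 <= dot x (Bm *m x).
  have h1 := hlam x; have := quadD x; rewrite ler_norml => /andP[_ h2].
  have : n%:R ^+ 2 * del = lam / 2 by rewrite /del; field; rewrite gt_eqF.
  by move=> e; rewrite e in h2; lra.
have upB x : dot x (Bm *m x) <= n%:R ^+ 2 * (`|S| + del) * `|x| ^+ 2.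
  apply: le_trans (ler_norm _) _; apply: le_trans (norm_quad_le _ _ _) _.
  rewrite -mulrA -expr2 ler_wpM2r ?exprn_ge0// ler_wpM2l ?exprn_ge0//.
  have -> : Bm = S - (S - Bm) by rewrite opprB addrC subrK.
  by apply: le_trans (ler_normB _ _) _; rewrite lerD2l.
have AU : A N \in unitmx.
  apply: unitmx_pos => x x0; rewrite quadA mulr_gt0//.
  by apply: lt_le_trans (lowB x); rewrite mulr_gt0 ?exprn_gt0 ?normr_gt0// divr_gt0.
split => //.
set Q := s2^-1 *: A N; set C := s2 *: invmx (A N).
have QC : Q *m C = 1%:M.
  by rewrite /Q /C -scalemxAl -scalemxAr scalerA mulVf ?gt_eqF// scale1r mulmxV.
have quadQ x : dot x (Q *m x) / 2 = N%:R * dot x (Bm *m x) / (2 * s2).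
  by rewrite /Q -scalemxAl dotZr quadA; field; rewrite gt_eqF.
have lowQ z : kap * N%:R * `|z| ^+ 2 <= dot z (Q *m z) / 2.
  rewrite quadQ; have -> : kap * N%:R * `|z| ^+ 2 =
    N%:R * (lam / 2 * `|z| ^+ 2) / (2 * s2) by rewrite /kap; field; rewrite gt_eqF.
  rewrite ler_wpM2r ?invr_ge0 ?mulr_ge0 ?(ltW s2_gt0)// ler_wpM2l//.
split => //.
- by rewrite ler1n.
- by rewrite /Q linearZ/= A_sym.
- by rewrite /C linearZ/= invmx_sym.
- apply: le_integrable std_int => //.
    by apply/measurable_EFinP; apply: measurable_gw; exact: mcv_vec.
  move=> t _ /=; rewrite lee_fin !ger0_norm ?gw_ge0// ler_expR lerN2.
  apply: le_trans (lowQ _); rewrite mul_scalar_mx dotZr -sqnormE.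
  have h := sqnorm_le (vec t).
  apply: (@le_trans _ _ (s2^-1 * (n%:R * `|vec t| ^+ 2) / 2)).
    by rewrite ler_wpM2r// ler_wpM2l// invr_ge0 ltW.
  have -> : s2^-1 * (n%:R * `|vec t| ^+ 2) / 2 =
    kap * (n%:R / (2 * s2 * kap)) * `|vec t| ^+ 2.
    by field; rewrite !gt_eqF.
  by rewrite ler_wpM2r ?exprn_ge0// ler_wpM2l// ltW.
- move=> z; rewrite quadQ; have -> : kap' * N%:R * `|z| ^+ 2 =
    N%:R * (n%:R ^+ 2 * (`|S| + del) * `|z| ^+ 2) / (2 * s2).
    by rewrite /kap'; field; rewrite gt_eqF.
  by rewrite ler_wpM2r ?invr_ge0 ?mulr_ge0 ?(ltW s2_gt0)// ler_wpM2l.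
- have LN0 : 0 <= Lam / N%:R by rewrite divr_ge0 ?ltW.
  apply: norm_le_coef => // i j.
  pose y := col j C.
  have yE : Q *m y = delta_mx j ord0 by rewrite /y colE mulmxA QC mul1mx.
  have h := lowQ y; rewrite yE dotC dot_delta in h.
  have hy : kap * N%:R * `|y| ^+ 2 <= `|y| / 2.
    apply: le_trans h _; rewrite ler_wpM2r//.
    by apply: le_trans (ler_norm _) (coef_le_norm _ _ _).
  have yL : `|y| <= Lam / N%:R.
    have [->|y0] := eqVneq `|y| 0; first by [].
    have y1 : 0 < `|y| by rewrite lt_def y0 normr_ge0.
    have kNy : 0 < kap * N%:R * `|y| by apply: mulr_gt0 => //; exact: mulr_gt0.
    rewrite -(ler_pM2l kNy).
    have -> : kap * N%:R * `|y| * `|y| = kap * N%:R * `|y| ^+ 2 by ring.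
    apply: le_trans hy _.
    have -> : kap * N%:R * `|y| * (Lam / N%:R) = `|y| / 2.
      by rewrite /Lam; field; rewrite !gt_eqF.
    by [].
  by apply: le_trans yL; have := coef_le_norm y i ord0; rewrite mxE.
Unshelve. all: by end_near. Qed.

End Coercivity.

Section PrecisionLimit.
Context {R : realType} {n : nat}.
Context (s2 : R) (A : nat -> 'M[R]_n) (S : 'M[R]_n) (kap kap' Lam : R).
Hypothesis A_cvg : (fun N : nat => N%:R^-1 *: A N) @ \oo --> S.
Hypothesis S_unit : S \in unitmx.
Hypothesis Lam_ge0 : 0 <= Lam.
Hypothesis A_prec : \forall N \near \oo,
  A N \in unitmx /\ precision kap kap' Lam N%:R (s2^-1 *: A N) (s2 *: invmx (A N)).

(** The difference of two inverses is the product of the inverses around the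
    difference of the matrices, and [N * C] stays bounded. *)
Lemma covariance_limit :
  (fun N : nat => N%:R *: (s2 *: invmx (A N))) @ \oo --> s2 *: invmx S.
Proof.
apply/cvgrPdist_le => e e0.
pose c := n%:R * (n%:R * Lam) * `|invmx S|.
have c0 : 0 <= c by rewrite /c; nonneg.
have hB : \forall N \near \oo, `|S - N%:R^-1 *: A N| <= e / (c + 1).
  by move/cvgrPdist_le : A_cvg; apply; rewrite divr_gt0// ltr_wpDl.
near=> N.
have N0 : (0 < N)%N by near: N; exact: nbhs_infty_gt.
have NR : (0 : R) < N%:R by rewrite ltr0n.
have hBN : `|S - N%:R^-1 *: A N| <= e / (c + 1) by near: N.
have [AU prec] : A N \in unitmx /\
    precision kap kap' Lam N%:R (s2^-1 *: A N) (s2 *: invmx (A N)) by near: N.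
set B := N%:R^-1 *: A N in hBN *; set C := s2 *: invmx (A N) in prec *.
have CB : N%:R *: C *m B = s2%:M.
  rewrite /C /B -!scalemxAl -scalemxAr !scalerA mulVmx// scalemx1.
  by rewrite mulrAC mulfV ?gt_eqF// mul1r.
have CN : `|N%:R *: C| <= Lam.
  rewrite normrZ ger0_norm//; have := prec_C prec.
  by rewrite ler_pdivlMr// mulrC.
rewrite distrC.
have -> : N%:R *: C - s2 *: invmx S = N%:R *: C *m (S - B) *m invmx S.
  by rewrite mulmxBr CB mulmxBl mulmxK// mul_scalar_mx.
apply: le_trans (norm_mulmx_le _ _) _.
apply: (@le_trans _ _ (n%:R * (n%:R * Lam * (e / (c + 1))) * `|invmx S|)).
  rewrite ler_wpM2r// ler_wpM2l//; apply: le_trans (norm_mulmx_le _ _) _.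
  by rewrite ler_pM// ?mulr_ge0// ler_wpM2l.
have -> : n%:R * (n%:R * Lam * (e / (c + 1))) * `|invmx S| = c / (c + 1) * e.
  by rewrite /c; ring.
by rewrite ler_piMl ?(ltW e0)// ler_pdivrMr ?mul1r ?lerDl// ltr_wpDl.
Unshelve. all: by end_near. Qed.

End PrecisionLimit.

(** * Gaussian noise *)

Section GaussianNoise.
Context {R : realType} (d : measure_display) (Omega : measurableType d).
Context (P : probability Omega R) (N : nat) (s2 : R).
Hypothesis s2_gt0 : 0 < s2.

(** The maximum of the Gaussian density, that is its normalizing constant. *)
Definition gauss_peak : R := (Num.sqrt (2 * pi * s2)) ^- N.

Lemma gauss_peak_gt0 : 0 < gauss_peak.
Proof. by rewrite invr_gt0 exprn_gt0// sqrtr_gt0 !mulr_gt0// pi_gt0. Qed.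

Lemma gauss_pdfE (m y : 'cV[R]_N) :
  gauss_pdf s2 m y = gauss_peak * gw (s2^-1)%:M (y - m).
Proof.
rewrite /gauss_pdf /gw mul_scalar_mx dotZr -sqnormE; congr (_ * expR (- _)).
by field; rewrite gt_eqF.
Qed.

Context (E : {RV P >-> Rtuple R N}).
Hypothesis noise : gaussian_noise E s2.

Let Q : 'M[R]_N := (s2^-1)%:M.

Let pdf (e : Rtuple R N) : R := gauss_pdf s2 0 (vec e).

Let pdf_ge0 e : 0 <= pdf e.
Proof. by rewrite /pdf gauss_pdfE mulr_ge0 ?gw_ge0// ltW// gauss_peak_gt0. Qed.

Let pdfE e : pdf e = gauss_peak * gw Q (vec e).
Proof. by rewrite /pdf gauss_pdfE subr0. Qed.

Let mpdf : measurable_fun setT pdf.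
Proof.
rewrite (_ : pdf = fun e => gauss_peak * gw Q (vec e)); last exact/funext/pdfE.
by apply: measurable_funM => //; apply: measurable_gw; exact: mcv_vec.
Qed.

Let integral_pdf : (\int[lebesgueRn R N]_e (pdf e)%:E = 1)%E.
Proof. by rewrite -(noise measurableT) probability_setT. Qed.

Let pdf_int : (lebesgueRn R N).-integrable setT (fun e => (pdf e)%:E).
Proof.
apply/integrableP; split; first exact/measurable_EFinP.
under eq_integral => e _ do rewrite gee0_abs ?lee_fin ?pdf_ge0//.
by rewrite integral_pdf ltry.
Qed.

(** The density of the noise being integrable, so is the standard Gaussian
    weight; this is where the normalizability of Gaussian weights comes from. *)
Lemma std_weight_int :
  (lebesgueRn R N).-integrable setT (fun t => (gw (s2^-1)%:M (vec t))%:E).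
Proof.
apply: eq_integrable (integrableZl measurableT gauss_peak^-1 pdf_int) => // e _.
by rewrite /= -EFinM pdfE mulKf// gt_eqF// gauss_peak_gt0.
Qed.

Let mass1 : gauss_peak * gmass Q = 1.
Proof.
have : \int[lebesgueRn R N]_e pdf e = 1 by rewrite /Rintegral integral_pdf.
rewrite /gmass -RintegralZl//; last exact: std_weight_int.
by move=> <-; apply: eq_Rintegral => e _; rewrite pdfE.
Qed.

Lemma ge0_integral_noise (f : Rtuple R N -> \bar R) :
  measurable_fun setT f -> (forall e, (0 <= f e)%E) ->
  (\int[P]_w f (E w) = \int[lebesgueRn R N]_e (f e * (pdf e)%:E))%E.
Proof.
move=> mf f0.
rewrite -(ge0_integral_distribution E mf f0).
apply: ge0_integral_density => //; first exact/measurable_EFinP.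
Qed.

Let Qsym : Q^T = Q. Proof. exact: tr_scalar_mx. Qed.
Let QC : Q *m s2%:M = 1%:M.
Proof. by rewrite -scalar_mxM mulVf// gt_eqF. Qed.

Let integral_exp (b : 'cV[R]_N) :
  (\int[P]_w (expR (dot b (vec (E w))) * 1)%:E = (expR (s2 * dot b b / 2))%:E)%E.
Proof.
have mexp : measurable_fun setT (fun e : Rtuple R N => expR (dot b (vec e))).
  apply: measurableT_comp => //; apply: measurable_dot; first exact: mcv_cst.
  exact: mcv_vec.
under eq_integral => w _ do rewrite mulr1.
rewrite (ge0_integral_noise (f := fun e => (expR (dot b (vec e)))%:E)); first last.
- by move=> e; rewrite lee_fin expR_ge0.
- exact/measurable_EFinP.
have I := gw_mgf_int 0 Qsym QC std_weight_int b.
have mg := gw_mgf 0 Qsym QC std_weight_int b.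
rewrite mul_scalar_mx dotZr in mg.
transitivity ((gauss_peak * (gmass Q * expR (s2 * dot b b / 2)))%:E); last first.
  by rewrite mulrA mass1 mul1r.
rewrite -mg EFinM /wI /Rintegral fineK; last exact: integrable_fin_num.
rewrite -integralZl//; apply: eq_integral => e _.
by rewrite -!EFinM pdfE subr0; congr EFin; ring.
Qed.

Lemma noise_mgf_int (b : 'cV[R]_N) :
  wint P (fun=> 1) (fun w => expR (dot b (vec (E w)))).
Proof.
apply/integrableP; split.
  apply/measurable_EFinP; apply: measurable_funM => //.
  apply: measurableT_comp => //; apply: measurable_dot; first exact: mcv_cst.
  move=> i j; exact: (measurableT_comp (mcv_vec i j)).
under eq_integral => w _ do
  rewrite gee0_abs ?lee_fin ?mulr_ge0 ?expR_ge0//.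
by rewrite integral_exp ltry.
Qed.

Lemma noise_mgf (b : 'cV[R]_N) :
  wI P (fun=> 1) (fun w => expR (dot b (vec (E w)))) = expR (s2 * dot b b / 2).
Proof. by rewrite /wI /Rintegral integral_exp. Qed.

End GaussianNoise.

(** * The likelihood and the generalized Bayes estimator *)

Section RintegralMeasurable.
Context d1 d2 (T1 : measurableType d1) (T2 : measurableType d2) (R : realType).
Context (mu : {sigma_finite_measure set T2 -> \bar R}).

(** Tonelli's theorem for the positive and negative parts. *)
Lemma measurable_Rintegral (G : T1 * T2 -> R) : measurable_fun setT G ->
  measurable_fun setT (fun x => \int[mu]_y G (x, y)).
Proof.
move=> mG; pose f z : \bar R := (G z)%:E.
have mf : measurable_fun setT f by exact/measurable_EFinP.
have mp := @measurable_fun_fubini_tonelli_F _ _ _ _ _ mu _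
  (measurable_funepos mf) (fun z => funepos_ge0 f z).
have mn := @measurable_fun_fubini_tonelli_F _ _ _ _ _ mu _
  (measurable_funeneg mf) (fun z => funeneg_ge0 f z).
rewrite (_ : (fun x => _) = fun x =>
  fine (fubini_F mu f^\+ x - fubini_F mu f^\- x)%E).
  by apply: measurableT_comp => //; exact: emeasurable_funB.
apply/funext => x; rewrite /Rintegral integralE /fubini_F.
by congr (fine (_ - _)%E); apply: eq_integral => y _; rewrite ?funeposE ?funenegE.
Qed.

End RintegralMeasurable.

Section Likelihood.
Context {R : realType} {n : nat} (s2 : R) (u : int -> R) (prior : 'cV[R]_n -> R).
Hypothesis n_gt0 : (0 < n)%N.
Hypothesis s2_gt0 : 0 < s2.

Definition gram N : 'M[R]_n := (Phi u N n)^T *m Phi u N n.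

Lemma gram_sym N : (gram N)^T = gram N.
Proof. by rewrite /gram trmx_mul trmxK. Qed.

Lemma sqnorm_Phi N (v : 'cV[R]_n) : sqnorm (Phi u N n *m v) = dot v (gram N *m v).
Proof. by rewrite sqnormE dot_mulmx mulmxA dotC. Qed.

(** The maximum of the likelihood. *)
Definition lik_factor N (y : 'cV[R]_N) : R := gauss_peak N s2 *
  expR (- (sqnorm (y - Phi u N n *m theta_ML u n y) / (2 * s2))).

Lemma lik_factor_gt0 N (y : 'cV[R]_N) : 0 < lik_factor y.
Proof. by rewrite mulr_gt0 ?expR_gt0 ?(gauss_peak_gt0 _ s2_gt0). Qed.

(** The residual of the maximum likelihood fit is orthogonal to the range of
    the regressor, so the likelihood is a Gaussian weight in the parameter
    centred at the maximum likelihood estimate. *)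
Lemma likelihoodE N (y : 'cV[R]_N) (theta : 'cV[R]_n) : gram N \in unitmx ->
  gauss_pdf s2 (Phi u N n *m theta) y =
  lik_factor y * gw (s2^-1 *: gram N) (theta - theta_ML u n y).
Proof.
move=> AU; set F := Phi u N n; set m := theta_ML u n y.
have FTr : F^T *m (y - F *m m) = 0.
  rewrite mulmxBr /m /theta_ML -/F !mulmxA.
  by rewrite -[F^T *m F]/(gram N) mulmxV// mul1mx subrr.
have -> : gauss_pdf s2 (F *m theta) y =
    gauss_peak N s2 * expR (- (sqnorm (y - F *m theta) / (2 * s2))) by [].
rewrite /lik_factor -/F -/m -mulrA -expRD; congr (_ * expR _).
have -> : y - F *m theta = (y - F *m m) - F *m (theta - m).
  by rewrite mulmxBr opprB addrA subrK.
move: (y - F *m m) (theta - m) FTr => r v FTr.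
have -> : sqnorm (r - F *m v) = sqnorm r + dot v (gram N *m v).
  rewrite -sqnorm_Phi -/F !sqnormE dotBl !dotBr [dot (F *m v) r]dotC.
  by rewrite [dot r (F *m v)]dot_mulmx FTr dot0l; ring.
by rewrite -scalemxAl dotZr; field; rewrite gt_eqF.
Qed.

Context (theta0 : 'cV[R]_n).
Hypothesis prior_ge0 : forall theta, 0 <= prior theta.
Hypothesis prior0_gt0 : 0 < prior theta0.

Definition rel_prior (theta : 'cV[R]_n) : R := prior theta / prior theta0.

Lemma rel_prior_ge0 theta : 0 <= rel_prior theta.
Proof. by rewrite divr_ge0. Qed.

(** The first summand puts the reference weight below the likelihood at sample
    size [n]; the other two put it below the standard Gaussian weight times
    [expR (- sqnorm h)], which absorbs quadratic polynomials. *)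
Definition ref_rate : R := n%:R ^+ 2 * `|gram n| / (2 * s2) + (2 * s2)^-1 + 1.

Lemma ref_rate_gt0 : 0 < ref_rate.
Proof.
by rewrite /ref_rate ltr_wpDl//; apply: addr_ge0; [apply: divr_ge0|]; nonneg.
Qed.

Let mu := lebesgueRn R n.

(** For noiseless data the likelihood is, up to a constant, a Gaussian weight
    centred at [theta0] exactly, so that integrability of its product with the
    prior passes to the reference weight. *)
Lemma rel_prior_int : bayes_integrable u s2 prior (Phi u n n *m theta0) ->
  wint mu (ref_weight theta0 ref_rate) (fun t => rel_prior (vec t)).
Proof.
move=> [I _].
pose y0 := Phi u n n *m theta0.
pose G (t : Rtuple R n) := gauss_pdf s2 (Phi u n n *m vec t) y0.
have GE t : G t = gauss_peak n s2 *
    expR (- (dot (vec t - theta0) (gram n *m (vec t - theta0)) / (2 * s2))).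
  rewrite /G -[LHS]/(gauss_peak n s2 *
    expR (- (sqnorm (y0 - Phi u n n *m vec t) / (2 * s2)))).
  by rewrite /y0 -mulmxBr sqnorm_Phi -(opprB (vec t)) mulmxN dotNl dotNr opprK.
have G0 t : 0 < G t by rewrite GE mulr_gt0 ?expR_gt0 ?(gauss_peak_gt0 _ s2_gt0).
have mGi : measurable_fun setT (fun t => (G t)^-1).
  rewrite (_ : (fun t => _) = fun t => (gauss_peak n s2)^-1 *
    expR (dot (vec t - theta0) (gram n *m (vec t - theta0)) / (2 * s2))).
    apply: measurable_funM => //; apply: measurableT_comp => //.
    apply: measurable_funM => //.
    apply: measurable_dot; first exact: mcv_centered.
    by apply: mcvM; [exact: mcv_cst | exact: mcv_centered].
  by apply/funext => t; rewrite GE invfM -expRN opprK.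
have mprior : measurable_fun setT (fun t : Rtuple R n => prior (vec t)).
  have [/measurable_EFinP mGp _] := integrableP _ _ _ I.
  rewrite (_ : (fun t : Rtuple R n => prior (vec t)) =
    fun t => (G t)^-1 * (G t * prior (vec t))).
    exact: measurable_funM.
  by apply/funext => t; rewrite mulKf// gt_eqF.
have I2 := integrableZl measurableT (gauss_peak n s2 * prior theta0)^-1 I.
apply: le_integrable I2 => //.
  apply/measurable_EFinP; apply: measurable_funM.
    by apply: measurable_funM.
  exact: measurable_ref_weight.
move=> t _ /=; rewrite lee_fin -/(G t).
have p0 := gauss_peak_gt0 n s2_gt0.
rewrite [leRHS]ger0_norm; last first.
  by apply: mulr_ge0; [rewrite invr_ge0; apply: mulr_ge0; exact: ltW |
    apply: mulr_ge0 => //; exact: ltW].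
rewrite ger0_norm; last by apply: mulr_ge0; [exact: rel_prior_ge0 | exact: expR_ge0].
have -> : (gauss_peak n s2 * prior theta0)^-1 * (G t * prior (vec t)) =
  rel_prior (vec t) * ((gauss_peak n s2)^-1 * G t).
  by rewrite /rel_prior; field; rewrite !gt_eqF.
rewrite ler_wpM2l ?rel_prior_ge0// GE mulKf ?gt_eqF// ler_expR lerN2.
set h := vec t - theta0.
have h1 : dot h (gram n *m h) <= n%:R ^+ 2 * `|gram n| * sqnorm h.
  apply: le_trans (ler_norm _) _; apply: le_trans (norm_quad_le _ _ _) _.
  have -> : n%:R ^+ 2 * `|gram n| * `|h| * `|h| = n%:R ^+ 2 * `|gram n| * `|h| ^+ 2.
    by ring.
  apply: ler_wpM2l; first by nonneg.
  exact: sqr_norm_le_sqnorm.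
apply: (@le_trans _ _ (n%:R ^+ 2 * `|gram n| * sqnorm h / (2 * s2))).
  by rewrite ler_wpM2r// invr_ge0 mulr_ge0// ltW.
have sh := sqnorm_ge0 h.
have s2i : 0 <= (2 * s2)^-1 by rewrite invr_ge0 mulr_ge0// ltW.
have -> : ref_rate * sqnorm h =
  n%:R ^+ 2 * `|gram n| * sqnorm h / (2 * s2) + ((2 * s2)^-1 + 1) * sqnorm h.
  by rewrite /ref_rate; ring.
by rewrite lerDl mulr_ge0// addr_ge0.
Qed.

Hypothesis std_int : mu.-integrable setT (fun t => (gw (s2^-1)%:M (vec t))%:E).

Lemma quad2_int (g : 'cV[R]_n) (M : 'M[R]_n) :
  wint mu (ref_weight theta0 ref_rate) (fun t => quad2 g M (vec t - theta0)).
Proof.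
have QC : (s2^-1)%:M *m s2%:M = 1%:M :> 'M[R]_n.
  by rewrite -scalar_mxM mulVf// gt_eqF.
have I := gw_mgf_int theta0 (tr_scalar_mx _ _) QC std_int 0.
pose D := 1 + n%:R * `|g| + n%:R ^+ 2 * `|M|.
have D0 : 0 <= D by apply: addr_ge0; [apply: addr_ge0 | ]; nonneg.
have ID := wintZ D I.
apply: le_integrable ID => //.
  apply/measurable_EFinP; apply: measurable_funM; last exact: measurable_ref_weight.
  have mh := @mcv_centered R n theta0.
  apply: measurable_funD; last first.
    apply: measurable_funM => //; apply: measurable_dot => //.
    by apply: mcvM => //; exact: mcv_cst.
  by apply: measurable_funD => //; apply: measurable_dot => //; exact: mcv_cst.
move=> t _ /=; rewrite lee_fin dot0l expR0 mulr1.
set h := vec t - theta0.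
rewrite normrM (ger0_norm (ref_weight_ge0 _ _ _)).
rewrite [leRHS]ger0_norm; last by rewrite mulr_ge0 ?gw_ge0.
have a0 : 0 <= `|h| by exact: normr_ge0.
have sh := sqnorm_ge0 h; have hs := sqr_norm_le_sqnorm h n_gt0.
have q : `|quad2 g M h| <= D * expR (sqnorm h).
  apply: (@le_trans _ _ (D * (1 + sqnorm h))); last first.
    by rewrite ler_wpM2l// expR_ge1Dx.
  have t1 := ler_normD (1 + dot g h) (dot h (M *m h) / 2).
  have t2 := ler_normD 1 (dot g h).
  have t3 := norm_dot_le g h; have t4 := norm_quad_le M h h.
  have h1 : `|h| <= 1 + sqnorm h.
    have := sqr_ge0 (2 * `|h| - 1).
    have -> : (2 * `|h| - 1) ^+ 2 = 4 * `|h| ^+ 2 - 4 * `|h| + 1 by ring.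
    by move: hs a0; lra.
  have t3' : n%:R * `|g| * `|h| <= n%:R * `|g| * (1 + sqnorm h).
    by rewrite ler_wpM2l// mulr_ge0.
  have M0 : 0 <= n%:R ^+ 2 * `|M| by nonneg.
  have t4' : n%:R ^+ 2 * `|M| * `|h| * `|h| <= n%:R ^+ 2 * `|M| * (1 + sqnorm h).
    have -> : n%:R ^+ 2 * `|M| * `|h| * `|h| = n%:R ^+ 2 * `|M| * `|h| ^+ 2 by ring.
    by apply: ler_wpM2l => //; move: hs; lra.
  have t5 : `|dot h (M *m h) / 2| <= `|dot h (M *m h)|.
    by rewrite normrM ler_piMr// ger0_norm// invf_le1// ler1n.
  rewrite normr1 in t2.
  rewrite /quad2 /D !mulrDl mul1r in t1 *; lra.
apply: (@le_trans _ _ (D * expR (sqnorm h) * ref_weight theta0 ref_rate t)).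
  by rewrite ler_wpM2r// expR_ge0.
rewrite -mulrA ler_wpM2l// /ref_weight /gw -expRD ler_expR -/h.
rewrite mul_scalar_mx dotZr -sqnormE.
have : ref_rate * sqnorm h = n%:R ^+ 2 * `|gram n| / (2 * s2) * sqnorm h +
  s2^-1 * sqnorm h / 2 + sqnorm h by rewrite /ref_rate; field; rewrite gt_eqF.
have : 0 <= n%:R ^+ 2 * `|gram n| / (2 * s2) * sqnorm h.
  apply: mulr_ge0 => //; apply: divr_ge0; first by nonneg.
  by apply: mulr_ge0 => //; exact: ltW.
lra.
Qed.

(** The posterior mean as a displacement of the maximum likelihood estimate;
    the factors not depending on the parameter cancel. *)
Lemma theta_Bayes_shift N (y : 'cV[R]_N) : gram N \in unitmx ->
  let m := theta_ML u n y in
  let w (t : Rtuple R n) := gw (s2^-1 *: gram N) (vec t - m) in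
  wint mu w (fun t => rel_prior (vec t)) ->
  (forall i, wint mu w (fun t => (vec t - m) i ord0 * rel_prior (vec t))) ->
  wI mu w (fun t => rel_prior (vec t)) != 0 ->
  theta_Bayes u s2 prior y = m + post_shift rel_prior (s2^-1 *: gram N) m.
Proof.
move=> AU m w Ip IXp Z0.
pose c := lik_factor y * prior theta0.
have c0 : c != 0 by rewrite mulf_neq0 ?gt_eqF ?lik_factor_gt0.
have fE t : gauss_pdf s2 (Phi u N n *m vec t) y * prior (vec t) =
    c * (rel_prior (vec t) * w t).
  by rewrite likelihoodE// /c /rel_prior /w -/m; field; rewrite gt_eqF.
apply/matrixP => i j.
rewrite (ord1 j) [LHS]mxE [RHS]mxE [post_shift _ _ _ _ _]mxE.
have -> : \int[mu]_t (gauss_pdf s2 (Phi u N n *m vec t) y * prior (vec t)) =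
    c * wI mu w (fun t => rel_prior (vec t)).
  by rewrite /wI -RintegralZl//; apply: eq_Rintegral => t _; rewrite fE.
have -> : \int[mu]_t (vec t i ord0 * (gauss_pdf s2 (Phi u N n *m vec t) y * prior (vec t))) =
    c * (m i ord0 * wI mu w (fun t => rel_prior (vec t)) +
         wI mu w (fun t => (vec t - m) i ord0 * rel_prior (vec t))).
  rewrite -wIZ// -wID//; last exact: wintZ.
  rewrite /wI -RintegralZl//; last by apply: wintD => //; exact: wintZ.
  apply: eq_Rintegral => t _; rewrite fE.
  by rewrite [(vec t - m) i ord0]mxE [(- m) i ord0]mxE; ring.
by rewrite -/m -/w; field; rewrite c0 Z0.
Qed.

End Likelihood.

Arguments gram {R} n u N.

(** * The maximum likelihood error and the expected excess loss *)

Section ExpectedLoss.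
Context {R : realType} {n : nat} (s2 : R) (theta0 : 'cV[R]_n) (u : int -> R).
Context {d : measure_display} {Omega : measurableType d} {P : probability Omega R}.
Context (E : forall N : nat, {RV P >-> Rtuple R N}).
Hypothesis n_gt0 : (0 < n)%N.
Hypothesis s2_gt0 : 0 < s2.
Context (kap kap' Lam : R).
Hypothesis kap_gt0 : 0 < kap.
Hypothesis Lam_gt0 : 0 < Lam.
Context (N : nat).
Hypothesis noise : gaussian_noise (E N) s2.
Hypothesis A_unit : gram n u N \in unitmx.

Let C : 'M[R]_n := s2 *: invmx (gram n u N).
Let Q : 'M[R]_n := s2^-1 *: gram n u N.
Hypothesis prec : precision kap kap' Lam N%:R Q C.

Definition ML_error (w : Omega) : 'cV[R]_n :=
  theta_ML u n (data u theta0 E N w) - theta0.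

Let L : 'M[R]_(n, N) := invmx (gram n u N) *m (Phi u N n)^T.

Lemma ML_errorE w : ML_error w = L *m vec (E N w).
Proof.
rewrite /ML_error /theta_ML /data -/L mulmxDr addrAC.
rewrite -[X in X - _ + _]/(L *m (Phi u N n *m theta0)) mulmxA.
rewrite (_ : L *m Phi u N n = 1%:M) ?mul1mx ?subrr ?add0r//.
by rewrite /L -mulmxA mulVmx.
Qed.

Let mE : mcv (fun w => vec (E N w)).
Proof. by move=> i j; exact: (measurableT_comp (mcv_vec i j)). Qed.

Lemma mcv_ML_error : mcv ML_error.
Proof.
rewrite (_ : ML_error = fun w => L *m vec (E N w)); last exact/funext/ML_errorE.
by apply: mcvM => //; exact: mcv_cst.
Qed.

Let dotL a w : dot a (ML_error w) = dot (L^T *m a) (vec (E N w)).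
Proof. by rewrite ML_errorE dot_mulmx. Qed.

Let LL a : s2 * dot (L^T *m a) (L^T *m a) = dot a (C *m a).
Proof.
rewrite -[in LHS](trmxK L) -dot_mulmx trmxK mulmxA /C -scalemxAl dotZr.
have -> : L *m L^T = invmx (gram n u N).
  rewrite /L trmx_mul trmxK mulmxA -(mulmxA _ _^T) -[_^T *m _]/(gram n u N).
  by rewrite mulVmx// mul1mx invmx_sym// gram_sym.
by [].
Qed.

Let mgf_int a : wint P (fun=> 1) (fun w => expR (dot a (ML_error w))).
Proof.
apply: eq_wint (noise_mgf_int s2_gt0 noise (L^T *m a)) => w.
by rewrite dotL.
Qed.

Let mgf a : wI P (fun=> 1) (fun w => expR (dot a (ML_error w))) =
  1 * expR (dot a (C *m a) / 2).
Proof.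
rewrite mul1r -LL -(noise_mgf s2_gt0 noise); apply: eq_wI => w.
by rewrite dotL.
Qed.

Let one (w : Omega) : R := 1.
Let w0 w : 0 <= one w. Proof. by []. Qed.
Let mw : measurable_fun setT one. Proof. exact: measurable_cst. Qed.
Let C_psd := prec_psd kap_gt0 prec.
Let C_sym := prec_Csym prec.
Let K0 : 0 <= (1 : R) := ler01.
Let wint1 := gaussian_wint1 mw mcv_ML_error mgf_int.
Let mass1 := gaussian_mass w0 mw mcv_ML_error C_psd K0 mgf_int mgf.

Lemma ML_wint_powsum k : wint P (fun=> 1) (fun w => powsum (ML_error w) k).
Proof. exact: (gaussian_wint_powsum mw mcv_ML_error mgf_int). Qed.

Lemma ML_powsum_le k : wI P (fun=> 1) (fun w => powsum (ML_error w) k) <=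
  @moment_cst R n k * (Lam / N%:R) ^+ k.
Proof.
have N0 : 0 < N%:R :> R := lt_le_trans ltr01 (prec_N prec).
have := @gaussian_powsum_le _ _ _ _ _ w0 mw n ML_error 1 C mcv_ML_error K0 mgf_int mgf
  (Lam / N%:R) k (divr_gt0 Lam_gt0 N0).
rewrite mulr1; apply => i; apply: le_trans (ler_norm _) _.
by apply: le_trans (coef_le_norm _ _ _) (prec_C prec).
Qed.

Context (g : 'cV[R]_n) (H : 'M[R]_n).

Let lossE w : excess_loss2 g H C (ML_error w) =
  2 * dot (C *m g) (ML_error w) +
  (2 * dot (ML_error w) ((C *m H) *m ML_error w) + sqnorm (C *m g) * 1).
Proof. by rewrite /excess_loss2 dotC mulmxA mulr1 addrA. Qed.

Let Idot : wint P (fun=> 1) (fun w => dot (C *m g) (ML_error w)).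
Proof. exact: (gaussian_wint_dot mw mcv_ML_error mgf_int). Qed.

Let Iquad : wint P (fun=> 1) (fun w => dot (ML_error w) ((C *m H) *m ML_error w)).
Proof. exact: (gaussian_wint_quad mw mcv_ML_error mgf_int). Qed.

Lemma wint_excess_loss2 :
  wint P (fun=> 1) (fun w => excess_loss2 g H C (ML_error w)).
Proof.
apply: eq_wint (wintD (wintZ 2 Idot)
  (wintD (wintZ 2 Iquad) (wintZ (sqnorm (C *m g)) wint1))) => w.
by rewrite lossE.
Qed.

Lemma wI_excess_loss2 : wI P (fun=> 1) (fun w => excess_loss2 g H C (ML_error w)) =
  2 * \tr (C *m H *m C) + sqnorm (C *m g).
Proof.
under eq_wI do rewrite lossE.
have I2 := wintZ 2 Iquad; have I3 := wintZ (sqnorm (C *m g)) wint1.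
rewrite (wID (wintZ 2 Idot) (wintD I2 I3)) (wID I2 I3) !wIZ//.
rewrite mass1 (gaussian_dot w0 mw mcv_ML_error C_psd K0 mgf_int mgf).
rewrite (gaussian_quad w0 mw mcv_ML_error C_sym C_psd K0 mgf_int mgf).
by ring.
Qed.

(** The error is a linear image of the noise and has covariance [C], so
    [excess_loss2] has an explicit mean, while moments of order four and six
    turn the pointwise bound of [risk_expansion] into one of order [N ^- 2] and
    [N ^- 3]. *)
Lemma expected_excess_loss (F : Omega -> R) (a ce : R) :
  0 <= a -> 0 <= ce -> measurable_fun setT F ->
  (forall w, `|F w - excess_loss2 g H C (ML_error w)| <=
    a * (N%:R^-1 + `|ML_error w| ^+ 2) ^+ 2 + ce * (N%:R^-1 + `|ML_error w| ^+ 2) ^+ 3) ->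
  wint P (fun=> 1) F /\
  `|wI P (fun=> 1) F - (2 * \tr (C *m H *m C) + sqnorm (C *m g))| <=
    a * (2 * (1 + @moment_cst R n 2 * Lam ^+ 2)) / N%:R ^+ 2 +
    ce * (4 * (1 + @moment_cst R n 3 * Lam ^+ 3)) / N%:R ^+ 3.
Proof.
move=> a0 ce0 mF hF.
have NR : 0 < N%:R :> R := lt_le_trans ltr01 (prec_N prec).
have I2 := ML_wint_powsum 2; have I3 := ML_wint_powsum 3.
pose b2 w := N%:R^-1 ^+ 2 * 1 + powsum (ML_error w) 2.
pose b3 w := N%:R^-1 ^+ 3 * 1 + powsum (ML_error w) 3.
have J2 : wint P (fun=> 1) b2 := wintD (wintZ _ wint1) I2.
have J3 : wint P (fun=> 1) b3 := wintD (wintZ _ wint1) I3.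
pose bd w := 2 * a * b2 w + 4 * ce * b3 w.
have Jbd : wint P (fun=> 1) bd := wintD (wintZ _ J2) (wintZ _ J3).
have pt w : `|F w - excess_loss2 g H C (ML_error w)| <= bd w.
  apply: le_trans (hF w) _.
  set i := N%:R^-1; set y := `|ML_error w| ^+ 2.
  have i0 : 0 <= i by rewrite invr_ge0 ltW.
  have y0 : 0 <= y by exact: exprn_ge0.
  have y2 : y ^+ 2 <= powsum (ML_error w) 2.
    by rewrite /y -exprM; exact: norm_le_powsum.
  have y3 : y ^+ 3 <= powsum (ML_error w) 3.
    by rewrite /y -exprM; exact: norm_le_powsum.
  have q2 : (i + y) ^+ 2 <= 2 * (i ^+ 2 + y ^+ 2).
    have := sqr_ge0 (i - y).
    have -> : (i - y) ^+ 2 = i ^+ 2 - 2 * (i * y) + y ^+ 2 by ring.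
    have -> : (i + y) ^+ 2 = i ^+ 2 + 2 * (i * y) + y ^+ 2 by ring.
    lra.
  have q3 : (i + y) ^+ 3 <= 4 * (i ^+ 3 + y ^+ 3).
    have h : 0 <= 3 * ((i + y) * (i - y) ^+ 2).
      by apply: mulr_ge0 => //; apply: mulr_ge0; [nonneg | exact: sqr_ge0].
    rewrite -subr_ge0; move: h; congr (0 <= _); ring.
  rewrite /bd /b2 /b3 !mulr1 lerD//.
    rewrite [2 * a]mulrC -mulrA ler_wpM2l//; apply: le_trans q2 _.
    by rewrite ler_wpM2l// lerD2l.
  rewrite [4 * ce]mulrC -mulrA ler_wpM2l//; apply: le_trans q3 _.
  by rewrite ler_wpM2l// lerD2l.
have Il := wint_excess_loss2.
have ID : wint P (fun=> 1) (fun w => F w - excess_loss2 g H C (ML_error w)).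
  apply: wint_le Jbd => //; apply: measurable_funB => //.
  have [/measurable_EFinP + _] := integrableP _ _ _ Il.
  by apply: eq_measurable_fun => w _; rewrite mulr1.
have IF : wint P (fun=> 1) F.
  by apply: eq_wint (wintD ID Il) => w; rewrite subrK.
split=> //.
rewrite -wI_excess_loss2 -wIB//.
apply: le_trans (wI_norm_le w0 ID Jbd pt) _.
have p2 := ML_powsum_le 2; have p3 := ML_powsum_le 3.
have E2 : wI P (fun=> 1) b2 = N%:R^-1 ^+ 2 + wI P (fun=> 1) (fun w => powsum (ML_error w) 2).
  by rewrite /b2 (wID (wintZ _ wint1) I2) wIZ// mass1 mulr1.
have E3 : wI P (fun=> 1) b3 = N%:R^-1 ^+ 3 + wI P (fun=> 1) (fun w => powsum (ML_error w) 3).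
  by rewrite /b3 (wID (wintZ _ wint1) I3) wIZ// mass1 mulr1.
rewrite /bd (wID (wintZ _ J2) (wintZ _ J3)) !wIZ// E2 E3.
apply: lerD.
  have -> : a * (2 * (1 + @moment_cst R n 2 * Lam ^+ 2)) / N%:R ^+ 2 =
    2 * a * (N%:R^-1 ^+ 2 + @moment_cst R n 2 * (Lam / N%:R) ^+ 2).
    by field; rewrite gt_eqF.
  by rewrite ler_wpM2l ?mulr_ge0// lerD2l.
have -> : ce * (4 * (1 + @moment_cst R n 3 * Lam ^+ 3)) / N%:R ^+ 3 =
  4 * ce * (N%:R^-1 ^+ 3 + @moment_cst R n 3 * (Lam / N%:R) ^+ 3).
  by field; rewrite gt_eqF.
by rewrite ler_wpM2l ?mulr_ge0// lerD2l.
Qed.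

End ExpectedLoss.

(** * Hyper-parameters, measurability and the limit functional *)

Section HyperParameterFree.
Context (R : realType) (n : nat) (u : int -> R) (theta0 : 'cV[R]_n).
Context (d : measure_display) (Omega : measurableType d).
Context (P : probability Omega R) (E : forall N, {RV P >-> Rtuple R N}).

Lemma cross_covariance0 (X Y : Omega -> 'cV[R]_n) : (forall w, Y w = 0) ->
  cross_covariance P X Y = 0.
Proof.
move=> Y0; apply/matrixP => i j; rewrite !mxE.
rewrite (_ : (fun w => Y w j ord0) = cst 0) ?covariance_cst_r//.
by apply/funext => w; rewrite Y0 mxE.
Qed.

(** With a one-point space of hyper-parameters, the estimators at the estimated
    and at the deterministic hyper-parameter coincide. *)
Lemma excess_var_HPE_unit (est : estimator R n) N :
  excess_var_HPE u theta0 E (fun _ : unit => est) (fun _ _ => tt) tt N = 0.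
Proof.
rewrite /excess_var_HPE /= cross_covariance0 ?trmx0 ?addr0 ?scaler0// => w.
by rewrite /hpe_change subrr.
Qed.

Lemma cvg_excess_var_HPE_unit (est : estimator R n) :
  excess_var_HPE u theta0 E (fun _ : unit => est) (fun _ _ => tt) tt @ \oo --> (0 : 'M[R]_n).
Proof.
rewrite (_ : excess_var_HPE _ _ _ _ _ _ = cst 0); first exact: cvg_cst.
by apply/funext => N; exact: excess_var_HPE_unit.
Qed.

End HyperParameterFree.

Section MeasurableShift.
Context {R : realType} {n : nat} (d : measure_display) (Omega : measurableType d).

Lemma mcv_post_shift (p : 'cV[R]_n -> R) (Q : 'M[R]_n) (m : Omega -> 'cV[R]_n) :
  measurable_fun setT (fun t : Rtuple R n => p (vec t)) -> mcv m ->
  (forall w, 0 < wI (lebesgueRn R n) (fun t => gw Q (vec t - m w)) (fun t => p (vec t))) ->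
  mcv (fun w => post_shift p Q (m w)).
Proof.
move=> mp mm Z0 i j; under eq_fun do rewrite mxE.
have mz : mcv (fun z : Omega * Rtuple R n => vec z.2 - m z.1).
  apply: mcvB => i' j'.
    exact: (measurableT_comp (mcv_vec i' j') measurable_snd).
  exact: (measurableT_comp (mm i' j') measurable_fst).
have mpz : measurable_fun setT (fun z : Omega * Rtuple R n => p (vec z.2)).
  exact: (measurableT_comp mp measurable_snd).
have mgz : measurable_fun setT (fun z : Omega * Rtuple R n => gw Q (vec z.2 - m z.1)).
  exact: measurable_gw.
apply: measurable_funM.
  have mnum := measurable_funM (measurable_funM (mz i ord0) mpz) mgz.
  exact: (measurable_Rintegral (lebesgueRn R n) mnum).
have mZ := measurable_Rintegral (lebesgueRn R n) (measurable_funM mpz mgz).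
(* The reciprocal of a positive function [f] is [expR (- ln f)]. *)
rewrite (_ : (fun w => _) = fun w => expR (- ln
    (wI (lebesgueRn R n) (fun t => gw Q (vec t - m w)) (fun t => p (vec t))))).
  apply: measurableT_comp => //; apply: measurableT_comp => //.
  exact: (measurableT_comp (@measurable_ln R)).
by apply/funext => w; rewrite expRN lnK// posrE.
Qed.

End MeasurableShift.

Section LimitFunctional.
Context {R : realType} {n : nat}.

(** The mean of [excess_loss2] when the error has covariance [C]; being quadratic
    in [C], it absorbs the factor [N ^+ 2]. *)
Definition limit_risk (g : 'cV[R]_n) (H C : 'M[R]_n) : R :=
  2 * \tr (C *m H *m C) + sqnorm (C *m g).

Lemma limit_riskZ g H C a : limit_risk g H (a *: C) = a ^+ 2 * limit_risk g H C.
Proof.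
rewrite /limit_risk -!scalemxAl -scalemxAr !linearZ/= !sqnormE dotZl dotZr.
by ring.
Qed.

Lemma cvg_limit_risk g H (C : nat -> 'M[R]_n) (C0 : 'M[R]_n) :
  C @ \oo --> C0 -> limit_risk g H (C N) @[N --> \oo] --> limit_risk g H C0.
Proof.
move=> CC0.
have cij i j : C N i j @[N --> \oo] --> C0 i j.
  exact: (cvg_comp _ _ CC0 (@coord_continuous _ _ _ i j C0)).
have E X : limit_risk g H X =
    2 * (\sum_i \sum_k (\sum_j X i j * H j k) * X k i) +
    \sum_i (\sum_j X i j * g j ord0) ^+ 2.
  rewrite /limit_risk; congr (_ * _ + _).
    by apply: eq_bigr => i _; rewrite mxE; apply: eq_bigr => k _; rewrite mxE.
  by apply: eq_bigr => i _; rewrite mxE.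
rewrite E; under eq_fun do rewrite E.
apply: cvgD.
  apply: cvgM; first exact: cvg_cst.
  apply: cvg_big_sum => i; apply: cvg_big_sum => k; apply: cvgM => //.
  by apply: cvg_big_sum => j; apply: cvgM => //; exact: cvg_cst.
apply: cvg_big_sum => i; under eq_fun do rewrite expr2; rewrite expr2.
by apply: cvgM; apply: cvg_big_sum => j; apply: cvgM => //; exact: cvg_cst.
Qed.

End LimitFunctional.

(** * The excess mean squared error *)

Section ExcessMSE.
Context (R : realType) (n : nat) (sigma2 : R)
  (theta0 : 'cV[R]_n) (u : int -> R) (Sigma : 'M[R]_n) (prior : 'cV[R]_n -> R)
  (d : measure_display) (Omega : measurableType d) (P : probability Omega R)
  (E : forall N : nat, {RV P >-> Rtuple R N}).
Hypothesis n_gt0 : (0 < n)%N.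
Hypothesis sigma2_gt0 : 0 < sigma2.
Hypothesis noise : forall N : nat, (n <= N)%N -> gaussian_noise (E N) sigma2.
Hypothesis Sigma_lim : (fun N : nat => N%:R^-1 *: ((Phi u N n)^T *m Phi u N n))
  @ \oo --> Sigma.
Hypothesis Sigma_posdef : posdefmx Sigma.
Hypothesis prior_ge0 : forall theta : 'cV[R]_n, 0 <= prior theta.
Hypothesis prior_gt0 : \forall theta \near theta0, 0 < prior theta.
Hypothesis log_prior_diff2 :
  twice_differentiable (fun theta => ln (prior theta)) theta0.
Hypothesis bayes_wd : forall (N : nat) (y : 'cV[R]_N), (n <= N)%N ->
  bayes_integrable u sigma2 prior y.

Let g := gradient (fun theta => ln (prior theta)) theta0.
Let H := symm (hessian (fun theta => ln (prior theta)) theta0).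
Let M := logM g H.
Let p := rel_prior prior theta0.
Let k0 := ref_rate sigma2 u (n := n).
Let est : estimator R n := theta_Bayes u sigma2 prior.
Let C N : 'M[R]_n := sigma2 *: invmx (gram n u N).
Let Q N : 'M[R]_n := sigma2^-1 *: gram n u N.
Let m N (w : Omega) := theta_ML u n (data u theta0 E N w).
Let x N := ML_error theta0 u E N.
Let F N (w : Omega) := excess_loss (x N w) (post_shift p (Q N) (m N w)).

Let prior0_gt0 : 0 < prior theta0.
Proof. exact: nbhs_singleton prior_gt0. Qed.

Let p_ge0 theta : 0 <= p theta.
Proof. exact: rel_prior_ge0. Qed.

Let H_sym : H^T = H. Proof. exact: tr_symm. Qed.

Let k0_gt0 : 0 < k0. Proof. exact: ref_rate_gt0. Qed.

Let std_int : (lebesgueRn R n).-integrable setT (fun t => (gw (sigma2^-1)%:M (vec t))%:E).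
Proof. exact: (std_weight_int sigma2_gt0 (noise (leqnn n))). Qed.

Let p_int : wint (lebesgueRn R n) (ref_weight theta0 k0) (fun t => p (vec t)).
Proof.
by apply: rel_prior_int => //; exact: bayes_wd.
Qed.

Let quad_int :
  wint (lebesgueRn R n) (ref_weight theta0 k0) (fun t => quad2 g M (vec t - theta0)).
Proof. exact: quad2_int. Qed.

Let taylor (eps : R) : 0 < eps -> exists2 r : R, 0 < r &
  forall h, `|h| <= r -> `|p (theta0 + h) - quad2 g M h| <= eps * `|h| ^+ 2.
Proof. exact: (prior_expansion prior_gt0 log_prior_diff2). Qed.

Let mp : measurable_fun setT (fun t : Rtuple R n => p (vec t)).
Proof. exact: (measurable_wint_ref p_int). Qed.

Let mx N : mcv (x N) -> mcv (m N).
Proof.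
move=> h; rewrite (_ : m N = fun w => x N w + theta0).
  by apply: mcvD => //; exact: mcv_cst.
by apply/funext => w; rewrite /x /ML_error subrK.
Qed.

(** For large samples the excess mean squared error is [N ^+ 2] times the mean of
    the excess loss [F], which [risk_expansion] and [expected_excess_loss]
    evaluate up to [o(N ^- 2)]. *)
Lemma excess_MSE_approx (e : R) : 0 < e -> \forall N \near \oo,
  exists v : R, excess_MSE u theta0 E est N = v%:E /\
    `|v - limit_risk g H (N%:R *: C N)| <= e.
Proof.
move=> e0.
have [kap [kap' [Lam [kap0 kap'0 Lam0 Hprec]]]] :=
  precision_eventually n_gt0 sigma2_gt0 (gram_sym u) Sigma_lim Sigma_posdef std_int.
have [c c0 hrisk] := risk_expansion n_gt0 kap0 kap'0 Lam0 k0_gt0 H_sym p_ge0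
  p_int quad_int taylor.
have [eta eta0 hlow] := taylor_lower taylor.
pose c2 := 2 * (1 + @moment_cst R n 2 * Lam ^+ 2).
pose c3 := 4 * (1 + @moment_cst R n 3 * Lam ^+ 3).
have c20 : 0 < c2.
  rewrite mulr_gt0// ltr_wpDr// mulr_ge0 ?moment_cst_ge0//.
  by apply: exprn_ge0; exact: ltW.
have c30 : 0 <= c3.
  rewrite mulr_ge0// addr_ge0// mulr_ge0 ?moment_cst_ge0//.
  by apply: exprn_ge0; exact: ltW.
(* The relative error of the pointwise expansion; [c2] and [c3] are the constants
   of [expected_excess_loss]. *)
pose eps := Num.min 1 (e / 2 / (c * c2)).
have eps0 : 0 < eps.
  by rewrite lt_min ltr01 /=; apply: divr_gt0; [exact: divr_gt0 | exact: mulr_gt0].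
have eps1 : eps <= 1 by rewrite ge_min lexx.
have epse : c * eps * c2 <= e / 2.
  have -> : c * eps * c2 = eps * (c * c2) by ring.
  rewrite -(ler_pdivlMr eps (e / 2) (mulr_gt0 c0 c20)).
  by rewrite /eps ge_min lexx orbT.
have [ce [Ns [ce0 hloss]]] := hrisk eps eps0 eps1.
pose B := Num.max (Num.max Ns (2 * (2 * n%:R * k0 + 1) / kap)) (2 * (ce * c3) / e).
have hB : \forall N \near \oo, B <= N%:R.
  exists (Num.bound `|B|) => // N /= hN.
  apply: le_trans (ler_norm _) _; apply: ltW; apply: lt_le_trans (archi_boundP _) _ => //.
  by rewrite ler_nat.
near=> N.
have nN : (n <= N)%N by near: N; exact: nbhs_infty_ge.
have [AU prec] : gram n u N \in unitmx /\
    precision kap kap' Lam N%:R (Q N) (C N) by near: N.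
have : B <= N%:R by near: N.
rewrite !ge_max => /andP[/andP[NNs Nkap] Nce].
have NR : 0 < N%:R :> R := lt_le_trans ltr01 (prec_N prec).
have hN : 2 * (2 * n%:R * k0 + 1) <= kap * N%:R by rewrite [leRHS]mulrC -ler_pdivrMr.
pose wt w (t : Rtuple R n) := gw (Q N) (vec t - m N w).
have Ip w : wint (lebesgueRn R n) (wt w) (fun t => p (vec t)).
  have : wint (lebesgueRn R n) (wt w) (fun t => 1 * p (vec t)).
    apply: (post_wint_prior kap0 k0_gt0 prec p_ge0 p_int hN) => // t.
    by rewrite normr1 lerDl mulr_ge0.
  by apply: eq_wint => t; rewrite mul1r.
have IXp w i : wint (lebesgueRn R n) (wt w) (fun t => (vec t - m N w) i ord0 * p (vec t)).
  apply: (post_wint_prior kap0 k0_gt0 prec p_ge0 p_int hN).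
    exact: mcv_centered.
  move=> t; apply: le_trans (coef_le_norm _ _ _) _.
  apply: (@le_trans _ _ (N%:R * `|vec t - m N w|)).
    by rewrite ler_peMl// (prec_N prec).
  by rewrite lerDr.
have Z0 w : 0 < wI (lebesgueRn R n) (wt w) (fun t => p (vec t)).
  apply: lt_le_trans (post_evidence_ge kap'0 prec p_ge0 eta0 _ hlow (Ip w)) => //.
  by rewrite !mulr_gt0 ?expR_gt0 ?exprn_gt0// mulr_gt0.
have mxN : mcv (x N) := mcv_ML_error theta0 E AU.
have mb : mcv (fun w => post_shift p (Q N) (m N w)).
  by apply: mcv_post_shift => //; exact: mx.
have mF : measurable_fun setT (F N).
  apply: measurable_funD; last exact: measurable_sqnorm.
  by apply: measurable_funM => //; exact: measurable_dot.
have hF w : `|F N w - excess_loss2 g H (C N) (x N w)| <=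
    c * eps * (N%:R^-1 + `|x N w| ^+ 2) ^+ 2 + ce * (N%:R^-1 + `|x N w| ^+ 2) ^+ 3.
  exact: hloss.
have ceps0 : 0 <= c * eps by rewrite mulr_ge0 ?(ltW c0) ?(ltW eps0).
have [IF EF] := expected_excess_loss n_gt0 sigma2_gt0 kap0 Lam0 (noise nN) AU prec
  ceps0 ce0 mF hF.
have Ix : wint P (fun=> 1) (fun w => sqnorm (x N w)).
  exact: (ML_wint_powsum theta0 sigma2_gt0 (noise nN) AU 1).
have MSE_ML : MSE u theta0 E (theta_ML u n) N =
    (wI P (fun=> 1) (fun w => sqnorm (x N w)))%:E.
  rewrite /MSE unlock /wI /Rintegral fineK; last exact: integrable_fin_num.
  by apply: eq_integral => w _; rewrite mulr1.
have MSE_B : MSE u theta0 E est N =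
    (wI P (fun=> 1) (fun w => sqnorm (x N w)) + wI P (fun=> 1) (F N))%:E.
  rewrite -wID// /MSE unlock /wI /Rintegral fineK; last first.
    by apply: integrable_fin_num => //; exact: wintD.
  apply: eq_integral => w _; rewrite mulr1; congr EFin.
  rewrite /est (theta_Bayes_shift sigma2_gt0 prior0_gt0 AU (Ip w) (IXp w)
    (lt0r_neq0 (Z0 w))).
  by rewrite -/p -/(Q N) addrAC -/(m N w) -/(x N w) sqnormD_excess.
exists (N%:R ^+ 2 * wI P (fun=> 1) (F N)); split.
  rewrite /excess_MSE MSE_ML MSE_B -EFinB -EFinM; congr EFin.
  by rewrite addrAC subrr add0r.
rewrite limit_riskZ -mulrBr normrM ger0_norm ?exprn_ge0//.
apply: (@le_trans _ _ (N%:R ^+ 2 * (c * eps * c2 / N%:R ^+ 2 + ce * c3 / N%:R ^+ 3))).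
  by rewrite ler_wpM2l ?exprn_ge0.
have -> : N%:R ^+ 2 * (c * eps * c2 / N%:R ^+ 2 + ce * c3 / N%:R ^+ 3) =
  c * eps * c2 + ce * c3 / N%:R by field; rewrite gt_eqF.
have hce : ce * c3 / N%:R <= e / 2.
  rewrite ler_pdivrMr//; move: Nce; rewrite ler_pdivrMr//; lra.
by move: epse hce; lra.
Unshelve. all: by end_near. Qed.

(** [N%:R *: C N] converges to [sigma2 *: invmx Sigma] and [limit_risk g H] is
    continuous. *)
Lemma excess_MSE_cvg : excess_MSE u theta0 E est @ \oo -->
  (limit_risk g H (sigma2 *: invmx Sigma))%:E.
Proof.
have [kap [kap' [Lam [kap0 kap'0 Lam0 Hprec]]]] :=
  precision_eventually n_gt0 sigma2_gt0 (gram_sym u) Sigma_lim Sigma_posdef std_int.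
have SU : Sigma \in unitmx.
  by apply: unitmx_pos => y y0; rewrite dot_mxE mulmxA; exact: Sigma_posdef.2.
have CL := cvg_limit_risk (g := g) (H := H) (covariance_limit Sigma_lim SU (ltW Lam0) Hprec).
apply: cvg_EFin.
  have := excess_MSE_approx ltr01; apply: filterS => N [v [-> _]].
  by [].
apply/cvgrPdist_le => e e0.
have e2 : 0 < e / 2 by rewrite divr_gt0.
move/cvgrPdist_le : CL => /(_ _ e2) CL.
near=> N.
have [v [vE hv]] : exists v : R, excess_MSE u theta0 E est N = v%:E /\
    `|v - limit_risk g H (N%:R *: C N)| <= e / 2.
  by near: N; exact: excess_MSE_approx.
have hL : `|limit_risk g H (sigma2 *: invmx Sigma) - limit_risk g H (N%:R *: C N)| <= e / 2.
  by near: N.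
rewrite /= vE /=.
have -> : limit_risk g H (sigma2 *: invmx Sigma) - v =
  (limit_risk g H (sigma2 *: invmx Sigma) - limit_risk g H (N%:R *: C N)) -
  (v - limit_risk g H (N%:R *: C N)) by ring.
by apply: le_trans (ler_normB _ _) _; rewrite [leRHS]splitr lerD.
Unshelve. all: by end_near. Qed.

(** Transposing under the trace replaces the symmetrized Hessian by the Hessian
    itself. *)
Lemma limit_riskE : limit_risk g H (sigma2 *: invmx Sigma) =
  sqnorm (XBias_Bayes sigma2 Sigma prior theta0) +
  \tr (XVar_Bayes sigma2 Sigma prior theta0).
Proof.
have Ssym : (invmx Sigma)^T = invmx Sigma.
  by apply: invmx_sym; exact: Sigma_posdef.1.
rewrite /limit_risk /XBias_Bayes [LHS]addrC /XVar_Bayes /XVar_sharp_Bayes.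
congr (_ + _); first by rewrite -scalemxAl.
rewrite mxtraceD mxtrace_tr.
set K := hessian _ _; set S := invmx Sigma in Ssym *.
have trK : \tr (S *m K^T *m S) = \tr (S *m K *m S).
  by rewrite -[RHS]mxtrace_tr !trmx_mul Ssym mulmxA.
rewrite -!scalemxAl -scalemxAr !mxtraceZ /H /symm -/K -scalemxAr -scalemxAl.
by rewrite mxtraceZ mulmxDr mulmxDl mxtraceD trK; field.
Qed.

End ExcessMSE.

Unset Implicit Arguments.
Set Strict Implicit.

Theorem corollary2p1 (R : realType) (n : nat) (sigma2 : R)
    (theta0 : 'cV[R]_n) (u : int -> R) (Sigma : 'M[R]_n)
    (prior : 'cV[R]_n -> R)
    (d : measure_display) (Omega : measurableType d) (P : probability Omega R)
    (E : forall N : nat, {RV P >-> Rtuple R N})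
    (n_gt0 : (0 < n)%N)
    (sigma2_gt0 : 0 < sigma2)
    (noise : forall N : nat, (n <= N)%N -> gaussian_noise (E N) sigma2)
    (causal : forall t : int, t < 0 -> u t = 0)
    (full_rank : forall N : nat, (n <= N)%N -> \rank (Phi u N n) = n)
    (Sigma_lim : (fun N : nat => N%:R^-1 *: ((Phi u N n)^T *m Phi u N n))
                   @ \oo --> Sigma)
    (Sigma_posdef : posdefmx Sigma)
    (prior_ge0 : forall theta : 'cV[R]_n, 0 <= prior theta)
    (prior_gt0 : \forall theta \near theta0, 0 < prior theta)
    (log_prior_diff2 :
       twice_differentiable (fun theta => ln (prior theta)) theta0)
    (bayes_wd : forall (N : nat) (y : 'cV[R]_N), (n <= N)%N ->
       bayes_integrable u sigma2 prior y) :
  let est : estimator R n := theta_Bayes u sigma2 prior in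
  let estH : unit -> estimator R n := fun _ => est in
  let eta_hat : forall N : nat, 'cV[R]_N -> unit := fun _ _ => tt in
  let XB := XBias_Bayes sigma2 Sigma prior theta0 in
  let XV := XVar_Bayes sigma2 Sigma prior theta0 in
  let XVH := XVarHPE u theta0 E estH eta_hat tt in
  [/\ cvgn (excess_MSE u theta0 E est),
      cvgn (excess_var_HPE u theta0 E estH eta_hat tt),
      XMSE u theta0 E est = (sqnorm XB + \tr XV + \tr XVH)%:E
    & \tr XVH = 0].
Proof.
move=> est estH eta_hat XB XV XVH.
have XVH0 : XVH = 0 by apply/cvg_lim => //; exact: cvg_excess_var_HPE_unit.
have cvgX := excess_MSE_cvg n_gt0 sigma2_gt0 noise Sigma_lim Sigma_posdef prior_ge0
  prior_gt0 log_prior_diff2 bayes_wd.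
have trXVH : \tr XVH = 0 by rewrite XVH0 linear0.
split=> //.
- by apply/cvg_ex; exists (limit_risk (gradient (fun theta => ln (prior theta)) theta0)
    (symm (hessian (fun theta => ln (prior theta)) theta0))
    (sigma2 *: invmx Sigma))%:E.
- by apply/cvg_ex; exists 0; exact: cvg_excess_var_HPE_unit.
- by rewrite trXVH addr0 -limit_riskE//; apply/cvg_lim.
Qed.
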